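(* Let $1<p<\infty$ and let $X=(X,d,\mu)$ be a complete metric space equipped with a doubling measure $\mu$ supporting a $p$-Poincaré inequality. Let $\Omega\subset X$ be a bounded domain with $C_p(X\setminus\Omega)>0$ and let $x_0\in\Omega$. Let $v$ be a singular function in $\Omega$ with singularity at $x_0$, and let $$\alpha=\begin{cases}\operatorname{cap}_p(\{x\in\Omega:v(x)\ge1\},\Omega)^{1/(1-p)},&\text{if }C_p(\{x_0\})=0,\\[1mm]\dfrac1{v(x_0)}\operatorname{cap}_p(\{x_0\},\Omega)^{1/(1-p)},&\text{if }C_p(\{x_0\})>0.\end{cases}$$ Then $u:=\alpha v$ is a Green function in $\Omega$ with singularity at $x_0$. Moreover, $$\operatorname{cap}_p(\Omega^b,\Omega_a)=(b-a)^{1-p}\quad\text{when }0\le a<b\le u(x_0),$$ where $\Omega^b=\{x\in\Omega:u(x)\ge b\}$, $\Omega_a=\{x\in\Omega:u(x)>a\}$ and $\infty^{1-p}$ is interpreted as $0$; and $\alpha$ is the unique number such that $\alpha v$ is a Green function.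
   Context: Setting: $X=(X,d,\mu)$ is a metric space with at least two points equipped with a positive complete Borel measure $\mu$ (defined on the completion of the Borel $\sigma$-algebra) with $0<\mu(B)<\infty$ for all balls $B$. A domain is a nonempty open connected set. Doubling: $\mu(B(x,2r))\le C_\mu\,\mu(B(x,r))$ for all balls. $p$-Poincaré inequality: there are $C_{PI}>0$, $\lambda\ge1$ such that $\frac1{\mu(B)}\int_B|u-u_B|\,d\mu\le C_{PI}\,r\bigl(\frac1{\mu(\lambda B)}\int_{\lambda B}g^p\,d\mu\bigr)^{1/p}$ for all balls $B=B(x,r)$, all integrable $u$ on $X$ and all $p$-weak upper gradients $g$ of $u$, where $u_B=\frac1{\mu(B)}\int_Bu\,d\mu$ and $\lambda B=B(x,\lambda r)$. Newtonian spaces: Curves are nonconstant, compact, rectifiable and parameterized by arc length $ds$. A measurable $g\colon X\to[0,\infty]$ is a $p$-weak upper gradient of $f\colon X\to[-\infty,\infty]$ if $|f(\gamma(0))-f(\gamma(l_\gamma))|\le\int_\gamma g\,ds$ for all curves $\gamma\colon[0,l_\gamma]\to X$ outside some family $\Gamma$ for which there is $0\le\rho\in L^p(X)$ with $\int_\gamma\rho\,ds=\infty$ for every $\gamma\in\Gamma$ (the left-hand side is $\infty$ if a term in it is $\pm\infty$). If $f$ has a $p$-weak upper gradient in $L^p_{\rm loc}(X)$, then $g_f$ denotes its a.e. unique minimal one. $N^{1,p}(X)$ is the set of measurable, everywhere defined $f\colon X\to[-\infty,\infty]$ with $\|f\|_{N^{1,p}(X)}^p=\int_X|f|^p\,d\mu+\inf_g\int_Xg^p\,d\mu<\infty$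 (infimum over $p$-weak upper gradients of $f$). For measurable $A\subset X$, $N^{1,p}(A)$ is defined by regarding $(A,d|_A,\mu|_A)$ as a metric space in its own right; for open $V$, $f\in N^{1,p}_{\rm loc}(V)$ if every $x\in V$ has a ball $B(x,r_x)\subset V$ with $f\in N^{1,p}(B(x,r_x))$. $N^{1,p}_0(V)$ is the set of restrictions to $V$ of $f\in N^{1,p}(X)$ with $f=0$ on $X\setminus V$ (such functions are regarded as extended by $0$). Capacities: $C_p(E)=\inf\|u\|_{N^{1,p}(X)}^p$ over $u\in N^{1,p}(X)$ with $u\ge1$ on $E$. For bounded $E\subset A$, $\operatorname{cap}_p(E,A)=\inf\int_Xg_u^p\,d\mu$ over $u\in N^{1,p}(X)$ with $u\ge1$ on $E$ and $u=0$ on $X\setminus A$ ($\infty$ if no such $u$). $p$-harmonicity: For open $V$, $u\in N^{1,p}_{\rm loc}(V)$ is a minimizer in $V$ if $\int_{\{\varphi\ne0\}}g_u^p\,d\mu\le\int_{\{\varphi\ne0\}}g_{u+\varphi}^p\,d\mu$ for all $\varphi\in N^{1,p}_0(V)$. A $p$-harmonic function is a (real-valued) continuous minimizer. For bounded open $G$ with $C_p(X\setminus G)>0$ and $f\in N^{1,p}(G)$, $H_Gf$ is the unique $p$-harmonic function in $G$ with $H_Gf-f\in N^{1,p}_0(G)$. A function $u\colon V\to(-\infty,\infty]$ is ($p$-)superharmonic in $V$ if it is lower semicontinuous, not identically $\infty$ in any component of $V$, and for every nonempty open $G$ whose closure is a compact subset of $V$ and with $C_p(X\setminus G)>0$, and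 every Lipschitz $v$ on $\overline G$ with $v\le u$ on $\partial G$, one has $H_Gv\le u$ in $G$. Singular function: a function $u\colon\Omega\to(0,\infty]$ is a singular function in $\Omega$ with singularity at $x_0$ if (S1) $u$ is superharmonic in $\Omega$; (S2) $u$ is $p$-harmonic in $\Omega\setminus\{x_0\}$; (S3) $u(x_0)=\sup_\Omega u$; (S4) $\inf_\Omega u=0$; (S5) $\tilde u\in N^{1,p}_{\rm loc}(X\setminus\{x_0\})$, where $\tilde u=u$ in $\Omega$ and $\tilde u=0$ on $X\setminus\Omega$. Green function: a singular function $u$ with $\operatorname{cap}_p(\Omega^b,\Omega)=b^{1-p}$ whenever $0<b<u(x_0)$, where $\Omega^b=\{x\in\Omega:u(x)\ge b\}$. *)

(* Defs.v *)
From HB Require Import structures.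
From mathcomp Require Import all_boot all_order all_algebra.
From mathcomp Require Import all_classical all_reals all_analysis.
(* not exported by all_analysis; provides the sigma-algebra of \bar R *)
From mathcomp Require Import measurable_realfun.

Set Implicit Arguments.
Unset Strict Implicit.
Unset Printing Implicit Defensive.

Import Order.TTheory GRing.Theory Num.Theory.
Import numFieldNormedType.Exports.

Local Open Scope classical_set_scope.
Local Open Scope ring_scope.

(* A metric space that also carries a sigma-algebra.  That this sigma-algebra
   is the mu-completion of the Borel one is [completed_borel] below. *)
#[short(type="measMetricType")]
HB.structure Definition MeasMetric (d : measure_display) (R : numDomainType) :=
  {T of Metric R T & Measurable d T}.

(* Powers of elements of [0, +oo].  The library's poweR has 0 `^ s = 0 and
   +oo `^ s = +oo for every s != 0, so negative exponents go through inve,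
   which satisfies 0^-1 = +oo and +oo^-1 = 0. *)
Definition epow (R : realType) (x : \bar R) (s : R) : \bar R :=
  (if (s < 0)%R then (x `^ (- s))^-1 else x `^ s)%E.

Section metric.
Context {R : realType} {X : metricType R}.

Definition complete_space := forall F : set_system X,
  ProperFilter F -> cauchy F -> exists x : X, F --> x.

Definition metric_bounded (A : set X) := exists x r, A `<=` ball x r.

Definition domain (A : set X) := [/\ A !=set0, open A & connected A].

Definition lipschitz_in (A : set X) (v : X -> R) :=
  exists L : R, forall x y, A x -> A y -> `|v x - v y| <= L * mdist x y.

Definition curve_length (gamma : R -> X) (a b : R) : \bar R :=
  ereal_sup [set (\sum_(0 <= i < size s)
    mdist (gamma (nth b (a :: s) i)) (gamma (nth b (a :: s) i.+1)))%:E
    | s in itv_partition a b].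

(* Only the values of gamma on [0, l] matter; l > 0 says that the curve is not
   constant, and the length condition makes gamma 1-Lipschitz on [0, l]. *)
Definition is_curve (A : set X) (gamma : R -> X) (l : R) :=
  [/\ 0 < l,
      gamma @` `[0, l]%classic `<=` A &
      forall t, 0 <= t <= l -> curve_length gamma 0 t = t%:E].

(* For nonnegative g the library's integral is the supremum of the integrals of
   the simple functions below g, so it is defined for every g and agrees with
   the integral for the completed Lebesgue measure if g \o gamma is Lebesgue
   measurable. *)
Definition curve_integral (g : X -> \bar R) (gamma : R -> X) (l : R) : \bar R :=
  (\int[lebesgue_measure]_(t in `[0%R, l]%classic) g (gamma t))%E.

End metric.

Section newtonian.
Context {R : realType} {d : measure_display} {X : measMetricType d R}.
Variables (mu : {measure set X -> \bar R}) (p : R).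
Implicit Types (A E V G : set X) (f g u phi : X -> \bar R).
Local Open Scope ereal_scope.

Definition completed_borel := forall A, measurable A <->
  exists B C, [/\ (<<s open >>) B, (<<s open >>) C,
    B `<=` A /\ A `<=` C & mu (C `\` B) = 0].

Definition balls_pos_finite := forall (x : X) (r : R), (0 < r)%R ->
  0 < mu (ball x r) < +oo.

Definition doubling := exists C : R, forall (x : X) (r : R), (0 < r)%R ->
  mu (ball x (2 * r)%R) <= C%:E * mu (ball x r).

(* A is regarded as a metric measure space in its own right in every
   definition below that has A as a parameter. *)

Definition exceptional A (Gamma : set ((R -> X) * R)) :=
  exists rho : X -> \bar R, [/\ measurable_fun A rho, forall x, A x -> 0 <= rho x,
    \int[mu]_(x in A) rho x `^ p < +oo &
    forall gamma l, is_curve A gamma l -> Gamma (gamma, l) ->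
      curve_integral rho gamma l = +oo].

(* As +oo - +oo = -oo in \bar R, `|f x - f y| is +oo as soon as f x or f y is
   infinite. *)
Definition weak_upper_gradient A f g :=
  [/\ measurable_fun A g, forall x, A x -> 0 <= g x &
    exists2 Gamma, exceptional A Gamma &
    forall gamma l, is_curve A gamma l -> ~ Gamma (gamma, l) ->
      `|f (gamma 0%R) - f (gamma l)| <= curve_integral g gamma l].

Definition Lp_loc A g := forall x, A x -> exists2 r : R, (0 < r)%R &
  \int[mu]_(y in A `&` ball x r) g y `^ p < +oo.

Definition is_minimal_wug A f g :=
  [/\ weak_upper_gradient A f g, Lp_loc A g &
    forall g', weak_upper_gradient A f g' -> Lp_loc A g' ->
      {ae mu, forall x, A x -> g x <= g' x}].

(* unique up to null sets and up to its values outside A *)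
Definition minimal_wug A f : X -> \bar R := xget (cst 0) (is_minimal_wug A f).

(* the p-th power of the Newtonian norm *)
Definition N1p_normp A f : \bar R :=
  \int[mu]_(x in A) `|f x| `^ p +
  ereal_inf [set \int[mu]_(x in A) g x `^ p | g in weak_upper_gradient A f].

Definition N1p A f := measurable_fun A f /\ N1p_normp A f < +oo.

Definition N1p_loc V f := forall x, V x -> exists r : R,
  [/\ (0 < r)%R, ball x r `<=` V & N1p (ball x r) f].

(* elements are represented by their extensions by 0 *)
Definition N1p0 V f := N1p setT f /\ forall x, ~ V x -> f x = 0.

Definition zero_ext V f : X -> \bar R := fun x => if x \in V then f x else 0.

Definition Cp E : \bar R :=
  ereal_inf [set N1p_normp setT u
    | u in [set u | N1p setT u /\ forall x, E x -> 1 <= u x]].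

Definition capp E A : \bar R :=
  ereal_inf [set \int[mu]_x (minimal_wug setT u x `^ p)
    | u in [set u | [/\ N1p setT u, forall x, E x -> 1 <= u x &
                        forall x, ~ A x -> u x = 0]]].

Definition poincare := exists CPI lambda : R,
  [/\ (0 < CPI)%R, (1 <= lambda)%R &
    forall (x : X) (r : R) u g, (0 < r)%R -> mu.-integrable setT u ->
      weak_upper_gradient setT u g ->
      let B := ball x r in
      let lB := ball x (lambda * r)%R in
      let uB := (mu B)^-1 * \int[mu]_(y in B) u y in
      (mu B)^-1 * \int[mu]_(y in B) `|u y - uB| <=
      CPI%:E * r%:E *
        ((mu lB)^-1 * \int[mu]_(y in lB) g y `^ p) `^ (p^-1)%R].

Definition minimizer V u := N1p_loc V u /\
  forall phi, N1p0 V phi ->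
    \int[mu]_(x in [set x | phi x != 0]) minimal_wug V u x `^ p <=
    \int[mu]_(x in [set x | phi x != 0]) minimal_wug V (u \+ phi) x `^ p.

Definition pharmonic V u :=
  [/\ forall x, V x -> u x \is a fin_num,
      {within V, continuous u} & minimizer V u].

(* The values outside G are irrelevant. *)
Definition Hext G f : X -> \bar R :=
  xget (cst 0) [set h | pharmonic G h /\ N1p0 G (zero_ext G (h \- f))].

Definition superharmonic V u :=
  [/\ forall x, V x -> -oo < u x,
      lower_semicontinuous (u : subspace V -> \bar R),
      forall x, V x -> exists2 y, connected_component V x y & u y != +oo &
      forall G (v : X -> R), G !=set0 -> open G -> compact (closure G) ->
        closure G `<=` V -> 0 < Cp (~` G) -> lipschitz_in (closure G) v ->
        (forall x, (closure G `\` G°) x -> (v x)%:E <= u x) ->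
        forall x, G x -> Hext G (EFin \o v) x <= u x].

Definition singular_function (Omega : set X) (x0 : X) u :=
  (forall x, Omega x -> 0 < u x) /\
  [/\ superharmonic Omega u,
      pharmonic (Omega `\ x0) u,
      u x0 = ereal_sup (u @` Omega),
      ereal_inf (u @` Omega) = 0 &
      N1p_loc (~` [set x0]) (zero_ext Omega u)].

Definition green_function (Omega : set X) (x0 : X) u :=
  singular_function Omega x0 u /\
  forall b : R, (0 < b)%R -> b%:E < u x0 ->
    capp [set x | Omega x /\ b%:E <= u x] Omega = epow b%:E (1 - p)%R.

(* Cp is nonnegative, so the second branch is the case of positive capacity. *)
Definition green_constant (Omega : set X) (x0 : X) (v : X -> \bar R) : \bar R :=
  if Cp [set x0] == 0
  then epow (capp [set x | Omega x /\ 1 <= v x] Omega) (1 - p)^-1%R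
  else (v x0)^-1 * epow (capp [set x0] Omega) (1 - p)^-1%R.

End newtonian.

(* Main.v *)
(* For 0 <= a < b the capacity of the condenser between the levels a and b of a
   singular function v equals (b - a)^-p times the energy of v in the layer
   {a < v < b}: the truncation of v is a competitor, and for every competitor w
   the p-harmonicity of v outside the pole, tested with (b - a) w minus the
   truncation, gives the converse.  Testing the same inequality with functions
   that are piecewise affine in v, the affine one being the minimizer, shows
   that the energy of a layer is Lambda (b - a) with a constant Lambda, which is
   positive by the Poincare inequality.  Hence the capacity is
   Lambda (b - a)^(1 - p), and alpha v is a Green function exactly for
   alpha = Lambda^(1 / (1 - p)).  The pole has zero capacity if and only if
   v is infinite there, so both cases of the normalization give this alpha.
   That alpha v is again singular needs the uniqueness of p-harmonic extensions,
   which follows from the strict convexity of the p-energy. *)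
Require Import Defs.
From HB Require Import structures.
From mathcomp Require Import all_boot all_order all_algebra.
From mathcomp Require Import all_classical all_reals all_analysis.
From mathcomp Require Import measurable_realfun.
From mathcomp Require Import ring lra.

Set Implicit Arguments.
Unset Strict Implicit.
Unset Printing Implicit Defensive.

Import Order.TTheory GRing.Theory Num.Theory.
Import numFieldNormedType.Exports.

Local Open Scope classical_set_scope.
Local Open Scope ring_scope.
Local Open Scope ereal_scope.

(** * Arcs *)

Section curves.
Context {R : realType} {X : metricType R}.
Implicit Types (A : set X) (g : R -> X) (s t r : R).

(** The definitions admit gradients that are measurable only for the completed sigma-algebra,
    functions with infinite values, and a [minimal_wug] and an [Hext] that are arbitrary choices
    with a default value. The calculus therefore runs on real functions with Borel gradients, which
    stay measurable along curves, and is translated back where the definitions are met. No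
    differentiation along curves is used: gluing, truncation and locality of gradients all come from
    one principle, that an oscillation estimate valid near every parameter of a curve holds on the
    whole curve. The obstacle in the main argument is that a singular function need not have finite
    energy near its pole and is infinite there when the pole has zero capacity. Everything is thus
    said about truncations at levels at most [v x0] and about test functions that vanish at the
    pole. A second obstacle is that a level set [{v = c}] might carry energy, so that layer energies
    are at first only superadditive; comparing the affine competitor with all others settles
    additivity and linearity at once. *)

Fixpoint polygon_length g (a : R) (w : seq R) : R :=
  if w is x :: w' then (mdist (g a) (g x) + polygon_length g x w')%R else 0%R.

(** The recursive sum makes partitions accessible to induction; the default value of [nth] is never
    reached. *)
Lemma polygon_lengthE g a b w :
  (\sum_(0 <= i < size w) mdist (g (nth b (a :: w) i)) (g (nth b (a :: w) i.+1)))%R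
  = polygon_length g a w.
Proof.
elim: w a => [|x w IH] a /=; first by rewrite big_nil.
by rewrite big_nat_recl//= IH.
Qed.

Lemma curve_lengthE g a b : curve_length g a b =
  ereal_sup [set (polygon_length g a w)%:E | w in itv_partition a b].
Proof.
rewrite /curve_length; congr ereal_sup; apply/seteqP; split=> _ [w pw <-];
  by exists w => //; rewrite polygon_lengthE.
Qed.

Lemma polygon_length_cat g a w w' : polygon_length g a (w ++ w') =
  (polygon_length g a w + polygon_length g (last a w) w')%R.
Proof. by elim: w a => [|x w IH] a /=; rewrite ?add0r// IH addrA. Qed.

(** Refining by [c] adds one vertex, and the triangle inequality compares the segment that it splits
    with the two new ones; a polygon that stops before [c] is only prolonged. *)
Lemma polygon_length_split g a c w : path <%R a w -> (a < c)%R ->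
  (polygon_length g a w <= polygon_length g a (itv_partitionL w c) +
                           polygon_length g c (itv_partitionR w c))%R.
Proof.
elim: w a => [|x w IH] a /=.
  by move=> _ ac; rewrite !addr0 mdist_ge0.
move=> /andP[ax pw] ac; rewrite /itv_partitionL /itv_partitionR/=.
have [xc|cx|xc] := ltgtP x c.
- by rewrite /= -addrA lerD2l IH.
- have pcw : path <%R c w by case: w pw {IH} => //= y w /andP[xy ->]; rewrite (lt_trans cx xy).
  rewrite unstable.path_lt_filter0//= unstable.path_lt_filterT//=.
  by rewrite addr0 addrA lerD2r metric_triangle.
- by subst x; rewrite unstable.path_lt_filter0//= unstable.path_lt_filterT//= addr0.
Qed.

Lemma polygon_length_map g (f : R -> R) a w :
  polygon_length g (f a) (map f w) = polygon_length (g \o f) a w.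
Proof. by elim: w a => //= x w IH a; rewrite IH. Qed.

Lemma itv_partition_shift (s a b : R) w : itv_partition a b w ->
  itv_partition (s + a)%R (s + b)%R (map (+%R s) w).
Proof.
move=> [pw /eqP <-]; split; last by rewrite last_map.
by rewrite path_map; apply: sub_path pw => x y /=; rewrite ltrD2l.
Qed.

Lemma curve_length_shift g s a b :
  curve_length (fun r => g (s + r)%R) a b = curve_length g (s + a) (s + b).
Proof.
rewrite !curve_lengthE; congr ereal_sup; apply/seteqP; split=> _ [w pw <-].
- exists (map (+%R s) w); first exact: itv_partition_shift.
  by rewrite (polygon_length_map g (+%R s)).
- have pw' := itv_partition_shift (- s) pw; rewrite !addKr in pw'.
  exists (map (+%R (- s)) w) => //.
  have := polygon_length_map (fun r => g (s + r)%R) (+%R (- s)) (s + a)%R w.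
  rewrite addKr => ->; congr (_ %:E).
  by congr polygon_length; apply/funext => r /=; rewrite addrA subrr add0r.
Qed.

Lemma curve_lengthxx g a : curve_length g a a = 0.
Proof.
rewrite curve_lengthE (_ : [set _ | _ in _] = [set 0]) ?ereal_sup1//.
apply/seteqP; split=> [_ [w /itv_partitionxx -> <-]//|_ ->].
by exists [::] => //; split=> /=.
Qed.

Lemma polygon_length_le g a b w : itv_partition a b w ->
  (polygon_length g a w)%:E <= curve_length g a b.
Proof. by move=> pw; rewrite curve_lengthE; apply: ereal_sup_ubound; exists w. Qed.

(** Refining by [b] gives one inequality and concatenating partitions the other. The first length is
    assumed finite so that it can be moved across inequalities in [\bar R]. *)
Lemma curve_lengthD g (a b c : R) (x : R) : (a <= b)%R -> (b <= c)%R ->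
  curve_length g a b = x%:E ->
  curve_length g a c = x%:E + curve_length g b c.
Proof.
rewrite le_eqVlt => /predU1P[->|ab].
  by rewrite curve_lengthxx => _ [<-]; rewrite add0e.
rewrite le_eqVlt => /predU1P[->|bc] xE.
  by rewrite curve_lengthxx adde0.
apply/eqP; rewrite eq_le; apply/andP; split.
  rewrite [X in X <= _]curve_lengthE; apply: ge_ereal_sup => _ [w pw <-].
  have [pa _] := pw.
  rewrite (le_trans (y := (polygon_length g a (itv_partitionL w b) +
       polygon_length g b (itv_partitionR w b))%:E))//.
    by rewrite lee_fin polygon_length_split.
  rewrite EFinD leeD//.
    by rewrite -xE; apply/polygon_length_le/(itv_partitionLP ab bc pw).
  exact/polygon_length_le/(itv_partitionRP ab bc pw).
rewrite -leeBrDl//.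
rewrite [X in X <= _]curve_lengthE; apply: ge_ereal_sup => _ [w pw <-].
rewrite leeBrDl// -leeBrDr// -xE [X in X <= _]curve_lengthE.
apply: ge_ereal_sup => _ [w' pw' <-].
rewrite leeBrDr// -EFinD.
have [_ /eqP lw'] := pw'.
rewrite -[X in polygon_length g X w]lw' -polygon_length_cat.
exact/polygon_length_le/(itv_partition_cat pw').
Qed.

(* A curve on an arbitrary parameter interval, so that subcurves need no
   reparametrization. *)
Definition arc A g s t := [/\ (s < t)%R,
  forall r, (s <= r <= t)%R -> A (g r) &
  forall r r', (s <= r)%R -> (r <= r')%R -> (r' <= t)%R ->
    curve_length g r r' = (r' - r)%:E].

(** The definition of a curve gives unit speed on initial intervals only; additivity of the length
    carries it to all subintervals. *)
Lemma is_curve_arc A g l : is_curve A g l -> arc A g 0 l.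
Proof.
move=> [l0 Ag len]; split => //.
  by move=> r rl; apply: Ag; exists r => //=; rewrite in_itv.
move=> r r' r0 rr' r'l.
have := @curve_lengthD g 0%R r r' r r0 rr' (len _ _).
rewrite r0 (le_trans rr' r'l) => /(_ isT).
rewrite len ?(le_trans r0 rr')//.
move=> /(congr1 (fun z => z - r%:E)); rewrite addeAC subee// add0e => <-.
by rewrite EFinB.
Qed.

Lemma arc_is_curve A g s t : arc A g s t ->
  is_curve A (fun r => g (s + r)%R) (t - s)%R.
Proof.
move=> [st Ag len]; split; first by rewrite subr_gt0.
  move=> _ [r /= + <-]; rewrite in_itv/= => /andP[r0 rts]; apply: Ag.
  by rewrite lerDl r0/= -lerBrDl.
move=> r /andP[r0 rts]; rewrite curve_length_shift addr0 len//.
- by rewrite addrC addKr.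
- by rewrite lerDl.
- by rewrite -lerBrDl.
Qed.

Lemma arc_sub A g s t s' t' : arc A g s t -> (s <= s')%R -> (s' < t')%R ->
  (t' <= t)%R -> arc A g s' t'.
Proof.
move=> [st Ag len] ss' st' tt'; split=> //.
  by move=> r /andP[r1 r2]; apply: Ag; rewrite (le_trans ss' r1) (le_trans r2 tt').
by move=> r r' r1 r2 r3; apply: len => //; [exact: le_trans r1|exact: le_trans tt'].
Qed.

Lemma arc_in A B g s t : arc A g s t -> (forall r, (s <= r <= t)%R -> B (g r)) ->
  arc B g s t.
Proof. by move=> []. Qed.

Lemma polygon_length_eq g g' a b w : itv_partition a b w ->
  (forall r, (a <= r <= b)%R -> g r = g' r) ->
  polygon_length g a w = polygon_length g' a w.
Proof.
elim: w a => //= x w IH a pw gg'.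
have /itv_partition_size_neq0 -/(_ isT) ab := pw.
have /itv_partition_cons pw' := pw; have xb := itv_partition_le pw'.
have /andP[ax _] : (a < x)%R && path <%R x w by case: pw.
rewrite !gg' ?lexx ?(ltW ab) ?(ltW ax)// IH// => r /andP[xr rb].
by apply: gg'; rewrite rb (le_trans (ltW ax)).
Qed.

Lemma arc_eq A g g' s t : arc A g s t ->
  (forall r, (s <= r <= t)%R -> g r = g' r) -> arc A g' s t.
Proof.
move=> [st Ag len] gg'; split=> // [r hr|r r' sr rr' r't].
  by rewrite -gg'//; exact: Ag.
rewrite -(len r r')// !curve_lengthE; congr ereal_sup.
by apply/seteqP; split=> _ [w pw <-]; exists w => //; congr (_%:E);
  [|apply/esym]; apply: (polygon_length_eq pw) => x /andP[rx xr']; apply: gg';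
  rewrite (le_trans sr rx) (le_trans xr' r't).
Qed.

Lemma arc_lip A g s t r r' : arc A g s t -> (s <= r <= t)%R -> (s <= r' <= t)%R ->
  (mdist (g r) (g r') <= `|r - r'|)%R.
Proof.
move=> [st _ len].
wlog rr' : r r' / (r <= r')%R => [H|] hr hr'.
  have [/H|/ltW/H] := leP r r'; first exact.
  by rewrite metric_sym distrC; exact.
move: rr'; rewrite le_eqVlt => /predU1P[->|rr']; first by rewrite mdistxx.
move: hr hr' => /andP[sr rt] /andP[sr' rt'].
rewrite distrC ger0_norm ?subr_ge0 ?(ltW rr')//.
have := @polygon_length_le g r r' [:: r'] (itv_partition1 rr').
by rewrite (len _ _ sr (ltW rr') rt') /= addr0 lee_fin.
Qed.

Lemma arc_open A g s t r (V : set X) : arc A g s t -> (s <= r <= t)%R ->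
  open V -> V (g r) -> exists2 e : R, (0 < e)%R &
  forall r', (s <= r' <= t)%R -> (`|r' - r| < e)%R -> V (g r').
Proof.
move=> arcg hr oV Vg.
have /nbhs_ballP[e /= e0 eV] := open_nbhs_nbhs (conj oV Vg).
exists e => // r' hr' r'r; apply: eV; rewrite ballEmdist /=.
by apply: le_lt_trans r'r; rewrite distrC (arc_lip arcg).
Qed.

(** Freezing the parameter outside [[s, t]] yields a curve that is continuous on the whole line, so
    its compositions with Borel functions are measurable without reference to the interval. *)
Lemma arc_continuous A g s t : arc A g s t ->
  exists2 g' : R -> X, continuous g' & forall r, (s <= r <= t)%R -> g r = g' r.
Proof.
move=> arcg; have [st _ _] := arcg.
pose c r := Num.max s (Num.min r t).
have hc r : (s <= c r <= t)%R.
  by rewrite /c le_max lexx/= ge_max (ltW st) ge_min lexx orbT.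
have c_lip r r' : (`|c r - c r'| <= `|r - r'|)%R.
  wlog rr' : r r' / (r <= r')%R => [H|].
    by have [/H//|/ltW/H] := leP r r'; rewrite distrC (distrC r).
  rewrite distrC (distrC r) (ger0_norm (x := r' - r)) ?subr_ge0//.
  by rewrite ler_norml /c; rewrite /Num.max /Num.min; repeat case: ifPn; lra.
exists (g \o c); last first.
  by move=> r /andP[sr rt]; rewrite /= /c (min_idPl rt) (max_idPr sr).
move=> r; apply/cvg_ballP => e e0 /=; near=> r'.
rewrite ballEmdist/= (le_lt_trans (arc_lip arcg (hc _) (hc _)))//.
apply: le_lt_trans (c_lip _ _) _.
by near: r'; apply: cvgr_dist_lt => //; exact: cvg_id.
Unshelve. all: by end_near. Qed.
End curves.

(** * Absolute continuity of integrals and estimates on intervals *)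

Section nonnegative_integrals.
Context {d : measure_display} {T : measurableType d} {R : realType}.
Variable mu : {measure set T -> \bar R}.
Implicit Types (k : T -> \bar R) (D B : set T).

(** A nonnegative function with finite integral is finite almost everywhere, which reduces the claim
    to the absolute continuity of the integral of the real function [f]. *)
Lemma ge0_integral_abs_continuous k D (e : R) :
  measurable_fun setT k -> (forall x, 0 <= k x) -> measurable D ->
  \int[mu]_(x in D) k x < +oo -> (0 < e)%R ->
  exists2 del : R, (0 < del)%R & forall B, measurable B -> B `<=` D ->
    mu B < del%:E -> \int[mu]_(x in B) k x < e%:E.
Proof.
move=> mk k0 mD kD e0.
have mkD : measurable_fun setT (k \_ D).
  by apply/(measurable_restrictT _ _).1 => //; exact: measurable_funS mk.
have kD0 x : 0 <= (k \_ D) x by exact: erestrict_ge0.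
have ikD : mu.-integrable setT (k \_ D).
  apply/integrableP; split=> //.
  rewrite (eq_integral (k \_ D)); last by move=> x _; rewrite gee0_abs.
  by rewrite -integral_mkcond.
pose f x := fine ((k \_ D) x).
have mf : measurable_fun setT f by exact: measurableT_comp.
have [N [mN N0 Nk]] := integrable_ae measurableT ikD.
have fk : ae_eq mu setT (k \_ D) (EFin \o f).
  exists N; split => // x /= nx; apply: Nk => /= fx; apply: nx => _.
  by rewrite /f fineK// fx.
have f0 x : (0 <= f x)%R by exact: fine_ge0.
have intf : mu.-integrable setT (EFin \o f).
  apply/integrableP; split; first exact/measurable_EFinP.
  rewrite (eq_integral (EFin \o f)); last by move=> x _; rewrite /= ger0_norm.
  rewrite -(ge0_ae_eq_integral measurableT _ _ _ _ fk)//.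
  - by rewrite -integral_mkcond.
  - exact/measurable_EFinP.
  - by move=> x _; rewrite lee_fin.
have [r [r0 re]] := integral_normr_continuous intf e0.
exists r => // B mB BD /re => /(_ mB).
rewrite -lte_fin; apply: le_lt_trans; rewrite /Rintegral fineK; last first.
  rewrite ge0_fin_numE ?integral_ge0//.
  have /integrableP[_] := intf; apply: le_lt_trans.
  by apply: ge0_subset_integral => //=; exact/measurable_EFinP/measurableT_comp.
rewrite (eq_integral (k \_ D)); last first.
  by move=> x; rewrite inE => /BD Dx; rewrite patchE mem_set.
rewrite (ge0_ae_eq_integral (g := EFin \o f)) => //.
- apply: ge0_le_integral => //=.
  + by move=> x _; rewrite lee_fin.
  + exact/measurable_EFinP/measurable_funTS.
  + exact/measurable_EFinP/measurableT_comp/measurable_funTS.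
  + by move=> x _; rewrite lee_fin ler_norm.
- exact: measurable_funTS.
- by apply/measurable_EFinP; exact: measurable_funTS.
- by move=> x _; rewrite lee_fin.
- exact: ae_eq_subset fk.
Qed.

End nonnegative_integrals.

Section integrals_on_intervals.
Context {R : realType}.
Local Notation lam := (@lebesgue_measure R).
Implicit Types (k : R -> \bar R) (s t r : R) (F : R -> R).

(** The image of Lebesgue measure under the translation gives intervals their length, so it is
    Lebesgue measure by uniqueness. *)
Lemma ge0_integral_shift k (s a b : R) :
  measurable_fun setT k -> (forall r, 0 <= k r) ->
  \int[lam]_(r in `[a, b]) k (s + r)%R = \int[lam]_(r in `[(s + a)%R, (s + b)%R]) k r.
Proof.
move=> mk k0.
have ms : measurable_fun setT (+%R s : R -> measurableTypeR R).
  exact: measurable_funD.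
have pre u v (b0 b1 : bool) : +%R s @^-1` [set` Interval (BSide b0 (s + u)%R) (BSide b1 (s + v)%R)]
    = [set` Interval (BSide b0 u) (BSide b1 v)].
  by apply/seteqP; split=> r /=; rewrite !in_itv /=; case: b0; case: b1; rewrite /= ?ltrD2l ?lerD2l.
transitivity (\int[pushforward lam (+%R s : R -> measurableTypeR R)]_(r in `[(s + a)%R, (s + b)%R]) k r).
  rewrite ge0_integral_pushforward//; first by rewrite pre.
  exact: measurable_funTS.
apply: eq_measure_integral => A mA _.
apply/esym/lebesgue_measure_unique => //= _ [[x y]] _ <-.
rewrite /pushforward -[x](subrKC s) -[y](subrKC s) pre !lebesgue_measure_itv/=.
by rewrite !lte_fin ltrD2l; case: ifP => // _; rewrite -!EFinB; congr (_%:E); lra.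
Qed.

Lemma ge0_integral_itvD k s r t : (s <= r)%R -> (r <= t)%R ->
  measurable_fun setT k -> (forall r, 0 <= k r) ->
  \int[lam]_(x in `[s, t]) k x =
  \int[lam]_(x in `[s, r]) k x + \int[lam]_(x in `[r, t]) k x.
Proof.
move=> sr rt mk k0.
rewrite -[X in _ + X]integral_itv_obnd_cbnd; last exact: measurable_funTS.
rewrite (@itv_bndbnd_setU _ _ _ (BRight r)) ?bnd_simp// ge0_integral_setU//=.
  exact: measurable_funTS.
apply/disj_setPRL => x /=; rewrite !in_itv/= => /andP[rx _] /andP[_].
by rewrite leNgt rx.
Qed.

(** Let [c] be the supremum of the set [S] of parameters up to which the estimate from [s] holds. A
    point of [S] just below [c] reaches across [c] by the local estimate, so [S] contains [c] and,
    unless [c = t], also points beyond it. *)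
Lemma local_to_global F k s t : (s <= t)%R ->
  measurable_fun setT k -> (forall r, 0 <= k r) ->
  (forall r, (s <= r <= t)%R -> exists2 e : R, (0 < e)%R &
     forall r1 r2, (s <= r1)%R -> (r1 < r2)%R -> (r2 <= t)%R ->
       (`|r1 - r| < e)%R -> (`|r2 - r| < e)%R ->
       `|F r1 - F r2|%:E <= \int[lam]_(x in `[r1, r2]) k x) ->
  `|F s - F t|%:E <= \int[lam]_(x in `[s, t]) k x.
Proof.
move=> st mk k0 H.
pose S := [set r | (s <= r <= t)%R /\ `|F s - F r|%:E <= \int[lam]_(x in `[s, r]) k x].
have Ss : S s by split; rewrite ?lexx// subrr normr0; exact: integral_ge0.
have hS : has_sup S.
  by split; [exists s|exists t => r [/andP[]]].
pose c := sup S.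
have sc : (s <= c)%R by apply: ub_le_sup => //; case: hS.
have ct : (c <= t)%R by apply: ge_sup => [|r [/andP[]]]; first by exists s.
have [|e e0 He] := H c; first by rewrite sc.
have [r Sr] := sup_adherent e0 hS; rewrite -/c => cer.
have rc : (r <= c)%R by apply: ub_le_sup => //; case: hS.
have [/andP[sr rt] Fr] := Sr.
pose r2 := Num.min t (c + e / 2)%R.
have ext r' : (r <= r')%R -> (r' <= t)%R -> (`|r' - c| < e)%R -> S r'.
  rewrite le_eqVlt => /predU1P[<-//|rr'] r't r'c.
  have rce : (`|r - c| < e)%R by rewrite ler0_norm ?subr_le0//; lra.
  have := He _ _ sr rr' r't rce r'c => Hr.
  split; first by rewrite r't (le_trans sr (ltW rr')).
  rewrite (@ge0_integral_itvD _ _ r)// ?(ltW rr')//.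
  apply: le_trans (leeD Fr Hr); rewrite -EFinD lee_fin.
  exact: ler_distD.
have r2t : (r2 <= t)%R by rewrite /r2 ge_min lexx.
have r2ce : (r2 <= c + e / 2)%R by rewrite /r2 ge_min lexx orbT.
have cr2 : (c <= r2)%R by rewrite /r2 le_min ct/=; lra.
have Sr2 : S r2.
  by apply: ext => //; [exact: le_trans rc _|rewrite ger0_norm ?subr_ge0//; lra].
have : (r2 <= c)%R by apply: ub_le_sup => //; case: hS.
rewrite {1}/r2 ge_min => /orP[tc|h]; last by move: h; rewrite gerDl leNgt divr_gt0.
have tE : t = c by apply/eqP; rewrite eq_le tc ct.
suff : S t by case.
by apply: ext; rewrite ?lexx// tE subrr normr0.
Qed.
End integrals_on_intervals.

(** * Almost every arc *)

Section newtonian_calculus.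
Context {R : realType} {d : measure_display} {X : measMetricType d R}.
Variables (mu : {measure set X -> \bar R}) (p : R).
Hypothesis p_gt1 : (1 < p)%R.
Hypothesis mu_borel : completed_borel mu.
Implicit Types (A B V N : set X) (f : X -> R) (h g rho : X -> \bar R).
Local Notation lam := (@lebesgue_measure R).
Local Notation borelType := (g_sigma_algebraType (@open X)).

Let p_gt0 : (0 < p)%R. Proof. exact: lt_trans p_gt1. Qed.
Let p_neq0 : p != 0%R. Proof. by rewrite gt_eqF. Qed.

Definition borel_set B := (<<s @open X >>) B.

(** Measurability for the Borel sigma-algebra and not for its completion: only this is preserved
    under composition with a continuous curve. *)
Definition borel_fun h := measurable_fun [set: borelType] (h : borelType -> \bar R).

Lemma borel_set_measurable B : borel_set B -> measurable B.
Proof. move=> bB; apply/mu_borel; exists B, B; rewrite setDv measure0; split=> //; split; exact: subset_refl. Qed.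

Lemma open_borel_set B : open B -> borel_set B.
Proof. exact: sub_sigma_algebra. Qed.

Lemma open_measurable B : open B -> measurable B.
Proof. by move=> oB; apply: borel_set_measurable; exact: open_borel_set. Qed.

Lemma closed_borel_set B : closed B -> borel_set B.
Proof.
move=> cB; rewrite -[B]setCK; apply: (@measurableC _ borelType).
by apply: open_borel_set; exact: closed_openC.
Qed.

Lemma borel_fun_measurable h D : borel_fun h -> measurable_fun D h.
Proof.
move=> bh; apply: measurable_funTS => mD Y mY.
by apply: borel_set_measurable; exact: bh.
Qed.

Lemma borel_fun_patch h B : borel_fun h -> borel_set B -> borel_fun (h \_ B).
Proof.
by move=> bh bB; apply/(measurable_restrictT _ _).1 => //; exact: measurable_funTS.
Qed.

Lemma continuous_borel (c : R -> X) : continuous c ->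
  measurable_fun setT (c : measurableTypeR R -> borelType).
Proof.
move=> cc; apply: (@measurability _ _ _ borelType _ _ (@open X)) => // _ [V oV <-].
by rewrite setTI; apply: measurable_realfun.open_measurable; apply: open_comp => // *; exact: cc.
Qed.

Lemma borel_set_preimage N (c : R -> X) : continuous c -> borel_set N ->
  measurable (c @^-1` N).
Proof.
by move=> /continuous_borel mc bN; have := mc measurableT N bN; rewrite setTI.
Qed.

Lemma borel_fun_comp h (c : R -> X) : continuous c -> borel_fun h ->
  measurable_fun setT (h \o c).
Proof. by move=> /continuous_borel mc bh; exact: measurableT_comp bh mc. Qed.

Lemma null_borel_cover B : measurable B -> mu B = 0 ->
  exists2 N, borel_set N & B `<=` N /\ mu N = 0.
Proof.
move=> mB; move: (mB) => /mu_borel [B1 [N [bB1 bN [B1B BN] NB1]]] B0.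
have B10 : mu B1 = 0.
  by apply: (subset_measure0 _ mB B1B B0); exact: borel_set_measurable.
exists N => //; split=> //; rewrite -(setDUK (subset_trans B1B BN)) measureU0//.
- exact: borel_set_measurable.
- by apply: measurableD; exact: borel_set_measurable.
Qed.

(* P holds on almost every arc in the sense of the p-modulus. *)
Definition aearc A (P : (R -> X) -> R -> R -> Prop) :=
  exists rho, [/\ borel_fun rho, forall x, 0 <= rho x,
    \int[mu]_(x in A) rho x `^ p < +oo &
    forall c s t, continuous c -> arc A c s t ->
      \int[lam]_(r in `[s, t]) rho (c r) < +oo -> P c s t].

Lemma measurable_pow h D : measurable_fun D h -> measurable_fun D (fun x => h x `^ p).
Proof. by move=> mh; exact: (measurableT_comp (measurable_poweR p)). Qed.

Lemma borel_fun_pow h (q : R) : borel_fun h -> borel_fun (fun x => h x `^ q).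
Proof. by move=> mh; exact: (measurableT_comp (measurable_poweR q)). Qed.

Lemma le_poweR (x y : \bar R) (q : R) : (0 <= q)%R -> 0 <= x -> x <= y -> x `^ q <= y `^ q.
Proof.
move=> q0 x0 xy; apply: gt0_ler_poweR => //; rewrite in_itv/= ?leey ?andbT//.
exact: le_trans xy.
Qed.

Lemma poweRpK (x : \bar R) : 0 <= x -> (x `^ p^-1) `^ p = x.
Proof. by move=> x0; rewrite -poweRrM mulVf// poweRe1. Qed.

Lemma poweRKp (x : \bar R) : 0 <= x -> (x `^ p) `^ p^-1 = x.
Proof. by move=> x0; rewrite -poweRrM mulfV// poweRe1. Qed.

Lemma aearc_mono A P Q : aearc A P ->
  (forall c s t, continuous c -> arc A c s t -> P c s t -> Q c s t) -> aearc A Q.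
Proof.
move=> [rho [brho rho0 irho H]] PQ; exists rho; split=> // c s t cc ac fin.
by apply: PQ => //; exact: H.
Qed.

Lemma aearcT A (P : (R -> X) -> R -> R -> Prop) :
  (forall c s t, continuous c -> arc A c s t -> P c s t) -> aearc A P.
Proof.
move=> H; exists (cst 0); split=> //; last by move=> c s t cc ac _; exact: H.
  exact: measurable_cst.
by rewrite integral0_eq// => x _; rewrite poweR0r.
Qed.

(** Countable subadditivity of the p-modulus. Up to a positive factor, each [rho n] lies below the
    p-th root of the weighted sum [S] of p-th powers, so an arc on which that root is integrable is
    good for every [n]. *)
Lemma aearc_countable A (P : nat -> (R -> X) -> R -> R -> Prop) : measurable A ->
  (forall n, aearc A (P n)) -> aearc A (fun c s t => forall n, P n c s t).
Proof.
move=> mA /choice[rho H].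
have brho n : borel_fun (rho n) by have [] := H n.
have rho0 n x : 0 <= rho n x by have [] := H n.
(* The weight times the energy of [rho n] is at most 1 / 2^(n + 1); the added 1 keeps the
   denominator positive. *)
pose a n := ((2 ^ n.+1)%:R^-1 / (fine (\int[mu]_(x in A) rho n x `^ p) + 1))%R.
have a0 n : (0 < a n)%R.
  by rewrite /a divr_gt0// ?invr_gt0// ?ltr0n ?expn_gt0// ltr_wpDl// fine_ge0// integral_ge0// => x _; exact: poweR_ge0.
pose S x := \sum_(0 <= n <oo) ((a n)%:E * rho n x `^ p).
have S0 x : 0 <= S x by apply: nneseries_ge0 => n _ _; rewrite mule_ge0 ?poweR_ge0// lee_fin ltW.
have bS : borel_fun S.
  apply: ge0_emeasurable_sum => [n x _ _|n _].
    by rewrite mule_ge0 ?poweR_ge0// lee_fin ltW.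
  by apply: measurable_funeM; exact: borel_fun_pow.
exists (fun x => S x `^ p^-1); split.
- exact: borel_fun_pow.
- by move=> x; exact: poweR_ge0.
- rewrite (eq_integral S); last by move=> x _; rewrite poweRpK.
  rewrite integral_nneseries//; last 2 first.
  + by move=> n; apply: measurable_funeM; exact/measurable_pow/borel_fun_measurable.
  + by move=> n x _; rewrite mule_ge0 ?poweR_ge0// lee_fin ltW.
  apply: (@le_lt_trans _ _ (\sum_(0 <= n <oo) (1 / (2 ^ n.+1)%:R)%:E)); last first.
    by rewrite (le_lt_trans (epsilon_trick0 _ _))// ltry.
  apply: lee_nneseries => [n _ _|n _].
    by apply: integral_ge0 => x _; rewrite mule_ge0 ?poweR_ge0// lee_fin ltW.
  have [_ _ fin _] := H n.
  rewrite ge0_integralZl_EFin//; last 3 first.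
  + by move=> x _; exact: poweR_ge0.
  + exact/measurable_pow/borel_fun_measurable.
  + exact: ltW.
  have i0 : 0 <= \int[mu]_(x in A) rho n x `^ p by apply: integral_ge0 => x _; exact: poweR_ge0.
  rewrite -(fineK (x := \int[mu]_(x in A) rho n x `^ p)) ?ge0_fin_numE// -EFinM lee_fin /a.
  set m := fine _; have m0 : (0 <= m)%R by exact: fine_ge0.
  rewrite mul1r -mulrA ler_piMr ?invr_ge0//.
  by rewrite mulrC ler_pdivrMr ?mul1r ?lerDl// ltr_wpDl.
- move=> c s t cc ac fin n.
  have [_ _ _] := H n; apply => //.
  have an0 : (0 < a n `^ p^-1)%R by exact: powR_gt0.
  suff : (a n `^ p^-1)%:E * \int[lam]_(r in `[s, t]) rho n (c r) < +oo.
    have : 0 <= \int[lam]_(r in `[s, t]) rho n (c r) by exact: integral_ge0.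
    case: (\int[lam]_(r in `[s, t]) rho n (c r)) => // [r _ _|]; first exact: ltry.
    by rewrite gt0_muley ?lte_fin// ltxx.
  apply: le_lt_trans fin.
  rewrite -ge0_integralZl_EFin//; last 2 first.
  + by apply: measurable_funTS; exact: (borel_fun_comp cc).
  + exact: ltW.
  apply: ge0_le_integral => //.
  + by move=> x _; rewrite mule_ge0// lee_fin ltW.
  + by apply: measurable_funTS; apply: measurable_funeM; exact: (borel_fun_comp cc).
  + by apply: measurable_funTS; exact: (borel_fun_comp cc (borel_fun_pow p^-1 bS)).
  + move=> x _.
    rewrite -[rho n (c x)]poweRKp// -poweR_EFin -poweRM ?lee_fin ?(ltW (a0 n)) ?poweR_ge0//.
    apply: le_poweR; first by rewrite invr_ge0 ltW.
      by rewrite mule_ge0 ?poweR_ge0// lee_fin ltW.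
    rewrite /S (nneseriesD1 (n := n))//; last first.
      by move=> k _; rewrite mule_ge0 ?poweR_ge0// lee_fin ltW.
    rewrite leeDl//; apply: nneseries_ge0 => k _ _.
    by rewrite mule_ge0 ?poweR_ge0// lee_fin ltW.
Qed.

Lemma aearcI A P Q : measurable A -> aearc A P -> aearc A Q ->
  aearc A (fun c s t => P c s t /\ Q c s t).
Proof.
move=> mA aP aQ.
have := @aearc_countable A (fun n => if n is 0%N then P else Q) mA.
move=> /(_ _)/aearc_mono; apply; first by case.
by move=> c s t _ _ H; split; [exact: (H 0%N)|exact: (H 1%N)].
Qed.

(** The integral of [rho] over a subarc is at most that over the arc, so one exceptional family
    serves all subarcs. *)
Lemma aearc_subarc A P : aearc A P -> aearc A (fun c s t => forall s' t',
  (s <= s')%R -> (s' < t')%R -> (t' <= t)%R -> P c s' t').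
Proof.
move=> [rho [brho rho0 irho H]]; exists rho; split=> // c s t cc ac fin s' t' ss st tt.
apply: H => //; first exact: arc_sub ac _ _ _.
apply: le_lt_trans fin; apply: ge0_subset_integral => //=.
  by apply: measurable_funTS; exact: (borel_fun_comp cc).
by apply: subset_itv; rewrite bnd_simp.
Qed.

Lemma aearc_subset A B P : measurable A -> measurable B -> B `<=` A -> aearc A P -> aearc B P.
Proof.
move=> mA mB BA [rho [brho rho0 irho H]]; exists rho; split=> //.
  apply: le_lt_trans irho; apply: ge0_subset_integral => //.
    exact/measurable_pow/borel_fun_measurable.
  by move=> x _; exact: poweR_ge0.
move=> c s t cc ac; apply: H => //.
by apply: (arc_in ac) => r hr; apply: BA; case: ac => _ + _; apply.
Qed.

(** Arcs that stay in [V] do not notice that [rho] is replaced by 0 off [V], and this makes its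
    energy over [A] finite. *)
Lemma aearc_open A V P : measurable A -> open V -> aearc V P ->
  aearc A (fun c s t => (forall r, (s <= r <= t)%R -> V (c r)) -> P c s t).
Proof.
move=> mA oV [rho [brho rho0 irho H]]; exists (rho \_ V); split.
- by apply: borel_fun_patch => //; exact: open_borel_set.
- by move=> x; exact: erestrict_ge0.
- apply: le_lt_trans irho.
  rewrite (eq_integral ((fun x => rho x `^ p) \_ V)); last first.
    by move=> x _; rewrite !patchE; case: ifP => //; rewrite poweR0r.
  rewrite -integral_mkcondr; apply: ge0_subset_integral => //.
  + by apply: measurableI => //; exact: open_measurable.
  + exact: open_measurable.
  + exact/measurable_pow/borel_fun_measurable.
  + by move=> x _; exact: poweR_ge0.
- move=> c s t cc ac fin cV; apply: H => //; first exact: arc_in ac cV.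
  apply: le_lt_trans fin; rewrite le_eqVlt; apply/orP; left; apply/eqP.
  apply: eq_integral => r; rewrite inE/= in_itv/= => /cV Vr.
  by rewrite patchE mem_set.
Qed.

Lemma aearc_finite A h : borel_fun h -> (forall x, 0 <= h x) ->
  \int[mu]_(x in A) h x `^ p < +oo ->
  aearc A (fun c s t => \int[lam]_(r in `[s, t]) h (c r) < +oo).
Proof. by move=> bh h0 ih; exists h; split. Qed.

Lemma aearc_null A N : borel_set N -> mu (A `&` N) = 0 -> measurable A ->
  aearc A (fun c s t => lam (`[s, t] `&` c @^-1` N) = 0).
Proof.
move=> bN AN0 mA; exists (cst +oo \_ N); split.
- by apply: borel_fun_patch => //; exact: measurable_cst.
- by move=> x; apply: erestrict_ge0 => *; exact: leey.
- rewrite (eq_integral (cst +oo \_ N)); last first.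
    by move=> x _; rewrite !patchE; case: ifP => _; rewrite ?poweRyr ?poweR0r.
  rewrite -integral_mkcondr integral_cst//; last by apply: measurableI => //; exact: borel_set_measurable.
  by rewrite AN0 mule0.
- move=> c s t cc ac.
  have mN : measurable (c @^-1` N) by exact: borel_set_preimage.
  have -> : \int[lam]_(r in `[s, t]) (cst +oo \_ N) (c r) = +oo * lam (`[s, t] `&` c @^-1` N).
    rewrite -integral_cst//; last exact: measurableI.
    rewrite integral_mkcondr; apply: eq_integral => r _; rewrite !patchE /=.
    by congr (if _ then _ else _); apply/idP/idP; rewrite !inE.
  have [->//|l0] := eqVneq (lam (`[s, t] `&` c @^-1` N)) 0.
  by rewrite gt0_mulye ?ltxx// lt0e l0/=.
Qed.

(** The integral of a nonnegative function is a supremum over the simple functions below it, hence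
    monotone without measurability. The curve integrals in [weak_upper_gradient] call for this,
    since a measurable gradient composed with a curve may fail to be measurable. *)
Lemma ge0_le_integral_nomeas d' (T : measurableType d') (nu : {measure set T -> \bar R})
  (D : set T) (f1 f2 : T -> \bar R) : (forall x, D x -> 0 <= f1 x) ->
  (forall x, D x -> f1 x <= f2 x) -> \int[nu]_(x in D) f1 x <= \int[nu]_(x in D) f2 x.
Proof.
move=> f10 f12; rewrite !ge0_integralE//; last by move=> x Dx; apply: le_trans (f12 _ Dx); exact: f10.
apply: le_ereal_sup => _ [h hf1 <-]; exists h => // x; apply: le_trans (hf1 x) _.
by rewrite !patchE; case: ifPn => //; rewrite inE => /f12.
Qed.

(** Each superlevel set at a rational level is covered by a Borel set [C q] with null excess. The
    majorant takes at [x] the supremum of the levels [q] with [x] in [C q]; it exceeds [h] only on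
    the countable union of the excesses. *)
Lemma borel_majorant h : measurable_fun setT h -> (forall x, 0 <= h x) ->
  exists h', [/\ borel_fun h', forall x, h x <= h' x &
    exists2 N, borel_set N & mu N = 0 /\ forall x, ~ N x -> h' x = h x].
Proof.
move=> mh h0.
have /choice[C HC] (q : rat) : exists C, [/\ borel_set C, [set x | (ratr q)%:E < h x] `<=` C &
    mu (C `\` [set x | (ratr q)%:E < h x]) = 0].
  have /mu_borel[B [C [bB bC [BE EC] CB]]] : measurable [set x | (ratr q)%:E < h x].
    by rewrite -[X in measurable X]setTI; exact: emeasurable_fun_o_infty.
  exists C; split => //.
  have mB := borel_set_measurable bB; have mC := borel_set_measurable bC.
  apply: (subset_measure0 _ (measurableD mC mB) _ CB); last by move=> x [Cx nEx]; split=> // /BE.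
  apply: measurableD => //; rewrite -[X in measurable X]setTI; exact: emeasurable_fun_o_infty.
(* Negative levels count as 0, as does every [n] that codes no rational; this is harmless since [h]
   is nonnegative. *)
pose hq n := if unpickle n is Some q then cst (Num.max 0 (ratr q : R))%:E \_ (C q) else cst 0.
have bhq n : borel_fun (hq n).
  rewrite /hq; case: unpickle => [q|]; last exact: measurable_cst.
  by apply: borel_fun_patch; [exact: measurable_cst|case: (HC q)].
have hq0 n x : 0 <= hq n x.
  rewrite /hq; case: unpickle => [q|]//; rewrite patchE; case: ifP => // _.
  by rewrite lee_fin le_max lexx.
pose h' x := esups (hq ^~ x) 0%N.
have hh' x : h x <= h' x.
  rewrite leNgt; apply/negP => hh.
  have h'0 : 0 <= h' x by apply: le_trans (hq0 0%N x) _; apply: ereal_sup_ubound; exists 0%N.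
  have [q h'q qh] : exists2 q : rat, h' x < (ratr q)%:E & (ratr q)%:E < h x.
    move: h'0 hh; case: (h' x) => [r r0|_|//]; last by rewrite ltNge leey.
    case: (h x) => [r'||//].
      rewrite lte_fin => /rat_in_itvoo[q]; rewrite in_itv/= => /andP[? ?].
      by exists q; rewrite lte_fin.
    have : (r < r + 1)%R by rewrite ltrDl.
    by move=> /rat_in_itvoo[q]; rewrite in_itv/= => /andP[? ?] _; exists q; rewrite ?lte_fin ?ltry.
  have : hq (pickle q) x <= h' x by apply: ereal_sup_ubound; exists (pickle q).
  rewrite /hq pickleK patchE mem_set; last by case: (HC q) => _ + _; apply.
  by rewrite leNgt => /negP; apply; apply: (lt_le_trans h'q); rewrite lee_fin le_max lexx orbT.
exists h'; split=> //; first exact: measurable_fun_esups.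
- pose N := \bigcup_n (if unpickle n is Some q then C q `\` [set x | (ratr q)%:E < h x] else set0).
  have mN n : measurable (if unpickle n is Some q then C q `\` [set x | (ratr q)%:E < h x] else set0).
    case: unpickle => // q; apply: measurableD; first by apply: borel_set_measurable; case: (HC q).
    by rewrite -[X in measurable X]setTI; exact: emeasurable_fun_o_infty.
  have [|M bM [NM M0]] := @null_borel_cover N (bigcupT_measurable _ mN).
    apply/eqP; rewrite -measure_le0 (le_trans (measure_sigma_subadditive mu mN (bigcupT_measurable _ mN) _))//.
    rewrite eseries0// => n _ _; case: unpickle => [q|]; last by rewrite measure0.
    by case: (HC q).
  exists M => //; split=> // x nMx; apply/eqP; rewrite eq_le; rewrite hh' andbT.
  apply: ge_ereal_sup => _ [n _ <-]; rewrite /hq.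
  case E : unpickle => [q|] //; rewrite patchE; case: ifPn => //; rewrite inE => Cq.
  have qh : (ratr q)%:E < h x.
    apply: contrapT => nqh; apply: nMx; apply: NM; exists n => //.
    by rewrite E; split.
  move: qh; rewrite /Num.max; case: ifP => //  _; exact: ltW.
Qed.

(* A form of weak_upper_gradient for finite functions whose Borel gradients are
   measurable along every curve; see pwug_wug and wug_pwug. *)
Definition pwug A f g := [/\ borel_fun g, forall x, 0 <= g x &
  aearc A (fun c s t => `|f (c s) - f (c t)|%:E <= \int[lam]_(r in `[s, t]) g (c r))].

Definition Lp A g := \int[mu]_(x in A) g x `^ p < +oo.

Lemma pwug_wug A f g : measurable A -> pwug A f g -> weak_upper_gradient mu p A (EFin \o f) g.
Proof.
move=> mA [bg g0 [rho [brho rho0 irho H]]]; split=> //.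
  exact: borel_fun_measurable.
(* All curves along which [rho] has infinite integral are declared exceptional; the remaining ones
   satisfy the condition of [aearc]. *)
exists [set cl | curve_integral rho cl.1 cl.2 = +oo].
  exists rho; split => //; exact: borel_fun_measurable.
move=> c l cl /= nrho; have ac := is_curve_arc cl.
have [c' cc' cE] := arc_continuous ac.
have l0 : (0 <= l)%R by case: ac => /ltW.
have cint h : \int[lam]_(r in `[0%R, l]) h (c' r) = curve_integral h c l.
  by apply: eq_integral => r; rewrite inE/= in_itv/= => rl; rewrite cE.
rewrite -(cint g) (cE 0%R) ?lexx// (cE l) ?lexx ?andbT//.
apply: (H _ _ _ cc'); first exact: (arc_eq ac).
by rewrite cint ltey; apply/eqP.
Qed.

(** Both the gradient and the function [rho] that witnesses the exceptional family are replaced by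
    Borel majorants. This can only raise their curve integrals, and it does not change their
    energies, as the majorants agree with them almost everywhere on [A]. *)
Lemma wug_pwug A (F : X -> \bar R) f g : open A -> weak_upper_gradient mu p A F g ->
  (forall x, A x -> F x = (f x)%:E) ->
  exists g', [/\ pwug A f g', forall x, A x -> g x <= g' x &
    {ae mu, forall x, A x -> g' x = g x}].
Proof.
move=> oA [mg g0 [Gam [rho [mrho rho0 irho Grho]] H]] Ff.
have mA := open_measurable oA.
have patch0 h x : (forall x, A x -> 0 <= h x) -> 0 <= (h \_ A) x.
  by move=> h0; exact: erestrict_ge0.
have [g' [bg' gg' [N bN [N0 Ng']]]] := @borel_majorant (g \_ A)
  ((measurable_restrictT _ mA).1 mg) (fun x => patch0 g x g0).
have [r' [br' rr' [N' bN' [N'0 Nr']]]] := @borel_majorant (rho \_ A)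
  ((measurable_restrictT _ mA).1 mrho) (fun x => patch0 rho x rho0).
have patchA h x : A x -> (h \_ A) x = h x by move=> Ax; rewrite patchE mem_set.
have g'0 x : 0 <= g' x by apply: le_trans (gg' x); exact: patch0.
have r'0 x : 0 <= r' x by apply: le_trans (rr' x); exact: patch0.
exists g'; split.
- split=> //; exists r'; split=> //.
    apply: le_lt_trans irho; apply: ae_ge0_le_integral => //.
    + by move=> x _; exact: poweR_ge0.
    + exact/measurable_pow/borel_fun_measurable.
    + by move=> x _; exact: poweR_ge0.
    + exact/measurable_pow.
    + exists N'; split=> //; first exact: borel_set_measurable.
      move=> x /= nx; apply: contrapT => nN; apply: nx => Ax.
      by rewrite Nr'// patchA.
  move=> c s t cc ac fin.
  have shift h : borel_fun h -> (forall x, 0 <= h x) ->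
     \int[lam]_(r in `[s, t]) h (c r) = curve_integral h (fun r => c (s + r)%R) (t - s)%R.
    move=> bh h0; rewrite /curve_integral.
    rewrite (ge0_integral_shift s 0 (t - s)%R (borel_fun_comp cc bh) (fun r => h0 (c r))).
    by rewrite addr0 (addrC s) subrK.
  have cl := arc_is_curve ac.
  have cA r : (`[0%R, (t - s)%R]%classic : set R) r -> A (c (s + r)%R).
    by move=> rl; case: cl => _ + _; apply; exists r.
  have := H _ _ cl; rewrite /= addr0 (addrC s) subrK.
  rewrite !Ff; [|by case: ac => st Ac _; apply: Ac; rewrite lexx ltW..].
  move=> Hc; apply: le_trans (Hc _) _.
    move=> Gc; have := Grho _ _ cl Gc => rhooo.
    move: fin; rewrite shift// ltNge => /negP; apply.
    rewrite -rhooo; apply: ge0_le_integral_nomeas => r /cA Ar; first exact: rho0.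
    by apply: le_trans (rr' _); rewrite patchA.
  rewrite shift//; apply: ge0_le_integral_nomeas => r /cA Ar; first exact: g0.
  by apply: le_trans (gg' _); rewrite patchA.
- by move=> x Ax; apply: le_trans (gg' _); rewrite patchA.
- exists N; split=> //; first exact: borel_set_measurable.
  move=> x /= nx; apply: contrapT => nN; apply: nx => Ax.
  by rewrite Ng'// patchA.
Qed.

(** * Calculus of weak upper gradients *)

Lemma pwugI A f g : measurable A -> pwug A f g ->
  aearc A (fun c s t => forall s' t', (s <= s')%R -> (s' <= t')%R -> (t' <= t)%R ->
    `|f (c s') - f (c t')|%:E <= \int[lam]_(r in `[s', t']) g (c r)).
Proof.
move=> mA [bg g0 /aearc_subarc/aearc_mono]; apply => c s t cc ac H s' t' ss.
rewrite le_eqVlt => /predU1P[<- _|]; last exact: H.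
by rewrite subrr normr0; apply: integral_ge0.
Qed.

Lemma pwug_map A f f' g : pwug A f g ->
  (forall x y, A x -> A y -> (`|f' x - f' y| <= `|f x - f y|)%R) -> pwug A f' g.
Proof.
move=> [bg g0 H] ff'; split=> //; apply: aearc_mono H _ => c s t cc ac; apply: le_trans.
by case: ac => st Ac _; rewrite lee_fin ff'//; apply: Ac; rewrite lexx ltW.
Qed.

Lemma pwug_eq A f f' g : pwug A f g -> (forall x, A x -> f x = f' x) -> pwug A f' g.
Proof. by move=> H ff'; apply: (pwug_map H) => x y Ax Ay; rewrite !ff'. Qed.

Lemma pwug_cst A (a : R) : pwug A (cst a) (cst 0).
Proof.
split=> //; first exact: measurable_cst.
by apply: aearcT => c s t _ _; rewrite subrr normr0 integral_ge0.
Qed.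

Lemma pwug_lipschitz A f (L : R) : (0 <= L)%R ->
  (forall x y, A x -> A y -> (`|f x - f y| <= L * mdist x y)%R) ->
  pwug A f (cst L%:E).
Proof.
move=> L0 lf; split; first exact: measurable_cst.
  by move=> x; rewrite lee_fin.
apply: aearcT => c s t cc ac; have [st Ac _] := ac.
rewrite integral_cst//= lebesgue_measure_itv/= lte_fin st -EFinB -EFinM lee_fin.
apply: le_trans (lf _ _ _ _) _; [by apply: Ac; rewrite lexx ltW..|].
rewrite ler_wpM2l// (le_trans (arc_lip ac _ _)) ?lexx ?(ltW st)//.
by rewrite ler0_norm ?opprB// subr_le0 ltW.
Qed.

Lemma pwug_subset A B f g : measurable A -> measurable B -> B `<=` A ->
  pwug A f g -> pwug B f g.
Proof. by move=> mA mB BA [bg g0 H]; split=> //; exact: aearc_subset H. Qed.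

Lemma pwugD A f1 f2 g1 g2 : measurable A -> pwug A f1 g1 -> pwug A f2 g2 ->
  pwug A (f1 \+ f2)%R (g1 \+ g2).
Proof.
move=> mA [bg1 g10 H1] [bg2 g20 H2]; split.
- exact: emeasurable_funD.
- by move=> x; rewrite adde_ge0.
- apply: aearc_mono (aearcI mA H1 H2) _ => c s t cc ac [h1 h2].
  rewrite ge0_integralD//; [|by apply: measurable_funTS; exact: (borel_fun_comp cc)..].
  apply: le_trans (leeD h1 h2); rewrite -EFinD lee_fin.
  by rewrite /= opprD addrACA ler_normD.
Qed.

Lemma pwugM A f g (a : R) : pwug A f g ->
  pwug A (fun x => a * f x)%R (fun x => `|a|%:E * g x).
Proof.
move=> [bg g0 H]; split.
- exact: measurable_funeM.
- by move=> x; rewrite mule_ge0// lee_fin.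
- apply: aearc_mono H _ => c s t cc ac h.
  rewrite ge0_integralZl_EFin//; last by apply: measurable_funTS; exact: (borel_fun_comp cc).
  by rewrite -mulrBr normrM EFinM; apply: lee_wpmul2l; rewrite ?lee_fin.
Qed.

Lemma pwugN A f g : pwug A f g -> pwug A (fun x => - f x)%R g.
Proof.
by move=> H; apply: pwug_map H _ => x y _ _; rewrite -opprD normrN.
Qed.

Lemma ler_dist_max (a a' b b' : R) :
  (`|Num.max a a' - Num.max b b'| <= Num.max `|a - b| `|a' - b'|)%R.
Proof.
have : (`|a - b| <= Num.max `|a - b| `|a' - b'|)%R by rewrite le_max lexx.
have : (`|a' - b'| <= Num.max `|a - b| `|a' - b'|)%R by rewrite le_max lexx orbT.
move: (Num.max `|a - b| `|a' - b'|)%R => m; rewrite !ler_norml.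
move=> /andP[h1 h2] /andP[h3 h4]; rewrite /Num.max.
by case: ifPn => ?; case: ifPn => ?; apply/andP; split; lra.
Qed.

(** Off countably many exceptional families all inequalities hold at once and pass to the limit at
    the endpoints. Convergence is required at every point of [A], since endpoints of arcs cannot
    avoid null sets. *)
Lemma pwug_limit A f (f_ : nat -> X -> R) (g_ : nat -> X -> \bar R) g : measurable A ->
  (forall n, pwug A (f_ n) (g_ n)) -> borel_fun g ->
  (forall n x, g_ n x <= g x) -> (forall x, A x -> f_ ^~ x @ \oo --> f x) ->
  pwug A f g.
Proof.
move=> mA H bg gg f_f.
have g0 x : 0 <= g x by apply: le_trans (gg 0%N x); case: (H 0%N).
split=> //.
have hn n : aearc A (fun c s t =>
  `|f_ n (c s) - f_ n (c t)|%:E <= \int[lam]_(r in `[s, t]) g_ n (c r)) by case: (H n).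
apply: aearc_mono (aearc_countable mA hn) _ => c s t cc ac h.
have [st Ac _] := ac.
have bnd n : `|f_ n (c s) - f_ n (c t)|%:E <= \int[lam]_(r in `[s, t]) g (c r).
  apply: le_trans (h n) _; have [bgn gn0 _] := H n.
  by apply: ge0_le_integral => //; apply: measurable_funTS; exact: (borel_fun_comp cc).
have i0 : 0 <= \int[lam]_(r in `[s, t]) g (c r) by exact: integral_ge0.
move: bnd i0; case: (\int[lam]_(r in `[s, t]) g (c r)) => [i||//] bnd _; last by rewrite leey.
rewrite lee_fin; have cv : `|f_ n (c s) - f_ n (c t)|%R @[n --> \oo] --> `|f (c s) - f (c t)|%R.
  by apply: cvg_norm; apply: cvgB; apply: f_f; apply: Ac; rewrite lexx ltW.
rewrite -(cvg_lim (@Rhausdorff R) cv); apply: limr_le; first exact: cvgP cv.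
by near=> n; rewrite -lee_fin.
Unshelve. all: by end_near. Qed.

(** By absolute continuity of the integral, a function with an integrable gradient along an arc is
    continuous along that arc, whether or not it is continuous on the space. *)
Lemma arc_continuous_along (F : R -> R) (k : R -> \bar R) s t :
  measurable_fun setT k -> (forall r, 0 <= k r) ->
  \int[lam]_(r in `[s, t]) k r < +oo ->
  (forall s' t', (s <= s')%R -> (s' <= t')%R -> (t' <= t)%R ->
    `|F s' - F t'|%:E <= \int[lam]_(r in `[s', t']) k r) ->
  forall r (e : R), (s <= r <= t)%R -> (0 < e)%R -> exists2 del : R, (0 < del)%R &
    forall r', (s <= r' <= t)%R -> (`|r' - r| < del)%R -> (`|F r' - F r| < e)%R.
Proof.
move=> mk k0 fin H r e /andP[sr rt] e0.
have [del del0 Hdel] := @ge0_integral_abs_continuous _ _ _ lam k `[s, t]%classic e mk k0 (measurable_itv _) fin e0.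
exists del => // r' /andP[sr' r't].
wlog rr' : r r' sr rt sr' r't / (r' <= r)%R => [W|].
  have [/W|/ltW/W W'] := leP r' r; first exact.
  by rewrite (distrC r' r) (distrC (F r')); exact: W'.
rewrite distrC ger0_norm ?subr_ge0// => rd.
rewrite -lte_fin; apply: le_lt_trans (H _ _ sr' rr' rt) _.
apply: Hdel => //; first by apply: subset_itv; rewrite bnd_simp.
rewrite /= lebesgue_measure_itv /= lte_fin; case: ifP => _; last by rewrite lte_fin.
by rewrite -EFinB lte_fin.
Qed.

Lemma borel_fun_ifset g g' V : borel_set V -> borel_fun g -> borel_fun g' ->
  borel_fun (fun x => if x \in V then g' x else g x).
Proof.
move=> bV bg bg'; apply: measurable_fun_ifT => //.
by apply: (measurable_fun_bool true); rewrite setTI preimage_mem_true.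
Qed.

Lemma dist_between (r r1 r2 r' e : R) : (`|r1 - r| < e)%R -> (`|r2 - r| < e)%R ->
  (r1 <= r' <= r2)%R -> (`|r - r'| < e)%R.
Proof.
rewrite !ltr_norml => /andP[a1 a2] /andP[b1 b2] /andP[c1 c2].
by apply/andP; split; lra.
Qed.

Lemma arc_local A c s t r V (k : R -> \bar R) (F : R -> R) : arc A c s t ->
  (s <= r <= t)%R -> open V -> V (c r) ->
  (forall r1 r2, (s <= r1)%R -> (r1 < r2)%R -> (r2 <= t)%R ->
     (forall r', (r1 <= r' <= r2)%R -> V (c r')) ->
     `|F r1 - F r2|%:E <= \int[lam]_(x in `[r1, r2]) k x) ->
  exists2 e : R, (0 < e)%R &
     forall r1 r2, (s <= r1)%R -> (r1 < r2)%R -> (r2 <= t)%R ->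
       (`|r1 - r| < e)%R -> (`|r2 - r| < e)%R ->
       `|F r1 - F r2|%:E <= \int[lam]_(x in `[r1, r2]) k x.
Proof.
move=> ac hr oV Vr H; have [e e0 He] := arc_open ac hr oV Vr.
exists e => // r1 r2 sr1 r12 r2t r1e r2e.
apply: H => // r' rr'; have /andP[r1r' r'r2] := rr'; apply: He.
  by rewrite (le_trans sr1 r1r') (le_trans r'r2 r2t).
by rewrite distrC (dist_between r1e r2e).
Qed.

(** On an arc, the set [E] of parameters where [g'] is the smaller gradient is squeezed between a
    compact [K] and an open [U]. Near a parameter of the open set [W] the estimate with [g']
    applies, near one outside [K] the estimate with [g]; since [K] lies in [W], these cases cover
    the arc and [local_to_global] glues them. The excess over the minimum is an integral over [E]
    minus [K] and [W] minus [E], small by absolute continuity. *)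
Lemma pwug_merge A V f g g' : open A -> open V -> V `<=` A ->
  pwug A f g -> Lp A g -> pwug V f g' -> Lp V g' ->
  pwug A f (fun x => if x \in V then mine (g x) (g' x) else g x).
Proof.
move=> oA oV VA pg Lg pg' Lg'; have mA := open_measurable oA.
have mV := open_measurable oV.
have bV := open_borel_set oV.
have [bg g0 Hg] := pg; have [bg' g'0 Hg'] := pg'.
set h := fun x => _.
have bh : borel_fun h by apply: borel_fun_ifset => //; exact: measurable_mine.
have h0 x : 0 <= h x by rewrite /h; case: ifP => // _; rewrite le_min g0 g'0.
split=> //.
have bg'V : borel_fun (g' \_ V) by exact: borel_fun_patch.
have g'V0 x : 0 <= (g' \_ V) x by exact: erestrict_ge0.
have Lg'V : Lp A (g' \_ V).
  apply: le_lt_trans Lg'.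
  rewrite (eq_integral ((fun x => g' x `^ p) \_ V)); last first.
    by move=> x _; rewrite !patchE; case: ifP => //; rewrite poweR0r.
  rewrite -integral_mkcondr setIidr//.
have H1 := aearcI mA (pwugI mA pg) (aearc_finite bg g0 Lg).
have H2 := aearcI mA (aearc_subarc (aearc_open mA oV (Hg'))) (aearc_finite bg'V g'V0 Lg'V).
apply: aearc_mono (aearcI mA H1 H2) _ => c s t cc ac [[D1 fin1] [D2 fin2]].
have [st _ _] := ac.
pose G r := g (c r); pose G' r := (g' \_ V) (c r).
have mG : measurable_fun setT G by exact: (borel_fun_comp cc).
have mG' : measurable_fun setT G' by exact: (borel_fun_comp cc).
have mh : measurable_fun setT (h \o c) by exact: (borel_fun_comp cc).
have G0 r : 0 <= G r by exact: g0.
have G'0 r : 0 <= G' r by exact: g'V0.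
pose O := c @^-1` V.
have oO : open O by apply: open_comp => // r _; exact: cc.
have mO : measurable O by exact: borel_set_preimage.
pose E := (`[s, t] `&` O) `&` [set r | G' r < G r].
have mE : measurable E.
  by apply: measurable_lte; [exact: measurableI|exact: measurable_funTS..].
have Est : E `<=` `[s, t] by move=> r [[]].
apply/lee_addgt0Pr => e e0; have e20 : (0 < e / 2)%R by rewrite divr_gt0.
have [d1 d10 Hd1] := @ge0_integral_abs_continuous _ _ _ lam G `[s, t]%classic _ mG G0 (measurable_itv _) fin1 e20.
have [d2 d20 Hd2] := @ge0_integral_abs_continuous _ _ _ lam G' `[s, t]%classic _ mG' G'0 (measurable_itv _) fin2 e20.
have finE : lam E < +oo.
  apply: (@le_lt_trans _ _ (lam `[s, t]%classic)); first by rewrite le_measure ?inE.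
  by rewrite /= lebesgue_measure_itv /= lte_fin st -EFinB ltry.
have [K [cK KE lK]] := lebesgue_regularity_inner mE finE d10.
have [U [oU EU lU]] := lebesgue_regularity_outer mE finE d20.
have mK : measurable K by exact: compact_measurable.
have mU : measurable U by exact: measurable_realfun.open_measurable.
pose W := U `&` O.
have oW : open W by exact: openI.
have mW : measurable W by exact: measurableI.
(* This majorant is at least [g] off [K] and at least [g'] on [W], the two regions where the
   respective local estimates are used. *)
pose k r := (G \_ (~` K)) r + (G' \_ W) r.
have mpatch (q : R -> \bar R) (B : set R) : measurable B -> measurable_fun setT q -> measurable_fun setT (q \_ B).
  by move=> mB mq; apply/(measurable_restrictT _ _).1 => //; exact: measurable_funTS.
have mk : measurable_fun setT k.
  by apply: emeasurable_funD; apply: mpatch => //; exact: measurableC.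
have k0 r : 0 <= k r by rewrite adde_ge0//; exact: erestrict_ge0.
have kW x : W x -> g' (c x) <= k x.
  move=> Wx; have [_ Vx] := Wx; rewrite /k.
  have -> : (G' \_ W) x = g' (c x) by rewrite patchE mem_set// /G' patchE mem_set.
  by rewrite leeDr// erestrict_ge0.
have kK x : ~ K x -> g (c x) <= k x.
  move=> nKx; rewrite /k.
  have -> : (G \_ (~` K)) x = g (c x) by rewrite patchE mem_set.
  by rewrite leeDl// erestrict_ge0.
have Dk : `|f (c s) - f (c t)|%:E <= \int[lam]_(r in `[s, t]) k r.
  apply: (local_to_global (F := f \o c)) => //; first exact: ltW.
  move=> r hr; have [Wr|nWr] := pselect (W r).
    have [e' e'0 He'] : exists2 e' : R, (0 < e')%R & forall r', (`|r - r'| < e')%R -> W r'.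
      have /nbhs_ballP[e' /= e'0 eW] := open_nbhs_nbhs (conj oW Wr).
      by exists e' => // r' rr'; apply: eW.
    exists e' => // r1 r2 sr1 r12 r2t r1e r2e.
    have Wr' r' : (r1 <= r' <= r2)%R -> W r'.
      by move=> hr'; apply: He'; exact: dist_between hr'.
    apply: le_trans (D2 _ _ sr1 r12 r2t _) _; first by move=> r' /Wr'[].
    apply: ge0_le_integral => //.
    - by apply: measurable_funTS; exact: (borel_fun_comp cc bg').
    - exact: measurable_funTS.
    - by move=> r' /=; rewrite in_itv/= => /Wr' /kW.
  have nKr : ~ K r by move=> Kr; apply: nWr; have Er := KE _ Kr; split; [exact: EU|case: Er => [[]]].
  have [e' e'0 He'] : exists2 e' : R, (0 < e')%R & forall r', (`|r - r'| < e')%R -> (~` K) r'.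
    have oK : open (~` K) by apply: closed_openC; exact: (compact_closed (@Rhausdorff R)).
    have /nbhs_ballP[e' /= e'0 eW] := open_nbhs_nbhs (conj oK nKr).
    by exists e' => // r' rr'; apply: eW.
  exists e' => // r1 r2 sr1 r12 r2t r1e r2e.
  apply: le_trans (D1 _ _ sr1 (ltW r12) r2t) _.
  apply: ge0_le_integral => //; [exact: measurable_funTS..|].
  move=> r' /=; rewrite in_itv/= => hr'; apply: kK.
  by apply: He'; exact: dist_between hr'.
apply: le_trans Dk _.
have mEK : measurable (E `\` K) by exact: measurableD.
have mWE : measurable ((`[s, t] `&` W) `\` E) by apply: measurableD => //; exact: measurableI.
(* Pointwise, [k] exceeds the merged gradient [h] by at most [G] on [E] minus [K] and by at most
   [G'] on [W] minus [E]. *)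
apply: (@le_trans _ _ (\int[lam]_(r in `[s, t]) ((h (c r) + (G \_ (E `\` K)) r) + (G' \_ ((`[s, t] `&` W) `\` E)) r))).
  apply: ge0_le_integral => //.
  - exact: measurable_funTS.
  - by apply: measurable_funTS; do 2?[apply: emeasurable_funD => //]; exact: mpatch.
  - move=> r rst; rewrite /k.
    have [Er|nEr] := pselect (E r).
      have [[_ Or] GG'] := Er; have Wr : W r by split=> //; exact: EU.
      have hE : h (c r) = G' r.
        by rewrite /h /G' patchE mem_set// min_r// ltW//; move: GG'; rewrite /= /G' patchE mem_set.
      rewrite [X in _ + X <= _]patchE mem_set// hE [leRHS]addeAC.
      rewrite [X in _ <= _ + X]patchE; have [Kr|nKr] := pselect (K r).
        by rewrite patchE memNset; [rewrite add0e memNset; [rewrite -addeA leeDl// adde_ge0//; rewrite patchE; case: ifP|case]|exact].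
      rewrite patchE mem_set// (mem_set (conj Er nKr : (E `\` K) r)) addeC leeD2r// leeDl//.
      exact: erestrict_ge0.
    have hG : h (c r) = G r.
      rewrite /h; case: ifPn => //; rewrite inE => Vr; rewrite min_l//.
      rewrite leNgt; apply/negP => gg; apply: nEr; split => //=.
      by rewrite /G' patchE mem_set.
    have -> : (G \_ (E `\` K)) r = 0 by rewrite patchE memNset//; case.
    have -> : (G' \_ ((`[s, t] `&` W) `\` E)) r = (G' \_ W) r.
      by rewrite !patchE; have [Wr|nWr] := pselect (W r); [rewrite !mem_set|rewrite !memNset// => -[[]]].
    rewrite hG adde0; apply: leeD => //; rewrite patchE; case: ifP => // _; exact: G0.
have u10 r : 0 <= (G \_ (E `\` K)) r by exact: erestrict_ge0.
have u20 r : 0 <= (G' \_ ((`[s, t] `&` W) `\` E)) r by exact: erestrict_ge0.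
have m0 : measurable_fun `[s, t] (h \o c) by exact: measurable_funTS.
have m1 : measurable_fun `[s, t] (G \_ (E `\` K)) by apply: measurable_funTS; exact: mpatch.
have m2 : measurable_fun `[s, t] (G' \_ ((`[s, t] `&` W) `\` E)) by apply: measurable_funTS; exact: mpatch.
rewrite ge0_integralD//; [|by move=> r _; rewrite adde_ge0|exact: emeasurable_funD].
rewrite ge0_integralD//.
have -> : \int[lam]_(r in `[s, t]) h (c r) + e%:E =
    \int[lam]_(r in `[s, t]) h (c r) + (e / 2)%:E + (e / 2)%:E.
  by rewrite -addeA -EFinD -splitr.
apply: leeD; first apply: leeD.
- exact: lexx.
- rewrite -integral_mkcondr setIidr; last by move=> r [/Est].
  by apply: ltW; apply: Hd1 => //; move=> r [/Est].
- rewrite -integral_mkcondr setIidr; last by move=> r [[]].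
  apply: ltW; apply: Hd2 => //; first by move=> r [[]].
  apply: le_lt_trans lU; rewrite le_measure ?inE//; first exact: measurableD.
  by move=> r [[_ []]].
Qed.

Lemma ler_dist_max_shift (x y a del : R) : (0 < del)%R ->
  (`|Num.max x a - Num.max y a| <=
   `|Num.max x (a + del) - Num.max y (a + del)| + del)%R.
Proof.
move=> del0.
have := lexx `|Num.max x (a + del) - Num.max y (a + del)|%R.
move: {2 3}(`|_|)%R => m; rewrite !ler_norml => /andP[].
by rewrite /Num.max; repeat (case: ifPn => ?); move=> *; apply/andP; split; lra.
Qed.

(** Where [F] equals [a], continuity keeps nearby values below [a + del] but not below [a]. So the
    function is truncated at the level [a + del], where it is locally constant near such parameters,
    and [del] tends to 0. *)
Lemma local_to_global_max (F : R -> R) (k : R -> \bar R) (a s t : R) : (s <= t)%R ->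
  measurable_fun setT k -> (forall r, 0 <= k r) ->
  (forall del r : R, (0 < del)%R -> (s <= r <= t)%R ->
    (exists2 e : R, (0 < e)%R & forall r', (s <= r' <= t)%R -> (`|r' - r| < e)%R ->
        (F r' <= a + del)%R) \/
    (exists2 e : R, (0 < e)%R &
     forall r1 r2, (s <= r1)%R -> (r1 < r2)%R -> (r2 <= t)%R ->
       (`|r1 - r| < e)%R -> (`|r2 - r| < e)%R ->
       `|F r1 - F r2|%:E <= \int[lam]_(x in `[r1, r2]) k x)) ->
  `|Num.max (F s) a - Num.max (F t) a|%:E <= \int[lam]_(x in `[s, t]) k x.
Proof.
move=> st mk k0 H; apply/lee_addgt0Pr => del del0.
apply: (@le_trans _ _ (`|Num.max (F s) (a + del) - Num.max (F t) (a + del)| + del)%:E).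
  by rewrite lee_fin ler_dist_max_shift.
rewrite EFinD leeD2r//.
apply: (local_to_global (F := fun r => Num.max (F r) (a + del)%R)) => // r hr.
have [[e e0 He]|[e e0 He]] := H _ _ del0 hr; exists e => // r1 r2 sr1 r12 r2t r1e r2e.
  rewrite (max_idPr (He r1 _ _))// ?sr1 ?(le_trans (ltW r12))//.
  rewrite (max_idPr (He r2 _ _))// ?r2t ?(le_trans sr1 (ltW r12))//.
  by rewrite subrr normr0 integral_ge0.
apply: le_trans (He _ _ sr1 r12 r2t r1e r2e).
rewrite lee_fin (le_trans (ler_dist_max _ _ _ _))// subrr normr0.
by rewrite ge_max lexx normr_ge0.
Qed.

(** By continuity along the arc, [f] stays above [a] near a parameter where it exceeds [a], and
    there the arc runs in [C]. The set [C] is a Borel superset of [{a < f}] because the superlevel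
    set itself need not be Borel. *)
Lemma pwug_truncate A f g (a : R) C : measurable A -> pwug A f g -> Lp A g ->
  borel_set C -> (forall x, A x -> (a < f x)%R -> C x) ->
  pwug A (fun x => Num.max (f x) a) (g \_ C).
Proof.
move=> mA pg Lg bC AC; have [bg g0 _] := pg.
have bgC : borel_fun (g \_ C) by exact: borel_fun_patch.
have gC0 x : 0 <= (g \_ C) x by exact: erestrict_ge0.
split=> //.
apply: aearc_mono (aearcI mA (pwugI mA pg) (aearc_finite bg g0 Lg)) _ => c s t cc ac [D fin].
have [st Ac _] := ac.
have cont := @arc_continuous_along (f \o c) (g \o c) s t (borel_fun_comp cc bg) (fun r => g0 (c r)) fin D.
apply: (local_to_global_max (F := f \o c) (k := (g \_ C) \o c) (ltW st) (borel_fun_comp cc bgC) (fun r => gC0 (c r))).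
move=> del r del0 hr.
have [far|far] := ltP a (f (c r)).
  right.
  have fa0 : (0 < f (c r) - a)%R by rewrite subr_gt0.
  have [e e0 He] := cont _ _ hr fa0; exists e => // r1 r2 sr1 r12 r2t r1e r2e.
  apply: le_trans (D _ _ sr1 (ltW r12) r2t) _; rewrite le_eqVlt; apply/orP; left; apply/eqP.
  apply: eq_integral => r'; rewrite inE/= in_itv/= => hr'.
  have hr'' : (s <= r' <= t)%R.
    by case/andP: hr' => h1 h2; rewrite (le_trans sr1 h1) (le_trans h2 r2t).
  rewrite patchE mem_set//; apply: AC; first exact: Ac.
  have := He _ hr''; rewrite distrC (dist_between r1e r2e hr') => /(_ isT) /=.
  by rewrite ltr_norml => /andP[+ _]; lra.
left; have [e e0 He] := cont _ _ hr del0; exists e => // r' hr' r'e.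
by have := He _ hr' r'e; rewrite ltr_norml /= => /andP[_]; lra.
Qed.

(** The majorant [phi] is continuous along almost every arc and vanishes off [G], so it forces [u]
    to 0 as the arc leaves [G]; inside the open set [G] the gradient [g] applies. *)
Lemma pwug_zero_extension G u phi g gphi : open G -> pwug setT phi gphi -> Lp setT gphi ->
  pwug G u g -> (forall x, 0 <= u x <= phi x)%R -> (forall x, ~ G x -> phi x = 0%R) ->
  pwug setT u (g \_ G).
Proof.
move=> oG pphi Lphi pg uphi phi0; have [bg g0 Hg] := pg; have [bphi gphi0 _] := pphi.
have mG := open_measurable oG; have bG := open_borel_set oG.
have bgG : borel_fun (g \_ G) by exact: borel_fun_patch.
have gG0 x : 0 <= (g \_ G) x by exact: erestrict_ge0.
split=> //.
have mT : measurable [set: X] by [].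
apply: aearc_mono (aearcI mT (aearcI mT (pwugI mT pphi) (aearc_finite bphi gphi0 Lphi))
  (aearc_subarc (aearc_open mT oG Hg))) _ => c s t cc ac [[D fin] Dg].
have [st _ _] := ac.
have cont := @arc_continuous_along (phi \o c) (gphi \o c) s t (borel_fun_comp cc bphi) (fun r => gphi0 (c r)) fin D.
have u0 x : Num.max (u x) 0%R = u x by apply/max_idPl; case/andP: (uphi x).
rewrite -(u0 (c s)) -(u0 (c t)).
apply: (local_to_global_max (F := u \o c) (k := (g \_ G) \o c) (ltW st) (borel_fun_comp cc bgG) (fun r => gG0 (c r))).
move=> del r del0 hr; have [Gr|nGr] := pselect (G (c r)).
  right; apply: (arc_local ac hr oG Gr) => r1 r2 sr1 r12 r2t Gr'.
  apply: le_trans (Dg _ _ sr1 r12 r2t Gr') _; rewrite le_eqVlt; apply/orP; left; apply/eqP.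
  by apply: eq_integral => r'; rewrite inE/= in_itv/= => /Gr' ?; rewrite patchE mem_set.
left; have [e e0 He] := cont _ _ hr del0; exists e => // r' hr' r'e.
rewrite add0r; case/andP: (uphi (c r')) => _ /le_trans; apply.
have := He _ hr' r'e; rewrite /= (phi0 (c r))// subr0.
by move=> /ltW; apply: le_trans; exact: ler_norm.
Qed.

(** Along an arc on which the first gradient is integrable, dominated convergence passes to the
    limit in the curve integrals. *)
Lemma pwug_inf A f (g_ : nat -> X -> \bar R) : measurable A ->
  (forall n, pwug A f (g_ n)) -> Lp A (g_ 0%N) ->
  (forall x, nonincreasing_seq (g_ ^~ x)) ->
  pwug A f (fun x => einfs (g_ ^~ x) 0%N).
Proof.
move=> mA H L0 dec.
have bgn n : borel_fun (g_ n) by case: (H n).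
have gn0 n x : 0 <= g_ n x by case: (H n).
split.
- exact: measurable_fun_einfs.
- by move=> x; apply: le_ereal_inf_tmp => _ [n _ <-].
have hn n : aearc A (fun c s t =>
  `|f (c s) - f (c t)|%:E <= \int[lam]_(r in `[s, t]) g_ n (c r)) by case: (H n).
apply: aearc_mono (aearcI mA (aearc_countable mA hn) (aearc_finite (bgn 0%N) (gn0 0%N) L0)) _.
move=> c s t cc ac [D fin].
have mg n : measurable_fun `[s, t] (g_ n \o c) by apply: measurable_funTS; exact: (borel_fun_comp cc).
have [||||_ _] := @dominated_convergence _ _ _ lam `[s, t]%classic (measurable_itv _)
   (fun n => g_ n \o c) (fun r => einfs (g_ ^~ (c r)) 0%N) (g_ 0%N \o c) mg.
- apply: measurable_funTS; apply: (@borel_fun_comp (fun x => einfs (g_ ^~ x) 0%N) c cc).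
  exact: measurable_fun_einfs.
- apply: aeW => r _.
  have -> : einfs (g_ ^~ (c r)) 0%N = ereal_inf (range (g_ ^~ (c r))).
    by congr ereal_inf; apply/seteqP; split=> _ [n _ <-]; exists n.
  exact: (ereal_nonincreasing_cvgn (dec (c r))).
- apply/integrableP; split; first exact: mg.
  have -> : \int[lam]_(r in `[s, t]) `|(g_ 0%N \o c) r| = \int[lam]_(r in `[s, t]) g_ 0%N (c r).
    by apply: eq_integral => r _; rewrite /= gee0_abs.
  exact: fin.
- apply: aeW => r n _; rewrite /= gee0_abs//; exact: dec.
move=> cv; rewrite -(cvg_lim _ cv)//; apply: lime_ge; first exact: cvgP cv.
by apply: nearW => n; exact: D.
Qed.

(** * Minimal weak upper gradients *)

Lemma ae_eq_le_integral D (u v : X -> \bar R) : measurable D ->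
  measurable_fun D u -> measurable_fun D v -> (forall x, D x -> 0 <= u x) ->
  (forall x, D x -> u x <= v x) -> \int[mu]_(x in D) v x < +oo ->
  \int[mu]_(x in D) v x <= \int[mu]_(x in D) u x ->
  {ae mu, forall x, D x -> u x = v x}.
Proof.
move=> mD mu_ mv u0 uv fin vu.
have v0 x : D x -> 0 <= v x by move=> Dx; apply: le_trans (u0 _ Dx) (uv _ Dx).
have uv_ : \int[mu]_(x in D) u x <= \int[mu]_(x in D) v x by exact: ge0_le_integral.
have iv : mu.-integrable D v.
  apply/integrableP; split=> //; rewrite (eq_integral v)// => x; rewrite inE => Dx.
  by rewrite gee0_abs// v0.
have iu : mu.-integrable D u.
  apply/integrableP; split=> //; apply: le_lt_trans fin; apply: le_trans uv_.
  rewrite le_eqVlt; apply/orP; left; apply/eqP; apply: eq_integral => x; rewrite inE => Dx.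
  by rewrite gee0_abs// u0.
have fu : \int[mu]_(x in D) u x \is a fin_num.
  by rewrite ge0_fin_numE ?integral_ge0//; exact: le_lt_trans uv_ fin.
have : \int[mu]_(x in D) `|v x - u x| = 0.
  transitivity (\int[mu]_(x in D) (v x - u x)).
    apply: ae_eq_integral => //.
    - by apply: measurableT_comp => //; exact: emeasurable_funB.
    - exact: emeasurable_funB.
    - have [N [mN N0 Nu]] := integrable_ae mD iu.
      exists N; split=> // x /= nx; apply: Nu => /= fux; apply: nx => Dx.
      by rewrite gee0_abs// sube_ge0 ?uv// fux.
  rewrite integralB//; apply/eqP; rewrite sube_eq//.
    by rewrite add0e eq_le vu uv_.
  by rewrite ge0_fin_numE ?integral_ge0.
move=> /(ae_eq_integral_abs mu mD (emeasurable_funB mv mu_)) [N [mN N0 Nvu]].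
have [N' [mN' N'0 N'u]] := integrable_ae mD iu.
exists (N `|` N'); split; first exact: measurableU.
  by rewrite measureU0.
move=> x /= nx; have [Nx|nNx] := pselect (N x); [by left|right; apply: N'u => /= fux].
apply: nx => Dx; apply: contrapT => nuv; apply: nNx; apply: Nvu => /= /(_ Dx) E.
by apply: nuv; rewrite -[RHS](subeK _ (fux Dx)) E add0e.
Qed.

Lemma ae_le_of_integral D (g h : X -> \bar R) : measurable D ->
  measurable_fun D g -> measurable_fun D h -> (forall x, D x -> 0 <= h x) ->
  (forall x, D x -> h x <= g x) -> \int[mu]_(x in D) g x `^ p < +oo ->
  \int[mu]_(x in D) g x `^ p <= \int[mu]_(x in D) h x `^ p ->
  {ae mu, forall x, D x -> g x = h x}.
Proof.
move=> mD mg mh h0 hg fin gh.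
have [||||N [mN N0 Ngh]] := @ae_eq_le_integral D (fun x => h x `^ p) (fun x => g x `^ p) mD _ _ _ _ fin gh.
- exact: measurable_pow.
- exact: measurable_pow.
- by move=> x _; exact: poweR_ge0.
- by move=> x Dx; apply: le_poweR => //; [exact: ltW|exact: h0|exact: hg].
exists N; split=> // x /= nx; apply: Ngh => /= E; apply: nx => Dx.
rewrite -(poweRKp (x := g x)) ?(le_trans (h0 _ Dx) (hg _ Dx))//.
by rewrite -(poweRKp (x := h x)) ?h0// E.
Qed.

Definition minimal_pwug A f g := [/\ pwug A f g, Lp A g &
  forall g', pwug A f g' -> Lp A g' -> {ae mu, forall x, A x -> g x <= g' x}].

Lemma Lp_le A g g' : measurable A -> borel_fun g -> borel_fun g' ->
  (forall x, 0 <= g' x) -> (forall x, A x -> g' x <= g x) -> Lp A g -> Lp A g'.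
Proof.
move=> mA bg bg' g0 gg'; apply: le_lt_trans; apply: ge0_le_integral => //.
- by move=> x _; exact: poweR_ge0.
- exact/measurable_pow/borel_fun_measurable.
- exact/measurable_pow/borel_fun_measurable.
- by move=> x Ax; apply: le_poweR => //; [exact: ltW|exact: gg'].
Qed.

Lemma Lp_subset A B g : measurable A -> measurable B -> B `<=` A -> borel_fun g -> Lp A g -> Lp B g.
Proof.
move=> mA mB BA bg; apply: le_lt_trans; apply: ge0_subset_integral => //.
- exact/measurable_pow/borel_fun_measurable.
- by move=> x _; exact: poweR_ge0.
Qed.

(** The infimum of the running minima of a minimizing sequence is a gradient of least energy. Its
    minimum with any other gradient has no smaller energy, hence agrees with it almost everywhere,
    so least energy implies least almost everywhere. *)
Lemma exists_minimal_pwug A f g0 : open A -> pwug A f g0 -> Lp A g0 ->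
  exists g, minimal_pwug A f g.
Proof.
move=> oA pg0 Lg0; have mA := open_measurable oA.
pose J g := \int[mu]_(x in A) g x `^ p.
have J0 g : 0 <= J g by apply: integral_ge0 => x _; exact: poweR_ge0.
pose S := [set J g | g in [set g | pwug A f g /\ Lp A g]].
pose m := ereal_inf S.
have m0 : 0 <= m by apply: le_ereal_inf_tmp => _ [g _ <-].
have mfin : m \is a fin_num.
  rewrite ge0_fin_numE//; apply: le_lt_trans (Lg0); apply: ereal_inf_lbound.
  by exists g0; [split|].
have /choice[g_ Hg] (n : nat) : exists g, [/\ pwug A f g, Lp A g & J g < m + (n.+1%:R^-1)%:E].
  have : m < m + (n.+1%:R^-1)%:E by rewrite lteDl// lte_fin invr_gt0.
  by move=> /ereal_inf_lt[_ [g [pg Lg] <-] Jg]; exists g.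
(* [pwug_merge] keeps the running minima admissible, and [pwug_inf] needs a decreasing sequence. *)
pose k := fix k n := if n is n'.+1 then
   (fun x => if x \in A then mine (k n' x) (g_ n x) else k n' x) else g_ 0%N.
have Hk n : pwug A f (k n) /\ Lp A (k n).
  elim: n => [|n [pk Lk]]; first by case: (Hg 0%N).
  have [pg Lg _] := Hg n.+1.
  have pk1 : pwug A f (k n.+1) by exact: pwug_merge.
  split=> //; apply: Lp_le Lk => //; [by case: pk|by case: pk1|by case: pk1|].
  by move=> x Ax /=; rewrite mem_set// ge_min lexx.
have kdec x : nonincreasing_seq (k ^~ x).
  apply/nonincreasing_seqP => n /=; case: ifP => _ //.
  by rewrite ge_min lexx.
have kg n x : A x -> k n x <= g_ n x.
  by case: n => [//|n] Ax /=; rewrite mem_set// ge_min lexx orbT.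
pose g x := einfs (k ^~ x) 0%N.
have gk n x : g x <= k n x by apply: ereal_inf_lbound; exists n.
have pg : pwug A f g.
  by apply: pwug_inf => //; [move=> n; case: (Hk n)|case: (Hk 0%N)].
have [bg gg0 _] := pg.
have Lg : Lp A g.
  by have [[bk k0 _] Lk] := Hk 0%N; apply: Lp_le Lk.
have Jg : J g <= m.
  apply/lee_addgt0Pr => e e0.
  have [n ne] : exists n, (n.+1%:R^-1 < e)%R.
    have [n _ /(_ n (leqnn n))/= Hn] := near_infty_natSinv_lt (PosNum e0).
    by exists n.
  have [[bgn _ _] _ Jgn] := Hg n.
  apply: (@le_trans _ _ (J (g_ n))); last first.
    by apply: (le_trans (ltW Jgn)); rewrite leeD2l// lee_fin ltW.
  apply: ge0_le_integral => //.
  - by move=> x _; exact: poweR_ge0.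
  - exact/measurable_pow/borel_fun_measurable.
  - exact/measurable_pow/borel_fun_measurable.
  - move=> x Ax; apply: le_poweR => //; first exact: ltW.
    by apply: le_trans (gk n x) (kg n x Ax).
exists g; split=> // g' pg' Lg'; have [bg' g'0 _] := pg'.
have ph := pwug_merge oA oA (@subset_refl _ A) pg Lg pg' Lg'.
set h := (fun x => _) in ph; have [bh h0 _] := ph.
have hA x : A x -> h x = mine (g x) (g' x) by move=> Ax; rewrite /h mem_set.
have hg x : A x -> h x <= g x by move=> Ax; rewrite hA// ge_min lexx.
have [||||N [mN N0 Ngh]] := @ae_le_of_integral A g h mA _ _ _ hg Lg _.
- exact: borel_fun_measurable.
- exact: borel_fun_measurable.
- by move=> x _.
- apply: (le_trans Jg); apply: ereal_inf_lbound; exists h => //; split=> //.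
  exact: Lp_le Lg.
exists N; split=> // x /= nx; apply: Ngh => /= E; apply: nx => Ax.
by rewrite E// hA// ge_min lexx orbT.
Qed.

(** A gradient known only on the open set [V] can be merged into [g], so minimality on [A] already
    covers competitors on [V]. *)
Lemma minimal_pwug_local A V f g g' : open A -> open V -> V `<=` A ->
  minimal_pwug A f g -> pwug V f g' -> Lp V g' ->
  {ae mu, forall x, V x -> g x <= g' x}.
Proof.
move=> oA oV VA [pg Lg ming] pg' Lg'; have mA := open_measurable oA.
have ph := pwug_merge oA oV VA pg Lg pg' Lg'; have [bh h0 _] := ph.
have [bg _ _] := pg.
have /ming[|N [mN N0 NH]] := ph.
  by apply: Lp_le Lg => // x _; case: ifP => // _; rewrite ge_min lexx.
exists N; split=> // x /= nx; apply: NH => /= E; apply: nx => Vx.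
have := E (VA _ Vx); rewrite mem_set// => /le_trans; apply.
by rewrite ge_min lexx orbT.
Qed.

(** * Doubling and Poincare inequality *)

Lemma ball_open_metric (x : X) (r : R) : open (ball x r).
Proof.
rewrite openE => y; rewrite ballEmdist/= => xy.
apply/nbhs_ballP; exists (r - mdist x y)%R => /=; first by rewrite subr_gt0.
move=> z; rewrite !ballEmdist/= => yz.
by apply: le_lt_trans (metric_triangle x y z) _; rewrite -ltrBrDl.
Qed.

Hypothesis mu_balls : balls_pos_finite mu.
Hypothesis mu_doubling : doubling mu.

Lemma measurable_ball (x : X) (r : R) : measurable (ball x r).
Proof. by apply: open_measurable; exact: ball_open_metric. Qed.

Lemma ball_subset_ball (x y : X) (r r' : R) : (mdist y x + r <= r')%R -> ball x r `<=` ball y r'.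
Proof.
move=> rr' z; rewrite !ballEmdist /= => xz.
by apply: lt_le_trans rr'; apply: le_lt_trans (metric_triangle y x z) _; rewrite ltrD2l.
Qed.

Lemma doubling_iter : exists2 C : R, (0 < C)%R & forall (x : X) (r : R) k, (0 < r)%R ->
  mu (ball x (2 ^+ k * r)%R) <= (C ^+ k)%:E * mu (ball x r).
Proof.
have [C HC] := mu_doubling.
have C0 : (0 < C)%R.
  have r2 : (0 < 2 * 1 :> R)%R by rewrite mulr1.
  have /andP[m2 _] := mu_balls (point : X) r2.
  have /andP[m1 m1y] := mu_balls (point : X) (@ltr01 R).
  have := lt_le_trans m2 (HC point _ (@ltr01 R)).
  by rewrite pmule_lgt0// lte_fin.
exists C => // x r k r0; elim: k => [|k IH].
  by rewrite !expr0 mul1r mul1e.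
rewrite exprS -mulrA; apply: le_trans (HC x _ _) _.
  by rewrite mulr_gt0// exprn_gt0.
by rewrite exprS EFinM -muleA; apply: lee_wpmul2l => //; rewrite lee_fin ltW.
Qed.

(** Otherwise the ball contains [e]-separated lists [Sep] of every size. The balls of radius [e / 2]
    around their points are disjoint, lie in [W], and by doubling each has at least the fraction
    C^(-k) of the measure of [W], so there are at most C^k of them. *)
Lemma bounded_totally_bounded (x0 : X) (r0 e : R) : (0 < r0)%R -> (0 < e)%R ->
  exists s : seq X, ball x0 r0 `<=` \bigcup_(y in [set` s]) ball y e.
Proof.
move=> r00 e0; apply: contrapT => /forallNP H.
pose fix Sep (s : seq X) := if s is y :: s' then
  [/\ ball x0 r0 y, forall z, z \in s' -> (e <= mdist z y)%R & Sep s'] else True.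
have ex_sep n : exists2 s, size s = n & Sep s.
  elim: n => [|n [s sn Ss]]; first by exists [::].
  have /existsNP[y /not_implyP[x0y Hy]] := H s.
  exists (y :: s); first by rewrite /= sn.
  split=> // z zs; rewrite leNgt; apply/negP => zy; apply: Hy.
  by exists z => //; rewrite ballEmdist.
have [C C0 HC] := doubling_iter.
have e20 : (0 < e / 2)%R by rewrite divr_gt0.
(* After [k] doublings a ball of radius [e / 2] around any point of the given ball contains [W],
   which has radius [r0 + e]. *)
have [k Hk] : exists k, (2 * r0 + e <= 2 ^+ k * (e / 2))%R.
  pose a := ((2 * r0 + e) / (e / 2))%R.
  exists (Num.bound a); rewrite -ler_pdivrMr// -/a.
  have a0 : (0 <= a)%R by rewrite divr_ge0// ?addr_ge0 ?mulr_ge0// ltW.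
  rewrite (le_trans (ltW (archi_boundP a0)))//.
  by rewrite -natrX ler_nat ltnW// ltn_expl.
pose W := ball x0 (r0 + e)%R.
have /andP[W0 Wy] : 0 < mu W < +oo by apply: mu_balls; rewrite addr_gt0.
have WC y : ball x0 r0 y -> mu W <= (C ^+ k)%:E * mu (ball y (e / 2)%R).
  move=> x0y; apply: le_trans (HC y _ k e20); apply: le_measure; rewrite ?inE; [exact: measurable_ball..|].
  apply: ball_subset_ball; apply: le_trans Hk; move: x0y; rewrite ballEmdist/= metric_sym.
  by move=> /ltW; lra.
have pack s : Sep s -> (size s)%:R%:E * mu W <=
    (C ^+ k)%:E * mu (\bigcup_(y in [set` s]) ball y (e / 2)%R).
  elim: s => [_|y s IH [x0y sepy Ss]] /=.
    by rewrite mul0e mule_ge0// lee_fin exprn_ge0// ltW.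
  have mS : measurable (\bigcup_(y in [set` s]) ball y (e / 2)%R).
    by apply: fin_bigcup_measurable => // z _; exact: measurable_ball.
  rewrite (_ : \bigcup_(z in _) _ = ball y (e / 2)%R `|` \bigcup_(y in [set` s]) ball y (e / 2)%R); last first.
    apply/seteqP; split=> [z [u /=]|z [yz|[u us uz]]].
    - by rewrite inE => /predU1P[->|us] uz; [left|right; exists u].
    - by exists y => //=; rewrite inE eqxx.
    - by exists u => //=; rewrite inE; apply/orP; right.
  rewrite measureU//; [|exact: measurable_ball|]; last first.
    rewrite -subset0 => z [yz [u /= us uz]].
    have := sepy u us; rewrite leNgt => /negP; apply.
    apply: le_lt_trans (metric_triangle u z y) _.
    move: yz uz; rewrite !ballEmdist/= => yz uz.
    by rewrite (splitr e) ltrD// metric_sym.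
  rewrite ge0_muleDr// -natr1 addrC EFinD ge0_muleDl ?lee_fin// mul1e.
  by apply: leeD; [exact: WC|exact: IH].
have sub s : Sep s -> \bigcup_(y in [set` s]) ball y (e / 2)%R `<=` W.
  elim: s => [_ z [u]|y s IH [x0y _ Ss] z [u /=]]; first by rewrite /= in_nil.
  rewrite inE => /predU1P[->|us] uz; last by apply: IH => //; exists u.
  by apply: ball_subset_ball uz; move: x0y; rewrite ballEmdist/= => /ltW; lra.
have Ck0 : (0 <= C ^+ k)%R by rewrite exprn_ge0// ltW.
have [s sn Ss] := ex_sep (Num.bound (C ^+ k)).
have : (size s)%:R%:E * mu W <= (C ^+ k)%:E * mu W.
  apply: le_trans (pack _ Ss) _; apply: lee_wpmul2l; first by rewrite lee_fin.
  apply: le_measure; rewrite ?inE; [|exact: measurable_ball|exact: sub].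
  by apply: fin_bigcup_measurable => // z _; exact: measurable_ball.
have Wfin : mu W \is a fin_num by rewrite ge0_fin_numE.
rewrite sn lee_pmul2r// lee_fin leNgt => /negP; apply.
exact: archi_boundP.
Qed.

(** Balls of radius 1 / (n + 1) around finite nets of the balls of radius m + 1 about a fixed point,
    enumerated by their indices. *)
Lemma countable_ball_base : exists B : nat -> set X, (forall n, open (B n)) /\
  forall (x : X) (r : R), (0 < r)%R -> exists2 n, B n x & B n `<=` ball x r.
Proof.
have /choice[F HF] (mn : nat * nat) : exists s : seq X,
    ball (point : X) mn.1.+1%:R `<=` \bigcup_(y in [set` s]) ball y (mn.2.+1%:R^-1 : R)%R.
  by apply: bounded_totally_bounded; rewrite ?invr_gt0.
exists (fun k => if unpickle k is Some (mn, i) then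
   ball (nth point (F mn) i) ((mn.2 : nat).+1%:R^-1 : R)%R else setT); split.
  by move=> k; case: unpickle => [[mn i]|]; [exact: ball_open_metric|exact: openT].
move=> x r r0.
have r20 : (0 < r / 2)%R by rewrite divr_gt0.
have [n _ /(_ n (leqnn n))/= Hn] := near_infty_natSinv_lt (PosNum r20).
pose m := Num.bound (mdist (point : X) x).
have xm : ball (point : X) m.+1%:R x.
  rewrite ballEmdist/= (lt_trans (archi_boundP (mdist_ge0 _ _)))//.
  by rewrite ltr_nat.
have [y ys yx] := HF (m, n) x xm.
have yE := nth_index point ys.
exists (pickle ((m, n), index y (F (m, n)))); rewrite pickleK yE//.
apply: ball_subset_ball => /=; move: yx; rewrite ballEmdist/= metric_sym => /ltW.
by move: Hn; set q := (_^-1)%R => Hn; rewrite (splitr r); lra.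
Qed.

(** A Lindelof argument: countably many base sets on which the property holds almost everywhere
    cover [A], so the exceptional sets have null union. *)
Lemma locally_ae A (P : X -> Prop) :
  (forall x, A x -> exists2 r : R, (0 < r)%R & {ae mu, forall y, ball x r y -> A y -> P y}) ->
  {ae mu, forall y, A y -> P y}.
Proof.
move=> H; have [B [oB HB]] := countable_ball_base.
pose good n := {ae mu, forall y, B n y -> A y -> P y}.
have Hae : {ae mu, forall y n, good n -> B n y -> A y -> P y}.
  apply/ae_foralln => n; have [gn|ngn] := pselect (good n); last exact: aeW.
  by move: gn; apply: filterS => y h _.
move: Hae; apply: filterS => y h Ay.
have [r r0 Hr] := H y Ay; have [n Bny Bnr] := HB y r r0.
apply: (h n) => //; rewrite /good; move: Hr; apply: filterS => z hz Bz Az.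
by apply: hz => //; exact: Bnr.
Qed.

Lemma ultra_bigcup_seq (F : set_system X) (s : seq X) (B : X -> set X) :
  UltraFilter F -> F (\bigcup_(y in [set` s]) B y) -> exists y, F (B y).
Proof.
move=> FU; elim: s => [|y s IH] Fs.
  exfalso; apply: (@filter_not_empty _ F).
  by move: Fs; congr (F _); apply/seteqP; split=> [z [u]|//]; rewrite /= in_nil.
have [Fy|Fny] := in_ultra_setVsetC (B y) FU; first by exists y.
apply: IH; apply: filterS (filterI Fny Fs) => z [nyz [u /=]].
by rewrite inE => /predU1P[->//|us] uz; exists u.
Qed.

Lemma closure_subset_ball A (x0 : X) (r : R) : A `<=` ball x0 r ->
  closure A `<=` ball x0 (r + 1)%R.
Proof.
move=> Ar z /(_ (ball z 1%R)) []; first exact: nbhsx_ballx.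
move=> y [/Ar]; rewrite !ballEmdist/= => x0y zy.
by apply: le_lt_trans (metric_triangle x0 y z) _; rewrite ltrD// metric_sym.
Qed.

Hypothesis X_complete : @complete_space R X.

(** An ultrafilter on a totally bounded set contains arbitrarily small balls, so it is Cauchy and
    converges by completeness. *)
Lemma closed_bounded_compact A (x0 : X) (r : R) : closed A -> A `<=` ball x0 r -> compact A.
Proof.
move=> cA Ar; rewrite compact_ultra => F FU FA.
have [|p_ Fp] := X_complete _ (_ : cauchy F).
  apply: cauchy_exP => e e0.
  have r0 : (0 < Num.max r 1 :> R)%R by rewrite lt_max ltr01 orbT.
  have [s Hs] := bounded_totally_bounded x0 r0 e0.
  apply: (@ultra_bigcup_seq F s (fun y => ball y e) FU).
  apply: filterS FA => y /Ar yr; apply: Hs.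
  by apply: ball_subset_ball yr; rewrite mdistxx add0r le_max lexx.
exists p_; split=> //; apply: cA => B nB.
have FAB : F (A `&` B) by apply: filterI => //; exact: Fp.
exact: (@filter_ex _ F _ _ FAB).
Qed.

(** * Passage between Borel gradients and the definitions *)

Lemma wug_contraction A (F F' : X -> \bar R) g : weak_upper_gradient mu p A F g ->
  (forall x y, A x -> A y -> `|F' x - F' y| <= `|F x - F y|) ->
  weak_upper_gradient mu p A F' g.
Proof.
move=> [mg g0 [Gam eG H]] FF'; split=> //; exists Gam => // c l cl nG.
have [l0 Ac _] := cl.
apply: le_trans (H _ _ cl nG); apply: FF'; apply: Ac.
  by exists 0%R => //=; rewrite in_itv/= lexx ltW.
by exists l => //=; rewrite in_itv/= lexx ltW.
Qed.

(** Competitors in [is_minimal_wug] are in L^p only locally. They are compared with [g] on small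
    balls, where they are in L^p, and [locally_ae] collects the balls. This form also fits a
    singular function, whose gradient need not be in L^p up to the pole. *)
Lemma is_minimal_wug_of_local A (F : X -> \bar R) f g : open A ->
  (forall x, A x -> F x = (f x)%:E) -> pwug A f g -> Lp_loc mu p A g ->
  (forall B g', open B -> B `<=` A -> pwug B f g' -> Lp B g' ->
     {ae mu, forall x, B x -> g x <= g' x}) ->
  is_minimal_wug mu p A F g.
Proof.
move=> oA Ff pg Lg H; have mA := open_measurable oA; split => //.
  apply: wug_contraction (pwug_wug mA pg) _ => x y Ax Ay.
  by rewrite /= !Ff.
move=> g' wg' Lg'.
have [g'' [pg'' _ g''g']] := wug_pwug oA wg' Ff.
have [bg'' g''0 _] := pg''.
have [mg' g'0 _] := wg'.
have : {ae mu, forall y, A y -> g y <= g'' y}.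
  apply: locally_ae => x Ax; have [r r0 fin] := Lg' x Ax; exists r => //.
  have oB : open (A `&` ball x r) by apply: openI => //; exact: ball_open_metric.
  have mB := open_measurable oB.
  have := H _ g'' oB (@subIsetl _ _ _) _ _; move=> /(_ _ _)/(filterS _); apply.
  - by move=> y h By Ay; exact: h.
  - exact: pwug_subset pg''.
  - apply: le_lt_trans fin; apply: ae_ge0_le_integral => //.
    + by move=> y _; exact: poweR_ge0.
    + exact/measurable_pow/borel_fun_measurable.
    + by move=> y _; exact: poweR_ge0.
    + by apply: measurable_pow; exact: measurable_funS mg'.
    + by move: g''g'; apply: filterS => y h [Ay _]; rewrite h.
by apply: filterS2 g''g' => y e h Ay; rewrite -e//; exact: h.
Qed.

Lemma minimal_pwug_is_minimal_wug A (F : X -> \bar R) f g : open A ->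
  (forall x, A x -> F x = (f x)%:E) -> minimal_pwug A f g -> is_minimal_wug mu p A F g.
Proof.
move=> oA Ff mg; have [pg Lg _] := mg; have [bg g0 _] := pg.
apply: (is_minimal_wug_of_local oA Ff pg) => [x Ax|B g' oB BA pg' Lg'].
  exists 1%R => //; have mA := open_measurable oA.
  by apply: Lp_subset Lg => //; apply: measurableI => //; exact: measurable_ball.
exact: minimal_pwug_local mg pg' Lg'.
Qed.

(** Two minimal gradients agree almost everywhere, so the one chosen by [xget] can be exchanged for
    any one at hand. *)
Lemma minimal_wugP A (F : X -> \bar R) g : is_minimal_wug mu p A F g ->
  is_minimal_wug mu p A F (minimal_wug mu p A F) /\
  {ae mu, forall x, A x -> minimal_wug mu p A F x = g x}.
Proof.
move=> mg; have mF : is_minimal_wug mu p A F (minimal_wug mu p A F).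
  by apply: xgetPex; exists g.
split=> //; have [wF LF minF] := mF; have [wg Lg ming] := mg.
apply: filterS2 (minF _ wg Lg) (ming _ wF LF) => x h1 h2 Ax.
by apply/eqP; rewrite eq_le h1// h2.
Qed.

Lemma integral_minimal_wug A (F : X -> \bar R) g D : measurable A -> measurable D -> D `<=` A ->
  is_minimal_wug mu p A F g ->
  \int[mu]_(x in D) minimal_wug mu p A F x `^ p = \int[mu]_(x in D) g x `^ p.
Proof.
move=> mA mD DA mg; have [[[mF F0 _] _ _] ae] := minimal_wugP mg.
have [[mg' g0 _] _ _] := mg.
apply: ge0_ae_eq_integral => //.
- by apply: measurable_pow; exact: measurable_funS mF.
- by apply: measurable_pow; exact: measurable_funS mg'.
- by move=> x _; exact: poweR_ge0.
- by move=> x _; exact: poweR_ge0.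
- by move: ae; apply: filterS => x h Dx; rewrite h//; exact: DA.
Qed.

Lemma integral_minimal_wug_le A (F h : X -> \bar R) D : measurable A -> measurable D -> D `<=` A ->
  weak_upper_gradient mu p A F h -> Lp_loc mu p A h ->
  \int[mu]_(x in D) minimal_wug mu p A F x `^ p <= \int[mu]_(x in D) h x `^ p.
Proof.
move=> mA mD DA wh Lh; have [mh h0 _] := wh.
have [[g mg]|H] := pselect (exists g, is_minimal_wug mu p A F g).
  have [[[mF F0 _] _ minF] _] := minimal_wugP mg.
  apply: ae_ge0_le_integral => //.
  - by move=> x _; exact: poweR_ge0.
  - by apply: measurable_pow; exact: measurable_funS mF.
  - by move=> x _; exact: poweR_ge0.
  - by apply: measurable_pow; exact: measurable_funS mh.
  - move: (minF _ wh Lh); apply: filterS => x le Dx; apply: le_poweR.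
    + exact: ltW.
    + by apply: F0; exact: DA.
    + by apply: le; exact: DA.
(* Without a minimal gradient, [minimal_wug] is the default 0 and the inequality is trivial. *)
rewrite integral0_eq; first by apply: integral_ge0 => x _; exact: poweR_ge0.
move=> x _; rewrite /minimal_wug xgetPN; first by rewrite poweR0r.
by move=> g mg; apply: H; exists g.
Qed.

Lemma N1p_intro A (F : X -> \bar R) f g : open A -> measurable_fun A F ->
  (forall x, A x -> F x = (f x)%:E) -> \int[mu]_(x in A) `|F x| `^ p < +oo ->
  pwug A f g -> Lp A g -> N1p mu p A F.
Proof.
move=> oA mF Ff iF pg Lg; split=> //; rewrite /N1p_normp lte_add_pinfty//.
apply: le_lt_trans Lg; apply: ereal_inf_lbound; exists g => //.
apply: wug_contraction (pwug_wug (open_measurable oA) pg) _ => x y Ax Ay.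
by rewrite /= !Ff.
Qed.

Lemma N1p_normp_lt A (F : X -> \bar R) (c : \bar R) : N1p_normp mu p A F < c ->
  exists2 g, weak_upper_gradient mu p A F g &
    \int[mu]_(x in A) `|F x| `^ p + \int[mu]_(x in A) g x `^ p < c.
Proof.
rewrite /N1p_normp; set I := \int[mu]_(x in A) _; set S := [set _ | _ in _].
have I0 : 0 <= I by apply: integral_ge0 => x _; exact: poweR_ge0.
have S0 : 0 <= ereal_inf S.
  by apply: le_ereal_inf_tmp => _ [g _ <-]; apply: integral_ge0 => x _; exact: poweR_ge0.
move=> ISc.
have Ify : I \is a fin_num.
  rewrite ge0_fin_numE//; apply: le_lt_trans (lt_le_trans ISc (leey _)).
  by rewrite leeDl.
have : ereal_inf S < c - I by rewrite lteBrDl.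
by move=> /ereal_inf_lt[_ [g wg <-] gc]; exists g => //; rewrite -lteBrDl.
Qed.

(** Stated for every real [f] that oscillates no more than [F], so that it yields gradients of
    truncations and of real parts of extended functions. *)
Lemma N1p_pwug A (F : X -> \bar R) f : open A -> N1p mu p A F ->
  (forall x y, A x -> A y -> `|f x - f y|%:E <= `|F x - F y|) ->
  exists2 g, pwug A f g & Lp A g.
Proof.
move=> oA [mF /N1p_normp_lt[g wg fin]] fF; have mA := open_measurable oA.
have wf : weak_upper_gradient mu p A (EFin \o f) g.
  by apply: wug_contraction wg _ => x y Ax Ay; exact: fF.
have [g' [pg' _ g'g]] := wug_pwug oA wf (fun _ _ => erefl).
exists g' => //; have [bg' _ _] := pg'; have [mg _ _] := wf.
apply: (@le_lt_trans _ _ (\int[mu]_(x in A) g x `^ p)); last first.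
  apply: le_lt_trans fin; rewrite leeDr//.
  by apply: integral_ge0 => x _; exact: poweR_ge0.
apply: ae_ge0_le_integral => //.
- by move=> x _; exact: poweR_ge0.
- exact/measurable_pow/borel_fun_measurable.
- by move=> x _; exact: poweR_ge0.
- exact: measurable_pow.
- by move: g'g; apply: filterS => x h Ax; rewrite h.
Qed.

(** * Consequences of the Poincare inequality *)

Hypothesis X_poincare : poincare mu p.

Lemma integral_pow_ge0 A h : 0 <= \int[mu]_(x in A) h x `^ p.
Proof. by apply: integral_ge0 => x _; exact: poweR_ge0. Qed.

Lemma ae_point A (P : X -> Prop) : measurable A -> 0 < mu A -> {ae mu, forall x, P x} ->
  exists2 x, A x & P x.
Proof.
move=> mA A0 [N [mN N0 NP]]; apply: contrapT => H.
have AN : A `<=` N by move=> x Ax; apply: NP => Px; apply: H; exists x.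
by move: A0; rewrite (subset_measure0 mA mN AN N0) ltxx.
Qed.

Definition average (f : X -> R) (B : set X) : \bar R := (mu B)^-1 * \int[mu]_(y in B) (f y)%:E.

(** For one fixed ball the radius and the measures of the ball and of its dilation are absorbed in
    [K], and the gradient may be integrated over the whole space. *)
Lemma poincare_ball (x : X) (r : R) : (0 < r)%R -> exists2 K : R, (0 <= K)%R &
  forall f g, mu.-integrable setT (EFin \o f) -> pwug setT f g -> Lp setT g ->
  \int[mu]_(y in ball x r) `|(f y)%:E - average f (ball x r)| <=
    K%:E * (\int[mu]_y g y `^ p) `^ p^-1.
Proof.
move=> r0; have [C [lambda [C0 l1 HP]]] := X_poincare.
have l0 : (0 < lambda)%R by exact: lt_le_trans l1.
have /andP[B0 By] := mu_balls x r0.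
have lr0 : (0 < lambda * r)%R by rewrite mulr_gt0.
have /andP[lB0 lBy] := mu_balls x lr0.
have Bfin : mu (ball x r) \is a fin_num by rewrite ge0_fin_numE.
have lBfin : mu (ball x (lambda * r)%R) \is a fin_num by rewrite ge0_fin_numE.
pose m := fine (mu (ball x r)); pose lm := fine (mu (ball x (lambda * r)%R)).
have m0 : (0 < m)%R by rewrite /m fine_gt0// B0.
have lm0 : (0 < lm)%R by rewrite /lm fine_gt0// lB0.
exists (m * (C * r * (lm^-1) `^ p^-1))%R.
  by rewrite !mulr_ge0// ?powR_ge0// ltW.
move=> f g intf pg Lg; have [bg g0 _] := pg.
have := HP x r (EFin \o f) g r0 intf (pwug_wug measurableT pg) => /=.
rewrite -(fineK Bfin) -(fineK lBfin) -/m -/lm !inver (gt_eqF m0) (gt_eqF lm0) => H.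
rewrite -/(EFin \o f).
have -> : average f (ball x r) = (m^-1)%:E * \int[mu]_(y in ball x r) (f y)%:E.
  by rewrite /average -(fineK Bfin) -/m inver (gt_eqF m0).
rewrite EFinM -muleA -[leLHS]mul1e -(mulfV (lt0r_neq0 m0)) EFinM -muleA.
apply: lee_wpmul2l; first by rewrite lee_fin ltW.
apply: (le_trans H); rewrite EFinM -muleA EFinM -!muleA.
do 2 (apply: lee_wpmul2l; first by rewrite lee_fin ltW).
have J0 D : 0 <= \int[mu]_(y in D) g y `^ p by apply: integral_ge0 => y _; exact: poweR_ge0.
rewrite poweRM//; last by rewrite lee_fin invr_ge0 ltW.
rewrite poweR_EFin; apply: lee_wpmul2l; first by rewrite lee_fin powR_ge0.
apply: le_poweR; first by rewrite invr_ge0 ltW.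
  by apply: integral_ge0 => y _; exact: poweR_ge0.
apply: ge0_subset_integral => //; first exact: measurable_ball.
  exact/measurable_pow/borel_fun_measurable.
by move=> y _; exact: poweR_ge0.
Qed.

Lemma zero_gradient_ae_cst f g : mu.-integrable setT (EFin \o f) -> pwug setT f g ->
  \int[mu]_x g x `^ p = 0 -> exists c : R, {ae mu, forall x, f x = c}.
Proof.
move=> intf pg g0.
have Lg : Lp setT g by rewrite /Lp g0.
have mf : measurable_fun setT (EFin \o f) by case/integrableP: intf.
pose B n := ball (point : X) n.+1%:R.
have B0 n : 0 < mu (B n) by have /andP[] := mu_balls (point : X) (ltr0Sn R n).
have H n : {ae mu, forall x, B n x -> (f x)%:E - average f (B n) = 0}.
  have [K K0 HK] := poincare_ball (point : X) (ltr0Sn R n).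
  have := HK f g intf pg Lg; rewrite g0 poweR0r ?invr_eq0// mule0 => I0.
  apply/(ae_eq_integral_abs mu (measurable_ball _ _)).
    by apply: emeasurable_funB => //; exact: measurable_funTS.
  by apply/eqP; rewrite eq_le I0 integral_ge0.
have Hall : {ae mu, forall x n, B n x -> (f x)%:E - average f (B n) = 0}.
  exact/ae_foralln.
(* On each ball of an increasing sequence [f] equals its average; a point of the smallest ball at
   which all these equalities hold identifies the averages. *)
have [x1 Bx1 Hx1] := ae_point (measurable_ball _ _) (B0 0%N) Hall.
have avE x n : (f x)%:E - average f (B n) = 0 -> average f (B n) = (f x)%:E.
  case: (average f (B n)) => [q||]//; rewrite -EFinB => -[/eqP].
  by rewrite subr_eq0 => /eqP ->.
have B0n n : B 0%N `<=` B n.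
  by apply: ball_subset_ball; rewrite mdistxx add0r ler_nat.
exists (f x1); move: Hall; apply: filterS => x Hx.
have [n Bn] : exists n, B n x.
  exists (Num.bound (mdist (point : X) x)); rewrite /B ballEmdist/=.
  by rewrite (lt_trans (archi_boundP (mdist_ge0 _ _)))// ltr_nat.
have e1 := avE _ _ (Hx n Bn).
have e2 := avE _ _ (Hx1 n (B0n n _ Bx1)).
by apply: EFin_inj; rewrite -e1 -e2.
Qed.

(** If the constant value [c] were not 0, the function [1 - f / c] would be 1 off [W] and have zero
    Newtonian norm, and the complement of [W] would have zero capacity. *)
Lemma zero_gradient_vanish W f g : measurable_fun setT f -> mu.-integrable setT (EFin \o f) ->
  pwug setT f g -> \int[mu]_x g x `^ p = 0 ->
  (forall x, ~ W x -> f x = 0%R) -> 0 < Cp mu p (~` W) ->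
  {ae mu, forall x, f x = 0%R}.
Proof.
move=> mf intf pg g0 f0 CW.
have [c Hc] := zero_gradient_ae_cst intf pg g0.
have [c0|cn0] := eqVneq c 0%R; first by rewrite -c0.
exfalso; move: CW; rewrite ltNge => /negP; apply.
pose u x := (1 - c^-1 * f x)%R.
have mu_ : measurable_fun setT u by apply: measurable_funB => //; exact: measurable_funM.
have pu : pwug setT u (fun x => `|c^-1|%:E * g x).
  apply: pwug_map (pwugM c^-1 pg) _ => x y _ _.
  by rewrite (_ : u x - u y = - (c^-1 * f x - c^-1 * f y))%R ?normrN// /u; lra.
have u0 : \int[mu]_x `|(EFin \o u) x| `^ p = 0.
  rewrite (ge0_ae_eq_integral (g := cst 0))//.
  - by rewrite integral0.
  - apply: measurable_pow; apply: measurableT_comp => //; exact/measurable_EFinP.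
  - by move=> x _; exact: poweR_ge0.
  - move: Hc; apply: filterS => x fc _ /=.
    by rewrite /u fc mulVf// subrr normr0 powR0.
have wu : \int[mu]_x (`|c^-1|%:E * g x) `^ p = 0.
  have [bg gg0 _] := pg.
  under eq_integral do rewrite poweRM ?lee_fin// poweR_EFin.
  rewrite ge0_integralZl_EFin ?powR_ge0//; last 2 first.
  - by move=> x _; exact: poweR_ge0.
  - exact/measurable_pow/borel_fun_measurable.
  by rewrite g0 mule0.
have Nu : N1p_normp mu p setT (EFin \o u) = 0.
  apply/eqP; rewrite eq_le; apply/andP; split.
    rewrite /N1p_normp u0 add0e -wu; apply: ereal_inf_lbound.
    by exists (fun x => `|c^-1|%:E * g x) => //; exact: pwug_wug.
  rewrite adde_ge0//; first exact: integral_pow_ge0.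
  apply: le_ereal_inf_tmp => _ [h _ <-].
  exact: integral_pow_ge0.
rewrite -Nu; apply: ereal_inf_lbound; exists (EFin \o u) => //; split.
  by split; [exact/measurable_EFinP|rewrite Nu].
by move=> x nWx; rewrite /= /u f0// mulr0 subr0.
Qed.

(** * Truncation, and competitors at a point of zero capacity *)

Lemma poweRD_le (a b : \bar R) : 0 <= a -> 0 <= b ->
  (a + b) `^ p <= (2 `^ p)%:E * (a `^ p + b `^ p).
Proof.
move=> a0 b0; wlog ab : a b a0 b0 / a <= b => [H|].
  have [/H|/ltW/H] := leP a b; first exact.
  by rewrite addeC (addeC (a `^ p)); exact.
have -> : (2 `^ p)%:E = (2%:E `^ p : \bar R) by [].
apply: (@le_trans _ _ ((2%:E * b) `^ p)).
  apply: le_poweR; [exact: ltW|exact: adde_ge0|].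
  by rewrite (_ : 2%:E = 1%:E + 1%:E :> \bar R)// ge0_muleDl// !mul1e leeD2r.
rewrite poweRM//; apply: lee_wpmul2l; first exact: poweR_ge0.
by rewrite leeDr// poweR_ge0.
Qed.

(** Truncation to [[a, b]] as a real function: infinite values become endpoints, so a truncated
    singular function is real at its pole. *)
Definition clampe (a b : R) (z : \bar R) : R := fine (mine (maxe z a%:E) b%:E).

Lemma clampe_fin (a b z : R) : clampe a b z%:E = Num.min (Num.max z a) b.
Proof. by rewrite /clampe -EFin_max -EFin_min. Qed.

Lemma clampey (a b : R) : clampe a b +oo = b.
Proof. by rewrite /clampe max_l ?leey// min_r ?leey. Qed.

Lemma clampeNy (a b : R) : (a <= b)%R -> clampe a b -oo = a.
Proof. by move=> ab; rewrite /clampe max_r ?leNye// min_l. Qed.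

Lemma clampe_bounds (a b : R) z : (a <= b)%R -> (a <= clampe a b z <= b)%R.
Proof.
move=> ab; case: z => [z||]; rewrite ?clampey ?clampeNy ?lexx ?ab//.
by rewrite clampe_fin le_min ab le_max lexx orbT ge_min lexx orbT.
Qed.

Lemma ler_dist_clamp (x y a b : R) :
  (`|Num.min (Num.max x a) b - Num.min (Num.max y a) b| <= `|x - y|)%R.
Proof.
have minl u v : (`|Num.min u b - Num.min v b| <= `|u - v|)%R.
  have := lexx `|u - v|%R; move: {2 3}(`|_|)%R => m; rewrite !ler_norml => /andP[].
  by rewrite /Num.min; repeat (case: ifPn => ?); move=> *; apply/andP; split; lra.
apply: le_trans (minl _ _) _; apply: le_trans (ler_dist_max _ _ _ _) _.
by rewrite subrr normr0 ge_max lexx normr_ge0.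
Qed.

Lemma clampe_contraction (a b : R) x y :
  `|clampe a b x - clampe a b y|%:E <= `|x - y|.
Proof.
case: x => [x||]; case: y => [y||]; rewrite ?leey//.
by rewrite !clampe_fin lee_fin ler_dist_clamp.
Qed.

Lemma measurable_clampe (a b : R) A (F : X -> \bar R) : measurable_fun A F ->
  measurable_fun A (fun x => clampe a b (F x)).
Proof.
move=> mF.
have m1 : measurable_fun A (fun x => mine (maxe (F x) a%:E) b%:E).
  by apply: measurable_mine => //; exact: measurable_maxe.
exact: measurableT_comp m1.
Qed.

Lemma borel_set_singleton (x : X) : borel_set [set x].
Proof.
apply: closed_borel_set; apply: accessible_closed_set1; apply: hausdorff_accessible.
exact: metric_hausdorff.
Qed.

Lemma Cp0_mu0 (x0 : X) : Cp mu p [set x0] = 0 -> mu [set x0] = 0.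
Proof.
move=> C0; apply/eqP; rewrite eq_le measure_ge0 andbT; apply/lee_addgt0Pr => e e0.
rewrite add0e.
have : Cp mu p [set x0] < e%:E by rewrite C0 lte_fin.
move=> /ereal_inf_lt[_ [u [[mu_ _] u1] <-]] /N1p_normp_lt[g _ lt_e].
have mx : measurable [set x0] by apply: borel_set_measurable; exact: borel_set_singleton.
rewrite -[mu [set x0]]mul1e -integral_cst//.
apply: le_trans (ltW lt_e); rewrite -[leLHS]adde0 leeD ?integral_pow_ge0//.
apply: (@le_trans _ _ (\int[mu]_(x in [set x0]) `|u x| `^ p)).
  apply: ge0_le_integral => //.
  - by apply: measurable_pow; apply: measurableT_comp => //; exact: measurable_funTS.
  - move=> x /= ->; rewrite -(poweR1r p); apply: le_poweR => //; first exact: ltW.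
    by apply: le_trans (u1 x0 _) _ => //; rewrite lee_abs.
apply: ge0_subset_integral => //; first by apply: measurable_pow; apply: measurableT_comp.
by move=> x _; exact: poweR_ge0.
Qed.

Lemma small_ball (x0 : X) (e : R) : mu [set x0] = 0 -> (0 < e)%R ->
  exists2 r : R, (0 < r)%R & mu (ball x0 r) < e%:E.
Proof.
move=> m0 e0; pose F n := ball x0 (n.+1%:R^-1 : R)%R.
have capF : \bigcap_n F n = [set x0].
  apply/seteqP; split=> [y H|_ -> n _]; last by rewrite /F; apply: ballxx; rewrite invr_gt0.
  apply/esym; apply: mdist_positivity; apply/eqP; rewrite eq_le mdist_ge0 andbT.
  apply/ler_addgt0Pr => del del0; rewrite add0r.
  have [n _ /(_ n (leqnn n))/= Hn] := near_infty_natSinv_lt (PosNum del0).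
  apply: ltW; apply: lt_trans Hn; have := H n I.
  by rewrite /F ballEmdist.
have mF n : measurable (F n) by exact: measurable_ball.
have cv : mu (F n) @[n --> \oo] --> mu (\bigcap_n F n).
  apply: nonincreasing_cvg_mu => //.
  - by have /andP[] := mu_balls x0 (ltac:(by rewrite invr_gt0) : (0 < 1%:R^-1 :> R)%R).
  - by rewrite capF; apply: borel_set_measurable; exact: borel_set_singleton.
  - move=> n m nm; apply/subsetPset; apply: ball_subset_ball.
    by rewrite mdistxx add0r lef_pV2 ?posrE// ler_nat.
rewrite capF m0 in cv.
apply: contrapT => H; have Fe n : e%:E <= mu (F n).
  rewrite leNgt; apply/negP => Fne; apply: H; exists (n.+1%:R^-1)%R => //.
suff : e%:E <= 0 by rewrite lee_fin leNgt e0.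
rewrite -(cvg_lim _ cv)//; apply: lime_ge; first exact: cvgP cv.
exact: nearW.
Qed.

Lemma integral_const_le A (c : R) (h : X -> \bar R) : measurable A -> measurable_fun A h ->
  (0 <= c)%R -> (forall x, A x -> c%:E <= h x) -> c%:E * mu A <= \int[mu]_(x in A) h x.
Proof.
move=> mA mh c0 ch; rewrite -integral_cst//; apply: ge0_le_integral => //.
Qed.

Lemma arc_lipschitz_wug A c s t V f (L : R) : arc A c s t -> (0 <= L)%R ->
  (forall x y, V x -> V y -> (`|f x - f y| <= L * mdist x y)%R) ->
  (forall r, (s <= r <= t)%R -> V (c r)) ->
  `|f (c s) - f (c t)|%:E <= \int[lam]_(r in `[s, t]) (cst L%:E \_ V) (c r).
Proof.
move=> ac L0 lf Vc; have [st _ _] := ac.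
have -> : \int[lam]_(r in `[s, t]) (cst L%:E \_ V) (c r) = \int[lam]_(r in `[s, t]) L%:E.
  by apply: eq_integral => r; rewrite inE/= in_itv/= => /Vc Vr; rewrite patchE mem_set.
rewrite integral_cst//= lebesgue_measure_itv/= lte_fin st -EFinB -EFinM lee_fin.
apply: le_trans (lf _ _ _ _) _; [by apply: Vc; rewrite lexx ltW..|].
rewrite ler_wpM2l// (le_trans (arc_lip ac _ _)) ?lexx ?(ltW st)//.
by rewrite ler0_norm ?opprB// subr_le0 ltW.
Qed.

(** The function is constant beyond distance [r]. The ball of radius [2 * r] leaves an open overlap,
    so that near each parameter an arc lies in the ball or where the function is 1. *)
Lemma pwug_cutoff (x0 : X) (r : R) : (0 < r)%R ->
  pwug setT (fun x => Num.min 1 (mdist x0 x / r))%R (cst (r^-1)%:E \_ (ball x0 (2 * r)%R)).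
Proof.
move=> r0; have r10 : (0 <= r^-1)%R by rewrite invr_ge0 ltW.
set f := fun x => _.
have bg : borel_fun (cst (r^-1)%:E \_ (ball x0 (2 * r)%R)).
  by apply: borel_fun_patch; [exact: measurable_cst|apply: open_borel_set; exact: ball_open_metric].
have g0 x : 0 <= (cst (r^-1)%:E \_ (ball x0 (2 * r)%R)) x.
  by apply: erestrict_ge0 => y _; rewrite lee_fin.
split=> //; apply: aearcT => c s t cc ac; have [st _ _] := ac.
have lf x y : (`|f x - f y| <= r^-1 * mdist x y)%R.
  have := ler_dist_clamp (mdist x0 x / r) (mdist x0 y / r) 0%R 1%R.
  rewrite !(max_idPl (divr_ge0 (mdist_ge0 _ _) (ltW r0))) !(minC _ 1%R) => /le_trans; apply.
  rewrite -mulrBl normrM (ger0_norm r10) mulrC ler_wpM2l//.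
  have h1 := metric_triangle x0 x y; have h2 := metric_triangle x0 y x.
  rewrite (metric_sym y x) in h2.
  by rewrite ler_norml; apply/andP; split; lra.
apply: (local_to_global (F := f \o c) (ltW st) (borel_fun_comp cc bg) (fun r => g0 (c r))) => q hq.
have [xq|xq] := ltP (mdist x0 (c q)) (2 * r)%R.
  apply: (arc_local ac hq (ball_open_metric x0 (2 * r)%R)); first by rewrite ballEmdist.
  move=> r1 r2 sr1 r12 r2t Vr.
  by apply: (arc_lipschitz_wug (arc_sub ac sr1 r12 r2t) r10) => // x y _ _; exact: lf.
have oV : open [set x | r < mdist x0 x]%R.
  rewrite openE => y /= ry; apply/nbhs_ballP; exists (mdist x0 y - r)%R => /=; first by rewrite subr_gt0.
  move=> z; rewrite ballEmdist/= => yz; rewrite ltNge; apply/negP => zr.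
  have := metric_triangle x0 z y; rewrite (metric_sym z y) leNgt => /negP; apply.
  by apply: (@le_lt_trans _ _ (r + mdist y z)%R); rewrite ?lerD2r// -ltrBrDl.
have Vq : [set x | r < mdist x0 x]%R (c q).
  by apply: lt_le_trans xq; rewrite ltr_pMl// ltr1n.
apply: (arc_local ac hq oV Vq) => r1 r2 sr1 r12 r2t Vr.
have f1 x : (r < mdist x0 x)%R -> f x = 1%R.
  by move=> rx; rewrite /f (min_idPl _)// ler_pdivlMr// mul1r ltW.
rewrite /= !f1; [by rewrite subrr normr0 integral_ge0|by apply: Vr; rewrite lexx ltW..].
Qed.

Lemma borel_cover A : measurable A -> exists C, [/\ borel_set C, A `<=` C & mu (C `\` A) = 0].
Proof.
move=> mA; have /mu_borel[B [C [bB bC [BA AC] CB]]] := mA.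
have mB := borel_set_measurable bB; have mC := borel_set_measurable bC.
exists C; split=> //; apply: (subset_measure0 (measurableD mC mA) (measurableD mC mB) _ CB).
by move=> x [Cx nAx]; split=> // /BA.
Qed.

Lemma borel_cover_measure A : measurable A ->
  exists C, [/\ borel_set C, A `<=` C & mu C = mu A].
Proof.
move=> mA; have [C [bC AC CA]] := borel_cover mA.
exists C; split=> //; rewrite -(setDUK AC) measureU0//.
by apply: measurableD => //; exact: borel_set_measurable.
Qed.

Lemma measurable_ge_level (w : X -> R) (e : R) : measurable_fun setT w ->
  measurable [set x | e <= w x]%R.
Proof.
move=> mw; have mEw : measurable_fun setT (EFin \o w) by exact/measurable_EFinP.
by have := emeasurable_fun_c_infty measurableT mEw e%:E; rewrite setTI.
Qed.

Lemma measurable_open_levels V (F : X -> \bar R) : open V ->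
  (forall a : R, open (V `&` [set x | a%:E < F x])) -> measurable_fun V F.
Proof.
move=> oV oF mV; apply: (measurability _ (ErealGenOInfty.measurableE R)) => //.
move=> _ [_ [a ->] <-]; rewrite preimage_itvoy.
by apply: open_measurable; exact: oF.
Qed.

Lemma open_mdist_gt (x0 : X) (a : R) : open [set x | a < mdist x0 x]%R.
Proof.
rewrite openE => y /= ry; apply/nbhs_ballP; exists (mdist x0 y - a)%R => /=; first by rewrite subr_gt0.
move=> z; rewrite ballEmdist/= => yz; rewrite ltNge; apply/negP => zr.
have := metric_triangle x0 z y; rewrite (metric_sym z y) leNgt => /negP; apply.
by apply: (@le_lt_trans _ _ (a + mdist y z)%R); rewrite ?lerD2r// -ltrBrDl.
Qed.

Lemma measurable_mdist (x0 : X) : measurable_fun setT (mdist x0 : X -> R).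
Proof.
apply/measurable_EFinP; apply: measurable_open_levels; first exact: openT.
by move=> a; rewrite setTI; exact: open_mdist_gt.
Qed.

Lemma chebyshev_pow (w : X -> R) (e : R) : measurable_fun setT w -> (forall x, 0 <= w x)%R ->
  (0 < e)%R -> (e `^ p)%:E * mu [set x | e <= w x]%R <= \int[mu]_x (w x)%:E `^ p.
Proof.
move=> mw w0 e0.
have mS := measurable_ge_level e mw.
apply: (@le_trans _ _ (\int[mu]_(x in [set x | e <= w x]%R) (w x)%:E `^ p)).
  apply: integral_const_le => //; rewrite ?powR_ge0//.
  - by apply: measurable_pow; apply: measurable_funTS; exact/measurable_EFinP.
  - move=> x /= ew.
    by apply: (@le_poweR e%:E (w x)%:E p (ltW p_gt0)); rewrite lee_fin// ltW.
apply: ge0_subset_integral => //; first by apply: measurable_pow; exact/measurable_EFinP.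
by move=> x _; exact: poweR_ge0.
Qed.

(** A function of small Newtonian norm with value at least 1 at the point is truncated and then cut
    down to [Om] by subtracting the cone [psi], which vanishes at [x0] and is 1 outside a ball in
    [Om]. Subtracting instead of multiplying avoids a product rule, and the slope of the cone counts
    only where the function exceeds the cone, a set of small measure. *)
Lemma Cp0_competitor (Om : set X) (x0 : X) (e : R) : open Om -> Om x0 ->
  Cp mu p [set x0] = 0 -> (0 < e)%R ->
  exists (w : X -> R) (g : X -> \bar R), [/\ measurable_fun setT w, forall x, (0 <= w x <= 1)%R, w x0 = 1%R,
    forall x, ~ Om x -> w x = 0%R &
    pwug setT w g /\ \int[mu]_x g x `^ p < e%:E].
Proof.
move=> oOm Omx0 C0 e0.
have m0 := Cp0_mu0 C0.
have /nbhs_ballP[r /= r0 rOm] := open_nbhs_nbhs (conj oOm Omx0).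
pose L := (r^-1)%R; have L0 : (0 < L)%R by rewrite invr_gt0.
pose K := (2 `^ p)%R; have K0 : (0 < K)%R by rewrite powR_gt0.
(* Chosen so that the final bound K (e1 + 2 L^p e1) equals [e]. *)
pose e1 := (e / (K * (1 + 2 * L `^ p)))%R.
have Lp0 : (0 <= L `^ p)%R by exact: powR_ge0.
have e10 : (0 < e1)%R by rewrite divr_gt0// mulr_gt0// ltr_wpDr// mulr_ge0.
have [r1 r10 Hr1] := small_ball m0 e10.
pose del := (Num.min 1 (r1 / r))%R.
have del0 : (0 < del)%R by rewrite lt_min ltr01 divr_gt0.
(* The first bound is for the energy of the gradient; the second gives, by Chebyshev's inequality,
   measure at most [e1] to the set where [u'] is at least [del]. *)
pose eta := (Num.min e1 (del `^ p * e1))%R.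
have eta0 : (0 < eta)%R by rewrite lt_min e10 mulr_gt0// powR_gt0.
have : Cp mu p [set x0] < eta%:E by rewrite C0 lte_fin.
move=> /ereal_inf_lt[_ [u [Nu u1] <-]] /N1p_normp_lt[gu0 wgu0 lt_eta].
have [mu_ _] := Nu.
pose u' x := clampe 0 1 (u x).
have u'b x : (0 <= u' x <= 1)%R by exact: clampe_bounds.
have mu' : measurable_fun setT u' by exact: measurable_clampe.
have [gu [pgu _ gugu]] : exists gu, [/\ pwug setT u' gu, forall x, setT x -> gu0 x <= gu x &
    {ae mu, forall x, setT x -> gu x = gu0 x}].
  apply: wug_pwug openT _ (fun x _ => erefl).
  by apply: wug_contraction wgu0 _ => x y _ _; exact: clampe_contraction.
have [bgu gup0 _] := pgu; have [mgu0 gu00 _] := wgu0.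
have Egu : \int[mu]_x gu x `^ p = \int[mu]_x gu0 x `^ p.
  apply: ge0_ae_eq_integral => //.
  - exact/measurable_pow/borel_fun_measurable.
  - exact: measurable_pow.
  - by move=> x _; exact: poweR_ge0.
  - by move=> x _; exact: poweR_ge0.
  - by move: gugu; apply: filterS => x h _; rewrite h.
have gu_eta : \int[mu]_x gu x `^ p < eta%:E.
  by rewrite Egu; apply: le_lt_trans lt_eta; rewrite leeDr// integral_pow_ge0.
have u'u : \int[mu]_x (u' x)%:E `^ p < eta%:E.
  apply: (@le_lt_trans _ _ (\int[mu]_x `|u x| `^ p)); last first.
    by apply: le_lt_trans lt_eta; rewrite leeDl// integral_pow_ge0.
  apply: ge0_le_integral => //.
  - by move=> x _; exact: poweR_ge0.
  - by apply: measurable_pow; exact/measurable_EFinP.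
  - by apply: measurable_pow; apply: measurableT_comp.
  - move=> x _; apply: le_poweR; first exact: ltW.
      by rewrite lee_fin; case/andP: (u'b x).
    have := clampe_contraction 0 1 (u x) 0.
    rewrite sube0 clampe_fin maxxx (min_idPl ler01) subr0 ger0_norm//.
    by case/andP: (u'b x).
have u'x0 : u' x0 = 1%R.
  have := u1 x0 erefl; rewrite /u'; case: (u x0) => [z|_|//]; last by rewrite clampey.
  by rewrite lee_fin => z1; rewrite clampe_fin (max_idPl (le_trans ler01 z1)) (min_idPr z1).
pose psi x := (Num.min 1 (mdist x0 x / r))%R.
have ppsi : pwug setT psi _ := pwug_cutoff x0 r0.
have psi0 x : (0 <= psi x)%R by rewrite /psi le_min ler01 divr_ge0// ?mdist_ge0// ltW.
have mpsi : measurable_fun setT psi.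
  apply: measurable_minr => //; apply: measurable_funM => //; exact: measurable_mdist.
have mS := measurable_ge_level del mu'.
have [C1 [bC1 SC1 mC1]] := borel_cover_measure mS.
(* Outside the ball of radius [r1] the cone is at least [del], so [u'] exceeds it only on [C]. *)
pose C := ball x0 r1 `|` C1.
have bC : borel_set C.
  by apply: (@measurableU _ borelType) => //; apply: open_borel_set; exact: ball_open_metric.
have pdiff := pwugD measurableT pgu (pwugN ppsi).
set gd := (_ \+ _) in pdiff; have [bgd gd0 _] := pdiff.
have gdle x : gd x <= gu x + L%:E.
  by rewrite /gd /= leeD2l// patchE; case: ifP => // _; rewrite lee_fin ltW.
have gpow x : gd x `^ p <= K%:E * (gu x `^ p + (L `^ p)%:E).
  apply: (@le_trans _ _ ((gu x + L%:E) `^ p)); first by apply: le_poweR => //; exact: ltW.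
  by rewrite -poweR_EFin; apply: poweRD_le => //; rewrite lee_fin ltW.
have gdpow x : gd x `^ p <= K%:E * (gu x `^ p + ((cst (L `^ p)%:E \_ (ball x0 (2 * r)%R)) x)).
  apply: (@le_trans _ _ (K%:E * (gu x `^ p + ((cst L%:E \_ (ball x0 (2 * r)%R)) x) `^ p))).
    by apply: poweRD_le => //; apply: erestrict_ge0 => y _; rewrite lee_fin ltW.
  apply: lee_wpmul2l; first by rewrite lee_fin ltW.
  by rewrite leeD2l// !patchE; case: ifP => _; rewrite ?poweR0r.
have mgp : measurable_fun setT (fun x => gu x `^ p) by exact/measurable_pow/borel_fun_measurable.
have mball := measurable_ball x0 (2 * r)%R.
have mpb B : measurable B -> measurable_fun setT (cst (L `^ p)%:E \_ B : X -> \bar R).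
  by move=> mB; apply/(measurable_restrictT _ _).1 => //; exact: measurable_cst.
have pb0 B x : 0 <= (cst (L `^ p)%:E \_ B) x by apply: erestrict_ge0 => y _; rewrite lee_fin.
have bound (B : set X) (h : X -> \bar R) : measurable B -> borel_fun h ->
    (forall x, h x `^ p <= K%:E * (gu x `^ p + (cst (L `^ p)%:E \_ B) x)) ->
    \int[mu]_x h x `^ p <= K%:E * (\int[mu]_x gu x `^ p + (L `^ p)%:E * mu B).
  move=> mB bh hle.
  apply: (@le_trans _ _ (\int[mu]_x (K%:E * (gu x `^ p + (cst (L `^ p)%:E \_ B) x)))).
    apply: ge0_le_integral => //.
    - by move=> x _; exact: poweR_ge0.
    - exact/measurable_pow/borel_fun_measurable.
    - by apply: measurable_funeM; apply: emeasurable_funD => //; exact: mpb.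
  rewrite ge0_integralZl_EFin//; last 3 first.
  - by move=> x _; rewrite adde_ge0// poweR_ge0.
  - by apply: emeasurable_funD => //; exact: mpb.
  - exact: ltW.
  rewrite ge0_integralD//; last 2 first.
  - by move=> x _; exact: poweR_ge0.
  - exact: mpb.
  by rewrite -integral_mkcond integral_cst.
have Lgd : Lp setT gd.
  apply: le_lt_trans (bound _ _ mball bgd gdpow) _.
  have r20 : (0 < 2 * r)%R by rewrite mulr_gt0.
  have /andP[_ Bfin] := mu_balls x0 r20.
  rewrite lte_mul_pinfty ?lee_fin ?(ltW K0)//.
  rewrite lte_add_pinfty//; first exact: lt_trans gu_eta (ltry _).
  by rewrite lte_mul_pinfty ?lee_fin.
pose w x := Num.max (u' x - psi x)%R 0%R.
have pw : pwug setT w (gd \_ C).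
  apply: pwug_truncate => // x _ /=; rewrite subr_gt0 => psiu.
  have [xr1|r1x] := ltP (mdist x0 x) r1; first by left; rewrite ballEmdist.
  right; apply: SC1 => /=; apply: le_trans (ltW psiu).
  by rewrite /del /psi le_min ge_min lexx /= ge_min ler_pM2r ?invr_gt0// r1x orbT.
exists w, (gd \_ C); split.
- by apply: measurable_maxr => //; exact: measurable_funB.
- move=> x; rewrite /w le_max lexx orbT ge_max ler01 andbT/= lerBlDr.
  by case/andP: (u'b x) => _ /le_trans; apply; rewrite lerDl.
- by rewrite /w u'x0 /psi mdistxx mul0r min_r// subr0 max_l.
- move=> x nOx; have xr : (r <= mdist x0 x)%R.
    by rewrite leNgt; apply/negP => xr; apply: nOx; apply: rOm; rewrite ballEmdist.
  have -> : w x = (Num.max (u' x - 1) 0)%R.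
    by rewrite /w /psi min_l// ler_pdivlMr// mul1r.
  by rewrite max_r// subr_le0; case/andP: (u'b x).
- split=> //; have [bgC _ _] := pw.
  have mC := borel_set_measurable bC.
  apply: le_lt_trans (bound C _ mC bgC _) _.
    move=> x; rewrite !patchE; case: ifPn => _; first exact: gpow.
    by rewrite poweR0r// adde0 mule_ge0 ?poweR_ge0// lee_fin ltW.
  have muC : mu C <= (2 * e1)%:E.
    rewrite mulr_natl mulr2n EFinD; apply: le_trans (measureU2 _ _ _) _ => //.
    - exact: measurable_ball.
    - exact: borel_set_measurable.
    - apply: leeD; first exact: ltW.
      rewrite [leLHS](_ : _ = mu [set x | del <= u' x]%R)//.
      have := chebyshev_pow mu' (fun x => ltac:(by case/andP: (u'b x))) del0.
      move=> /le_lt_trans-/(_ _ u'u) h.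
      have delp : (0 < del `^ p)%R by exact: powR_gt0.
      rewrite -(@lee_pmul2l _ (del `^ p)%:E) ?lte_fin//.
      by apply: (le_trans (ltW h)); rewrite -EFinM lee_fin /eta ge_min lexx orbT.
  have e1eta : (eta <= e1)%R by rewrite /eta ge_min lexx.
  apply: (@lt_le_trans _ _ (K%:E * (e1%:E + (L `^ p)%:E * (2 * e1)%:E))).
    rewrite lte_pmul2l ?lte_fin//; apply: lte_leD => //.
    - by rewrite ge0_fin_numE ?mule_ge0 ?lee_fin// lte_mul_pinfty ?lee_fin//; apply: le_lt_trans muC _; exact: ltry.
    - by apply: lt_le_trans gu_eta _; rewrite lee_fin.
    - by apply: lee_wpmul2l => //; rewrite lee_fin.
  rewrite [leLHS](_ : _ = (K * (e1 + L `^ p * (2 * e1)))%:E)// lee_fin /e1.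
  rewrite le_eqVlt; apply/orP; left; apply/eqP; field.
  by rewrite !gt_eqF// ltr_wpDr// mulr_ge0.
Qed.

(** * Strict convexity and points of zero capacity *)

(** The mean value theorem between [y] and 1: the derivative p c^(p - 1) is below [p] to the left of
    1 and above it to the right. *)
Lemma bernoulli_powR (y : R) : (0 <= y)%R -> y != 1%R -> (1 + p * (y - 1) < y `^ p)%R.
Proof.
rewrite le_eqVlt => /predU1P[<- _|y0 y1].
  by rewrite powR0// sub0r mulrN1; have := p_gt1; lra.
have cont a b : (0 < a)%R -> {within `[a, b]%classic, continuous (fun x : R => x `^ p)%R}.
  move=> a0; apply: derivable_within_continuous => x; rewrite in_itv/= => /andP[ax _].
  by apply: derivable_powR; rewrite in_itv/= andbT (lt_le_trans a0 ax).
have der a b : (0 < a)%R -> forall x : R, x \in `]a, b[%R ->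
    is_derive x 1%R (fun x : R => x `^ p)%R (p * x `^ (p - 1))%R.
  move=> a0 x; rewrite in_itv/= => /andP[ax _].
  by apply: is_derive1_powR; exact: lt_trans ax.
have pm1 : (0 < p - 1)%R by rewrite subr_gt0.
have p1 : (1 `^ (p - 1) = 1 :> R)%R by rewrite powR1.
have [ylt|ygt|/esym/eqP] := ltgtP y 1%R; last by rewrite eq_sym (negbTE y1).
  have [c + E] := MVT ylt (der _ _ y0) (cont _ _ y0).
  rewrite in_itv/= => /andP[yc c1].
  have c0 : (0 < c)%R by exact: lt_trans yc.
  have : (c `^ (p - 1) < 1)%R.
    by rewrite -[ltRHS]p1 gt0_ltr_powR// ?nnegrE ?(ltW c0) ?ler01.
  move: E; rewrite powR1 => E H.
  have : (p * c `^ (p - 1) * (1 - y) < p * (1 - y))%R.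
    by rewrite ltr_pM2r ?subr_gt0// -[ltRHS]mulr1 ltr_pM2l.
  by rewrite -E; lra.
have [c + E] := MVT ygt (der _ _ ltr01) (cont _ _ ltr01).
rewrite in_itv/= => /andP[c1 cy].
have c0 : (0 < c)%R by exact: lt_trans c1.
have : (1 < c `^ (p - 1))%R.
  by rewrite -[ltLHS]p1 gt0_ltr_powR// ?nnegrE ?(ltW c0) ?ler01.
move: E; rewrite powR1 => E H.
have : (p * (y - 1) < p * c `^ (p - 1) * (y - 1))%R.
  by rewrite ltr_pM2r ?subr_gt0// -[ltLHS]mulr1 ltr_pM2l.
by rewrite -E; lra.
Qed.

(** Bernoulli's inequality for [x / m], whose equality case is [x = m]. *)
Lemma tangent_powR (x m : R) : (0 <= x)%R -> (0 < m)%R ->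
  (m `^ p + p * m `^ p * (x / m - 1) <= x `^ p)%R /\
  ((m `^ p + p * m `^ p * (x / m - 1) = x `^ p)%R -> x = m).
Proof.
move=> x0 m0; have mp0 : (0 < m `^ p)%R by exact: powR_gt0.
have xm0 : (0 <= x / m)%R by rewrite divr_ge0// ltW.
have xE : (x `^ p = m `^ p * (x / m) `^ p)%R.
  by rewrite -powRM ?(ltW m0)// mulrC divfK ?gt_eqF.
have [xm1|xm1] := eqVneq (x / m)%R 1%R.
  have xm : x = m by rewrite -[x](divfK (lt0r_neq0 m0)) xm1 mul1r.
  by rewrite xE xm1 powR1 subrr mulr0 addr0 mulr1.
have := bernoulli_powR xm0 xm1.
rewrite -(ltr_pM2l mp0) -xE => H.
have E : (m `^ p + p * m `^ p * (x / m - 1) = m `^ p * (1 + p * (x / m - 1)))%R by ring.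
by rewrite E; split; [exact: ltW|move=> E'; move: H; rewrite E' ltxx].
Qed.

(** Adding the tangent inequalities at the midpoint [m] for [a] and for [b] cancels the linear
    terms, and equality in the sum forces equality in both. If [m = 0], both numbers vanish. *)
Lemma midpoint_powR (a b : R) : (0 <= a)%R -> (0 <= b)%R ->
  (((a + b) / 2) `^ p <= (a `^ p + b `^ p) / 2)%R /\
  ((((a + b) / 2) `^ p = (a `^ p + b `^ p) / 2)%R -> a = b).
Proof.
move=> a0 b0; set m := ((a + b) / 2)%R.
have : (0 <= m)%R by rewrite divr_ge0// addr_ge0.
rewrite le_eqVlt => /predU1P[m0|m0].
  have ab0 : (a + b = 0)%R by rewrite -[LHS](divfK (_ : 2 != 0 :> R)%R)// -/m -m0 mul0r.
  have -> : a = 0%R by lra.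
  have -> : b = 0%R by lra.
  by rewrite -m0 powR0// addr0 mul0r; split.
have [h1 h2] := tangent_powR a0 m0; have [k1 k2] := tangent_powR b0 m0.
have mn0 : m != 0%R by rewrite gt_eqF.
have S : (m `^ p + p * m `^ p * (a / m - 1) + (m `^ p + p * m `^ p * (b / m - 1)) = 2 * m `^ p)%R.
  have : (a / m + b / m = 2)%R.
    by rewrite -mulrDl -[(a + b)%R](divfK (_ : 2 != 0 :> R)%R)// -/m mulrC mulrA mulVf// mul1r.
  move: (a / m)%R (b / m)%R (m `^ p)%R => A B M AB.
  have -> : B = (2 - A)%R by lra.
  ring.
split.
  rewrite ler_pdivlMr// mulrC -S; exact: lerD.
move=> E; have {}E : (2 * m `^ p = a `^ p + b `^ p)%R.
  by rewrite E mulrC divfK.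
have lin (x1 x2 y1 y2 : R) : (x1 <= y1 -> x2 <= y2 -> x1 + x2 = y1 + y2 -> x1 = y1 /\ x2 = y2)%R.
  by clear h1 h2 k1 k2 S E => *; split; lra.
have [|/h2 -> /k2 -> //] := lin _ _ _ _ h1 k1 _.
by rewrite S.
Qed.

Lemma midpoint_poweR (x y : \bar R) : 0 <= x -> 0 <= y ->
  ((2^-1)%:E * (x + y)) `^ p <= (2^-1)%:E * (x `^ p + y `^ p).
Proof.
case: x => [x||]; case: y => [y||]// x0 y0; last 3 first.
- by rewrite !poweRyr// addey ?gt0_muley ?leey// -ltNye (lt_le_trans (ltNy0 _))// poweR_ge0.
- by rewrite !poweRyr// addye ?gt0_muley ?leey// -ltNye (lt_le_trans (ltNy0 _))// poweR_ge0.
- by rewrite !poweRyr// addye ?gt0_muley ?leey.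
rewrite -EFinD -EFinM !poweR_EFin -EFinD -EFinM lee_fin.
by have [+ _] := midpoint_powR x0 y0; rewrite ![(2^-1 * _)%R]mulrC.
Qed.

Lemma midpoint_poweR_eq (x y : \bar R) : 0 <= x < +oo -> 0 <= y < +oo ->
  ((2^-1)%:E * (x + y)) `^ p = (2^-1)%:E * (x `^ p + y `^ p) -> x = y.
Proof.
case: x => [x||]; case: y => [y||]//; rewrite ?ltxx ?andbF//.
rewrite !lee_fin => /andP[x0 _] /andP[y0 _].
rewrite -EFinD -EFinM !poweR_EFin -EFinD -EFinM => -[].
have [_ +] := midpoint_powR x0 y0; rewrite ![(2^-1 * _)%R]mulrC => H /H ->//.
Qed.

Hypothesis two_points : exists x y : X, x <> y.

(** An atom at [x0] would contradict the Poincare inequality. In a ball [B] that also contains a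
    ball [B'] missing [x0], the average of [w] would be close to 1 because of the atom and close to
    0 because of [B'], while [w] deviates little from it in the mean. The second point of the space
    provides the centre of [B']. *)
Lemma point_null (x0 : X) :
  (forall e : R, (0 < e)%R -> exists (w : X -> R) (g : X -> \bar R),
     [/\ measurable_fun setT w, mu.-integrable setT (EFin \o w), forall x, (0 <= w x <= 1)%R, w x0 = 1%R &
      [/\ pwug setT w g, \int[mu]_x g x `^ p <= e%:E &
         \int[mu]_(x in ~` [set x0]) (w x)%:E <= e%:E]]) ->
  mu [set x0] = 0.
Proof.
have lin (x y' z : R) : (0 < x -> x <= y' + z -> z <= x / 4 -> y' <= x / 2 -> False)%R by lra.
move=> H; have mx : measurable [set x0] by apply: borel_set_measurable; exact: borel_set_singleton.
have [y yx0] : exists y, x0 <> y.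
  have [x [y xy]] := two_points; have [E|] := pselect (x0 = x); last by exists x.
  by exists y; rewrite E.
have d0 : (0 < mdist x0 y)%R by rewrite mdist_gt0; apply/eqP.
set dd := mdist x0 y in d0.
have dd0 : (0 < 2 * dd)%R by rewrite mulr_gt0.
pose B := ball x0 (2 * dd)%R; pose B' := ball y dd.
have mB : measurable B by exact: measurable_ball.
have mB' : measurable B' by exact: measurable_ball.
have B'B : B' `<=` B by apply: ball_subset_ball; rewrite -/dd mulr_natl mulr2n.
have B'x : B' `<=` ~` [set x0].
  by move=> z + zx; rewrite /B' ballEmdist/= zx metric_sym ltxx.
have xB : [set x0] `<=` B by move=> _ ->; exact: ballxx.
have /andP[B0 By] := mu_balls x0 dd0; have /andP[B'0 B'y] := mu_balls y d0.
have [K K0 HK] := poincare_ball x0 dd0.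
have := measure_ge0 mu [set x0]; rewrite le_eqVlt => /predU1P[<-//|a0]; exfalso.
have ay : mu [set x0] < +oo by apply: le_lt_trans By; rewrite le_measure ?inE.
pose a := fine (mu [set x0]); pose b := fine (mu B').
have aE : mu [set x0] = a%:E by rewrite fineK// ge0_fin_numE// ltW.
have bE : mu B' = b%:E by rewrite fineK// ge0_fin_numE// ltW.
have a_gt0 : (0 < a)%R by rewrite -lte_fin -aE.
have b_gt0 : (0 < b)%R by rewrite -lte_fin -bE.
(* The deviation [F] is at most [K * t], so this [t] gives F (1 + b / a) <= b / 2, which together
   with [e <= b / 4] is too small to account for [b]. The summand in [K + 1] keeps the denominator
   positive. *)
pose t := (b / (2 * ((K + 1) * (1 + b / a))))%R.
have ba0 : (0 < 1 + b / a)%R by rewrite addr_gt0// divr_gt0.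
have K1 : (0 < K + 1)%R by rewrite ltr_wpDl.
have t0 : (0 < t)%R by rewrite divr_gt0// !mulr_gt0.
pose e := (Num.min (b / 4) (t `^ p))%R.
have e0 : (0 < e)%R by rewrite lt_min divr_gt0//= powR_gt0.
have [w [g [mw iw w01 w1 [pg ge we]]]] := H e e0.
have mEw : measurable_fun setT (EFin \o w) by exact/measurable_EFinP.
have Lg : Lp setT g by apply: le_lt_trans ge _; exact: ltry.
have iBfin : \int[mu]_(x in B) (w x)%:E \is a fin_num.
  by apply: integrable_fin_num => //; exact: integrableS iw.
have Bfin : mu B \is a fin_num by rewrite ge0_fin_numE// ltW.
have fB0 : (0 < fine (mu B))%R by rewrite fine_gt0// B0.
pose m := ((fine (mu B))^-1 * fine (\int[mu]_(x in B) (w x)%:E))%R.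
have mE : average w B = m%:E.
  by rewrite /average -(fineK Bfin) inver (gt_eqF fB0) -(fineK iBfin) -EFinM.
have m0 : (0 <= m)%R.
  rewrite mulr_ge0 ?invr_ge0 ?fine_ge0//; apply: integral_ge0 => x _.
  by rewrite lee_fin; case/andP: (w01 x).
have := HK w g iw pg Lg; rewrite -/B mE; set E := \int[mu]_(y in B) _ => HE.
have mwm D : measurable_fun D (fun x => `|(w x)%:E - m%:E|).
  apply: measurableT_comp => //; apply: emeasurable_funB => //; exact: measurable_funTS.
have Et : E <= (K * t)%:E.
  apply: (le_trans HE); rewrite EFinM; apply: lee_wpmul2l; first by rewrite lee_fin.
  apply: (@le_trans _ _ ((t `^ p)%:E `^ p^-1)).
    apply: le_poweR; [by rewrite invr_ge0 ltW|exact: integral_pow_ge0|].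
    by apply: (le_trans ge); rewrite lee_fin /e ge_min lexx orbT.
  by rewrite -[(t `^ p)%:E]/(t%:E `^ p) poweRKp// lee_fin ltW.
have H1 : (a * `|1 - m|)%:E <= E.
  rewrite mulrC EFinM -aE; apply: (@le_trans _ _ (\int[mu]_(x in [set x0]) `|(w x)%:E - m%:E|)).
    by apply: integral_const_le => // x ->; rewrite w1.
  exact: ge0_subset_integral.
have H2 : (b * m)%:E <= E + e%:E.
  rewrite mulrC EFinM -bE.
  apply: (@le_trans _ _ (\int[mu]_(x in B') (`|(w x)%:E - m%:E| + (w x)%:E))).
    apply: integral_const_le => //.
    - by apply: emeasurable_funD => //; exact: measurable_funTS.
    - move=> x _; rewrite -EFinB abse_EFin -EFinD lee_fin.
      have := ler_norm (m - w x)%R; rewrite distrC; lra.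
  rewrite ge0_integralD//; last 2 first.
  - by move=> x _; rewrite lee_fin; case/andP: (w01 x).
  - exact: measurable_funTS.
  apply: leeD; first exact: ge0_subset_integral.
  apply: le_trans we; apply: ge0_subset_integral => //.
  - exact: measurableC.
  - exact: measurable_funTS.
  - by move=> x _; rewrite lee_fin; case/andP: (w01 x).
have Efin : E \is a fin_num.
  by rewrite ge0_fin_numE; [apply: le_lt_trans Et _; exact: ltry|exact: integral_ge0].
move: H1 H2 Et; rewrite -(fineK Efin) -EFinD !lee_fin; set F := fine E => H1 H2 Et.
have H3 : (`|1 - m| <= F / a)%R by rewrite ler_pdivlMr// mulrC.
have H4 : (1 - m <= F / a)%R by apply: le_trans H3; exact: ler_norm.
have H5 : (b <= F + e + b * (F / a))%R.
  have : (b * (1 - m) <= b * (F / a))%R by rewrite ler_pM2l.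
  by lra.
have e4 : (e <= b / 4)%R by rewrite /e ge_min lexx.
have H6 : (F + b * (F / a) <= b / 2)%R.
  have -> : (F + b * (F / a) = F * (1 + b / a))%R by field; rewrite gt_eqF.
  apply: (@le_trans _ _ ((K + 1) * t * (1 + b / a))%R).
    by rewrite ler_pM2r//; apply: (le_trans Et); rewrite ler_pM2r// lerDl.
  rewrite le_eqVlt; apply/orP; left; apply/eqP; rewrite /t; field.
  by apply/and3P; split; rewrite gt_eqF// addr_gt0.
apply: (lin b (F + b * (F / a))%R e) => //; by rewrite addrAC.
Qed.

(** Only the integral of [w] off the point is assumed small, as rescaled truncations of a singular
    function tend to 0 only off the pole. Since the point is null and [0 <= w <= 1], this bounds the
    integral of the p-th power. *)
Lemma Cp_point_eq0 (x0 : X) :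
  (forall e : R, (0 < e)%R -> exists (w : X -> R) (g : X -> \bar R),
     [/\ measurable_fun setT w, mu.-integrable setT (EFin \o w), forall x, (0 <= w x <= 1)%R, w x0 = 1%R &
      [/\ pwug setT w g, \int[mu]_x g x `^ p <= e%:E &
         \int[mu]_(x in ~` [set x0]) (w x)%:E <= e%:E]]) ->
  Cp mu p [set x0] = 0.
Proof.
move=> H; have mu0 := point_null H.
have mx : measurable [set x0] by apply: borel_set_measurable; exact: borel_set_singleton.
apply/eqP; rewrite eq_le; apply/andP; split; last first.
  apply: le_ereal_inf_tmp => _ [u _ <-]; apply: adde_ge0; first exact: integral_pow_ge0.
  by apply: le_ereal_inf_tmp => _ [g _ <-]; exact: integral_pow_ge0.
apply/lee_addgt0Pr => e e0; rewrite add0e.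
have e20 : (0 < e / 2)%R by rewrite divr_gt0.
have [w [g [mw iw w01 w1 [pg ge we]]]] := H _ e20.
have mEw : measurable_fun setT (EFin \o w) by exact/measurable_EFinP.
have wp x : `|(w x)%:E| `^ p <= (w x)%:E.
  have /andP[w0 wl] := w01 x.
  rewrite gee0_abs ?poweR_EFin; last by rewrite lee_fin.
  rewrite lee_fin.
  move: w0; rewrite le_eqVlt => /predU1P[<-|w0]; first by rewrite powR0.
  by rewrite ge1r_powR ?w0 ?(ltW p_gt1).
have we' : \int[mu]_x `|(w x)%:E| `^ p <= (e / 2)%:E.
  have nu : (setT : set X) = [set x0] `|` ~` [set x0] by rewrite setUv.
  apply: (@le_trans _ _ (\int[mu]_x (w x)%:E)); first by apply: ge0_le_integral_nomeas => x _; [exact: poweR_ge0|exact: wp].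
  rewrite [X in \int[_]_(x in X) _]nu ge0_integral_setU//; last 4 first.
  - exact: measurableC.
  - exact: measurable_funTS.
  - by move=> x _; rewrite lee_fin; case/andP: (w01 x).
  - by rewrite disj_set2E setICr eqxx.
  rewrite null_set_integral ?add0e//; exact: measurable_funTS.
have Nw : N1p_normp mu p setT (EFin \o w) <= e%:E.
  rewrite [e](splitr e) EFinD; apply: leeD => //.
  apply: le_trans ge; apply: ereal_inf_lbound; exists g => //; exact: pwug_wug.
apply: le_trans Nw; apply: ereal_inf_lbound; exists (EFin \o w) => //; split.
  apply: N1p_intro pg _ => //; first exact: openT.
  - by apply: le_lt_trans we' _; exact: ltry.
  - by apply: le_lt_trans ge _; exact: ltry.
by move=> _ ->/=; rewrite w1.
Qed.

(** * Homogeneity and the Dirichlet problem *)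

Import HBNNSimple.

(** A simple function below [f] becomes one below [c f], so this inequality holds without
    measurability, as curve integrals of arbitrary gradients require. *)
Lemma le_integralZ_nomeas d' (T : measurableType d') (nu : {measure set T -> \bar R})
  (D : set T) (f : T -> \bar R) (c : R) : (0 < c)%R -> (forall x, D x -> 0 <= f x) ->
  c%:E * \int[nu]_(x in D) f x <= \int[nu]_(x in D) (c%:E * f x).
Proof.
move=> c0 f0; rewrite muleC -lee_pdivlMr// [in leLHS]ge0_integralE//.
apply: ub_ereal_sup => _ [h hf <-]; have h0 x : (0 <= h x)%R by exact: fun_ge0.
 rewrite lee_pdivlMr// muleC.
rewrite -integralT_nnsfun -ge0_integralZl//; last by rewrite lee_fin ltW.
  rewrite [leRHS]integral_mkcond; apply: ge0_le_integral_nomeas => x _.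
    by rewrite mule_ge0 ?lee_fin ?(ltW c0)// h0.
  move: (hf x); rewrite !patchE; case: ifPn => // _ hx.
    by apply: lee_wpmul2l => //; rewrite lee_fin ltW.
  have : c%:E * (h x)%:E <= c%:E * 0 by apply: lee_wpmul2l => //; rewrite lee_fin ltW.
  by rewrite mule0.
  exact/measurable_EFinP.
by move=> x _; rewrite lee_fin h0.
Qed.

Lemma integral_powZ (c : R) h D : (0 < c)%R -> measurable D -> measurable_fun D h ->
  (forall x, D x -> 0 <= h x) ->
  \int[mu]_(x in D) (c%:E * h x) `^ p = (c `^ p)%:E * \int[mu]_(x in D) h x `^ p.
Proof.
move=> c0 mD mh h0; rewrite -ge0_integralZl//.
- by apply: eq_integral => x /[!inE] Dx; rewrite poweRM ?lee_fin ?(ltW c0)// h0.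
- exact: measurable_pow.
- by move=> x _; exact: poweR_ge0.
- by rewrite lee_fin powR_ge0.
Qed.

Lemma wugZ A (F : X -> \bar R) g (c : R) : (0 < c)%R -> weak_upper_gradient mu p A F g ->
  weak_upper_gradient mu p A (fun x => c%:E * F x) (fun x => c%:E * g x).
Proof.
move=> c0 [mg g0 [Gam exG H]]; split.
- exact: measurable_funeM.
- by move=> x Ax; rewrite mule_ge0 ?lee_fin ?(ltW c0)// g0.
exists Gam => // gam l cg nG.
have -> : c%:E * F (gam 0%R) - c%:E * F (gam l) = c%:E * (F (gam 0%R) - F (gam l)).
  by case: (F _) (F _) => [x||] [y||]; rewrite ?gt0_muley ?gt0_muleNy ?lte_fin//= -?EFinM -?EFinB -?EFinM ?mulrBr//
    ?gt0_muley ?gt0_muleNy ?lte_fin.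
rewrite abseM gee0_abs ?lee_fin ?(ltW c0)//.
apply: (@le_trans _ _ (c%:E * curve_integral g gam l)).
  by apply: lee_wpmul2l; [rewrite lee_fin ltW|exact: H].
apply: le_integralZ_nomeas => // t; case: cg => _ gA _ tl; apply: g0; apply: gA.
by exists t.
Qed.

Lemma is_minimal_wugZ A (F : X -> \bar R) g (c : R) : (0 < c)%R -> measurable A ->
  is_minimal_wug mu p A F g ->
  is_minimal_wug mu p A (fun x => c%:E * F x) (fun x => c%:E * g x).
Proof.
have LZ (k : R) h : (0 < k)%R -> measurable A -> measurable_fun A h -> (forall x, A x -> 0 <= h x) ->
    Lp_loc mu p A h -> Lp_loc mu p A (fun x => k%:E * h x).
  move=> k0 mA mh h0 Lh x Ax; have [r r0 fin] := Lh x Ax; exists r => //.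
  have mB : measurable (A `&` ball x r) by apply: measurableI => //; exact: measurable_ball.
  rewrite integral_powZ//.
  - by apply: lte_mul_pinfty => //; rewrite lee_fin powR_ge0.
  - exact: measurable_funS mh.
  - by move=> y [Ay _]; exact: h0.
have KZ (k : R) (y : \bar R) : (0 < k)%R -> (k^-1)%:E * (k%:E * y) = y.
  by move=> k0; rewrite muleA -EFinM mulVf ?gt_eqF// mul1e.
move=> c0 mA [wg Lg ming]; have [mg g0 _] := wg; split.
- exact: wugZ.
- exact: LZ.
move=> g' wg' Lg'; have [mg' g'0 _] := wg'.
have c'0 : (0 < c^-1)%R by rewrite invr_gt0.
have := ming (fun x => (c^-1)%:E * g' x) _ (LZ _ _ c'0 mA mg' g'0 Lg').
have -> : F = (fun x => (c^-1)%:E * (c%:E * F x)) by apply/funext => x; rewrite KZ.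
move=> /(_ (wugZ c'0 wg')); apply: filterS => x le Ax.
have := le Ax; rewrite -(@lee_pmul2l _ c%:E)// ?lte_fin//.
by rewrite [leRHS]muleA -EFinM mulfV ?gt_eqF// mul1e.
Qed.

Lemma integral_minimal_wugZ A (F : X -> \bar R) (c : R) D : (0 < c)%R -> measurable A ->
  measurable D -> D `<=` A ->
  \int[mu]_(x in D) minimal_wug mu p A (fun x => c%:E * F x) x `^ p =
  (c `^ p)%:E * \int[mu]_(x in D) minimal_wug mu p A F x `^ p.
Proof.
move=> c0 mA mD DA.
have [[g mg]|H] := pselect (exists g, is_minimal_wug mu p A F g).
  rewrite (integral_minimal_wug mA mD DA mg).
  rewrite (integral_minimal_wug mA mD DA (is_minimal_wugZ c0 mA mg)) integral_powZ//.
  - by have [[mg' _ _] _ _] := mg; exact: measurable_funS mg'.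
  - by have [[_ g0 _] _ _] := mg; move=> x /DA; exact: g0.
(* Neither function has a minimal gradient in this case, so both integrands are the default 0. *)
rewrite !integral0_eq ?mule0//.
- move=> x _; rewrite /minimal_wug xgetPN ?poweR0r// => g mg; apply: H; by exists g.
- move=> x _; rewrite /minimal_wug xgetPN ?poweR0r// => g mg; apply: H.
  exists (fun x => (c^-1)%:E * g x).
  have -> : F = (fun x => (c^-1)%:E * (c%:E * F x)).
    by apply/funext => y; rewrite muleA -EFinM mulVf ?gt_eqF// mul1e.
  by apply: is_minimal_wugZ => //; rewrite invr_gt0.
Qed.

Lemma N1pZ A (F : X -> \bar R) (c : R) : (0 < c)%R -> measurable A ->
  N1p mu p A F -> N1p mu p A (fun x => c%:E * F x).
Proof.
move=> c0 mA [mF /N1p_normp_lt[g wg lt]]; split; first exact: measurable_funeM.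
have [mg g0 _] := wg.
apply: (@le_lt_trans _ _ ((c `^ p)%:E * (\int[mu]_(x in A) `|F x| `^ p + \int[mu]_(x in A) g x `^ p))).
  rewrite muleDr//; last by rewrite ge0_adde_def// inE; exact: integral_pow_ge0.
  rewrite -!integral_powZ//; last exact: measurableT_comp.
  apply: leeD.
    under eq_integral do rewrite abseM gee0_abs ?lee_fin ?(ltW c0)//.
    by [].
  by apply: ereal_inf_lbound; exists (fun x => c%:E * g x) => //; exact: wugZ.
by apply: lte_mul_pinfty => //; rewrite lee_fin powR_ge0.
Qed.

Lemma N1p_locZ V (F : X -> \bar R) (c : R) : (0 < c)%R ->
  N1p_loc mu p V F -> N1p_loc mu p V (fun x => c%:E * F x).
Proof.
move=> c0 NF x Vx; have [r [r0 BV NB]] := NF x Vx; exists r; split => //.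
by apply: N1pZ => //; exact: measurable_ball.
Qed.

Lemma N1p0Z V (F : X -> \bar R) (c : R) : (0 < c)%R ->
  N1p0 mu p V F -> N1p0 mu p V (fun x => c%:E * F x).
Proof.
move=> c0 [NF F0]; split; first exact: N1pZ.
by move=> x /F0 ->; rewrite mule0.
Qed.

Lemma measurable_neq0 (F : X -> \bar R) : measurable_fun setT F -> measurable [set x | F x != 0].
Proof.
move=> mF; rewrite -[X in measurable X]setTI; exact: measurable_neqe.
Qed.

(** Testing the scaled function with [phi] amounts to testing the original one with [phi / c], which
    has the same support. *)
Lemma pharmonicZ V (h : X -> \bar R) (c : R) : (0 < c)%R -> open V ->
  pharmonic mu p V h -> pharmonic mu p V (fun x => c%:E * h x).
Proof.
move=> c0 oV [hfin hcont [Nh minh]]; have mV := open_measurable oV.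
split.
- by move=> x Vx; rewrite fin_numM// hfin.
- move=> x; apply: cvgeZl => //; exact: hcont.
split; first exact: N1p_locZ.
move=> phi [Nphi phi0].
have c'0 : (0 < c^-1)%R by rewrite invr_gt0.
have := minh _ (N1p0Z c'0 (conj Nphi phi0)).
have -> : [set x | (c^-1)%:E * phi x != 0] = [set x | phi x != 0].
  apply/seteqP; split => x /=; rewrite mule_eq0 negb_or; first by case/andP.
  by move=> ->; rewrite eqe invr_eq0 gt_eqF.
have mD : measurable [set x | phi x != 0] by apply: measurable_neq0; case: Nphi.
have DV : [set x | phi x != 0] `<=` V.
  by move=> x /= /eqP; apply: contra_notP => /phi0.
rewrite integral_minimal_wugZ//.
have -> : (fun x => c%:E * h x) \+ phi = (fun x => c%:E * (h \+ (fun x => (c^-1)%:E * phi x)) x).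
  apply/funext => x /=; rewrite muleDr//.
    by rewrite [X in _ = _ + X]muleA -EFinM mulfV ?gt_eqF// mul1e.
  have [Vx|/phi0 ->] := pselect (V x); first by apply: fin_num_adde_defr; exact: hfin.
  by rewrite mule0; apply: fin_num_adde_defl.
rewrite integral_minimal_wugZ// => le; apply: lee_wpmul2l => //.
by rewrite lee_fin powR_ge0.
Qed.

Lemma integral_powD_lty A (h h' k : X -> \bar R) : measurable A ->
  measurable_fun A h -> measurable_fun A h' ->
  (forall x, A x -> 0 <= h x) -> (forall x, A x -> 0 <= h' x) ->
  (forall x, A x -> 0 <= k x <= h x + h' x) ->
  \int[mu]_(x in A) h x `^ p < +oo -> \int[mu]_(x in A) h' x `^ p < +oo ->
  \int[mu]_(x in A) k x `^ p < +oo.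
Proof.
move=> mA mh mh' h0 h'0 kh Lh Lh'.
apply: (@le_lt_trans _ _ (\int[mu]_(x in A) ((2 `^ p)%:E * (h x `^ p + h' x `^ p)))).
  apply: ge0_le_integral_nomeas => x Ax; first exact: poweR_ge0.
  have /andP[k0 kl] := kh x Ax.
  by apply: le_trans (poweRD_le (h0 x Ax) (h'0 x Ax)); apply: le_poweR => //; exact: ltW.
have mhp := measurable_pow mh; have mh'p := measurable_pow mh'.
rewrite ge0_integralZl//.
- rewrite ge0_integralD//; last 2 first.
  + by move=> x _; exact: poweR_ge0.
  + by move=> x _; exact: poweR_ge0.
  apply: lte_mul_pinfty => //; exact: lte_add_pinfty.
- exact: emeasurable_funD.
- by move=> x _; rewrite adde_ge0// poweR_ge0.
Qed.

Lemma LpD A g g' : measurable A -> borel_fun g -> borel_fun g' ->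
  (forall x, 0 <= g x) -> (forall x, 0 <= g' x) -> Lp A g -> Lp A g' -> Lp A (g \+ g').
Proof.
move=> mA bg bg' g0 g'0; apply: integral_powD_lty => //.
- exact: borel_fun_measurable.
- exact: borel_fun_measurable.
- by move=> x _; rewrite lexx andbT adde_ge0.
Qed.

(** [N1p] for real functions, with a Borel gradient in place of the infimum. *)
Definition newton A f := [/\ measurable_fun A f, \int[mu]_(x in A) `|(f x)%:E| `^ p < +oo &
  exists2 g, pwug A f g & Lp A g].

Lemma newton_N1p A f : open A -> newton A f -> N1p mu p A (EFin \o f).
Proof.
move=> oA [mf If [g pg Lg]]; apply: (N1p_intro oA _ _ _ pg Lg) => //.
exact/measurable_EFinP.
Qed.

Lemma N1p_newton A (F : X -> \bar R) f : open A -> N1p mu p A F -> measurable_fun A f ->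
  (forall x y, A x -> A y -> `|f x - f y|%:E <= `|F x - F y|) ->
  (forall x, A x -> `|f x|%:E <= `|F x|) -> newton A f.
Proof.
move=> oA NF mf fF fF0; split => //; last exact: N1p_pwug NF _.
have [_ /N1p_normp_lt[g _ lt]] := NF.
apply: (@le_lt_trans _ _ (\int[mu]_(x in A) `|F x| `^ p)).
  apply: ge0_le_integral_nomeas => x Ax; first exact: poweR_ge0.
  by apply: le_poweR; [exact: ltW|by []|exact: fF0].
by apply: le_lt_trans lt; rewrite leeDl// integral_pow_ge0.
Qed.

Lemma newton_contraction A f f' : newton A f -> measurable_fun A f' ->
  (forall x y, A x -> A y -> (`|f' x - f' y| <= `|f x - f y|)%R) ->
  (forall x, A x -> (`|f' x| <= `|f x|)%R) -> newton A f'.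
Proof.
move=> [mf If [g pg Lg]] mf' ff ff0; split; first exact: mf'; last first.
  by exists g; [exact: pwug_map pg _|exact: Lg].
apply: le_lt_trans If; apply: ge0_le_integral_nomeas => x Ax; first exact: poweR_ge0.
by apply: le_poweR; [exact: ltW|by []|rewrite lee_fin ff0].
Qed.

Lemma newtonD A f f' : measurable A -> newton A f -> newton A f' -> newton A (f \+ f')%R.
Proof.
move=> mA [mf If [g pg Lg]] [mf' If' [g' pg' Lg']]; split.
- exact: measurable_funD.
- apply: (integral_powD_lty mA _ _ _ _ _ If If') => //.
  + by apply: measurableT_comp => //; exact/measurable_EFinP.
  + by apply: measurableT_comp => //; exact/measurable_EFinP.
  + by move=> x Ax; rewrite abse_ge0/= lee_fin ler_normD.
have [bg g0 _] := pg; have [bg' g'0 _] := pg'.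
by exists (g \+ g'); [exact: pwugD|exact: LpD].
Qed.

Lemma newtonZ A f (c : R) : measurable A -> newton A f -> newton A (fun x => c * f x)%R.
Proof.
move=> mA [mf If [g pg Lg]]; have [bg g0 _] := pg.
have [->|c0] := eqVneq c 0%R.
  split.
  - by apply: measurable_funM => //; exact: measurable_cst.
  - rewrite integral0_eq// => x Ax; by rewrite mul0r abse0 poweR0r.
  - exists (cst 0); last by rewrite /Lp integral0_eq// => x Ax; rewrite poweR0r.
    by apply: (pwug_eq (pwug_cst A 0%R)) => x _; rewrite mul0r.
have c0' : (0 < `|c|)%R by rewrite normr_gt0.
split.
- by apply: measurable_funM => //; exact: measurable_cst.
- under eq_integral do rewrite EFinM abseM abse_EFin.
  rewrite integral_powZ//.
  + by apply: lte_mul_pinfty => //; rewrite lee_fin powR_ge0.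
  + by apply: measurableT_comp => //; exact/measurable_EFinP.
exists (fun x => `|c|%:E * g x); first exact: pwugM.
rewrite /Lp integral_powZ//; last exact: borel_fun_measurable.
by apply: lte_mul_pinfty => //; rewrite lee_fin powR_ge0.
Qed.

(** The good gradient [k] of [H + u] lives only on [D], whereas minimality asks for a gradient on
    all of [G]. Any [k0] there will do: merging brings it down to at most [k] on [D], which contains
    the support of [u]. *)
Lemma minimizer_le_local G (h : X -> \bar R) (H : X -> R) g (u : X -> R) k0 D k :
  open G -> open D -> D `<=` G -> minimizer mu p G h -> (forall x, G x -> h x = (H x)%:E) ->
  minimal_pwug G H g -> newton setT u -> (forall x, ~ D x -> u x = 0%R) ->
  pwug G (H \+ u)%R k0 -> Lp G k0 -> pwug D (H \+ u)%R k -> Lp D k ->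
  \int[mu]_(x in [set x | u x != 0%R]) g x `^ p <= \int[mu]_(x in [set x | u x != 0%R]) k x `^ p.
Proof.
move=> oG oD DG [_ minh] hH mg Nu u0 pk0 Lk0 pk Lk.
have mG := open_measurable oG; have mD := open_measurable oD.
pose U := [set x | u x != 0%R].
have UD : U `<=` D by move=> x /eqP; apply: contra_notP => /u0.
have UG : U `<=` G by move=> x /UD /DG.
have N1u := newton_N1p openT Nu.
have UE : [set x | (EFin \o u) x != 0] = U by apply/seteqP; split => x /=; rewrite eqe.
have mU : measurable U by rewrite -UE; apply: measurable_neq0; case: N1u.
have N0u : N1p0 mu p G (EFin \o u).
  by split => // x nG; rewrite /= u0// => /DG.
have [bk0 k00 _] := pk0; have [bk k_0 _] := pk.
pose k1 x := if x \in D then mine (k0 x) (k x) else k0 x.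
have pk1 : pwug G (H \+ u)%R k1 by exact: pwug_merge.
have [bk1 k10 _] := pk1.
have Lk1 : Lp G k1.
  apply: Lp_le Lk0 => // x _; rewrite /k1; case: ifPn => // _; by rewrite ge_min lexx.
have := minh _ N0u; rewrite UE.
rewrite (integral_minimal_wug mG mU UG (minimal_pwug_is_minimal_wug oG hH mg)).
move=> /le_trans; apply.
apply: (@le_trans _ _ (\int[mu]_(x in U) k1 x `^ p)).
  apply: integral_minimal_wug_le => //.
  - apply: wug_contraction (pwug_wug mG pk1) _ => x y Gx Gy.
    by rewrite /= !hH.
  - move=> x Gx; exists 1%R => //; apply: Lp_subset Lk1 => //.
    by apply: measurableI => //; exact: measurable_ball.
apply: ge0_le_integral_nomeas => x Ux; first exact: poweR_ge0.
apply: le_poweR; [exact: ltW|exact: k10|].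
by rewrite /k1 mem_set ?ge_min ?lexx ?orbT//; exact: UD.
Qed.

Lemma fine_continuous_within V (F : X -> \bar R) (f : X -> R) : open V ->
  {within V, continuous F} -> (forall x, V x -> F x = (f x)%:E) ->
  {in V, continuous f}.
Proof.
move=> oV; rewrite continuous_open_subspace// => cF Ff x; rewrite inE => Vx.
have /fine_cvg : F @ x --> (f x)%:E.
  by rewrite -Ff//; apply: cF; rewrite inE.
move=> H; apply: cvg_trans H; apply: near_eq_cvg.
near=> y; rewrite /= Ff//; near: y; exact: open_nbhs_nbhs.
Unshelve. all: by end_near. Qed.

Lemma open_ltr_in V (f f' : X -> R) : open V -> {in V, continuous f} -> {in V, continuous f'} ->
  open (V `&` [set x | f x < f' x]%R).
Proof.
move=> oV cf cf'; rewrite openE => x [Vx lt]; rewrite /interior.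
have Vx' : x \in V by rewrite inE.
pose e := ((f' x - f x) / 2)%R; have e0 : (0 < e)%R by rewrite divr_gt0// subr_gt0.
have /cvgr_lt/(_ (f x + e)%R) := cf x Vx'; rewrite ltrDl => /(_ e0) h1.
have /cvgr_gt/(_ (f' x - e)%R) := cf' x Vx'; rewrite ltrBlDr ltrDl => /(_ e0) h2.
near=> y; split.
  by near: y; exact: open_nbhs_nbhs.
have : (f y < f x + e)%R by near: y.
have : (f' x - e < f' y)%R by near: y.
by move=> /= i1 i2; move: e0; rewrite /e in i1 i2 *; lra.
Unshelve. all: by end_near. Qed.

Lemma measurable_continuous_in V f : open V -> {in V, continuous f} -> measurable_fun V f.
Proof.
move=> oV cf; apply/measurable_EFinP; apply: measurable_open_levels => // a.
have ca : {in V, continuous (cst a : X -> R)} by move=> x _; exact: cvg_cst.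
have := open_ltr_in oV ca cf; congr open; apply: eq_set => x /=.
Qed.

Lemma Lp_patch A k : Lp A k -> Lp setT (k \_ A).
Proof.
rewrite /Lp integral_mkcond; apply: le_lt_trans.
apply: ge0_le_integral_nomeas => x _; first exact: poweR_ge0.
by rewrite !patchE; case: ifPn => // _; rewrite poweR0r.
Qed.

Lemma Lp_ae_lty A g : measurable A -> borel_fun g -> (forall x, 0 <= g x) -> Lp A g ->
  {ae mu, forall x, A x -> g x < +oo}.
Proof.
move=> mA bg g0 Lg.
have ig : mu.-integrable A (fun x => g x `^ p).
  apply/integrableP; split; first exact/measurable_pow/borel_fun_measurable.
  by under eq_integral do rewrite gee0_abs ?poweR_ge0//.
have := integrable_ae mA ig; apply: filterS => x h Ax; have := h Ax.
move: (g0 x); case: (g x) => [r _ _|_|//]; first exact: ltry.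
by rewrite poweRyr.
Qed.

(** * Uniqueness of p-harmonic extensions *)

Section dirichlet_comparison.
Variables (G : set X) (h1 h2 : X -> \bar R) (H1 H2 psi : X -> R).
Hypotheses (oG : open G) (harm1 : pharmonic mu p G h1) (harm2 : pharmonic mu p G h2).
Hypotheses (hH1 : forall x, G x -> h1 x = (H1 x)%:E) (hH2 : forall x, G x -> h2 x = (H2 x)%:E).
Variables (k1 k2 : X -> \bar R).
Hypotheses (pk1 : pwug G H1 k1) (Lk1 : Lp G k1) (pk2 : pwug G H2 k2) (Lk2 : Lp G k2).
Hypotheses (psiG : forall x, G x -> psi x = (H2 x - H1 x)%R)
  (psi0 : forall x, ~ G x -> psi x = 0%R) (Npsi : newton setT psi).

Let mG : measurable G := open_measurable oG.
Let D := G `&` [set x | H1 x < H2 x]%R.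
Let phi x := Num.max (psi x) 0%R.

Let cH1 : {in G, continuous H1}.
Proof. by have [_ c _] := harm1; exact: fine_continuous_within c hH1. Qed.

Let cH2 : {in G, continuous H2}.
Proof. by have [_ c _] := harm2; exact: fine_continuous_within c hH2. Qed.

Let oD : open D. Proof. exact: open_ltr_in. Qed.
Let mD : measurable D := open_measurable oD.
Let DG : D `<=` G. Proof. by move=> x []. Qed.

Let phiD x : D x -> phi x = (H2 x - H1 x)%R.
Proof.
by move=> [Gx lt]; rewrite /phi psiG//; apply/max_idPl; rewrite subr_ge0 ltW.
Qed.

Let phi0 x : ~ D x -> phi x = 0%R.
Proof.
move=> nD; rewrite /phi; have [Gx|/psi0 ->] := pselect (G x); last by rewrite maxxx.
apply/max_idPr; rewrite psiG// subr_le0 leNgt; apply/negP => lt; exact: nD.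
Qed.

Let phi_gt0 x : D x -> (0 < phi x)%R.
Proof. by move=> Dx; rewrite phiD// subr_gt0; case: Dx. Qed.

Let Nphi : newton setT phi.
Proof.
apply: (newton_contraction Npsi).
- have [mpsi _ _] := Npsi; apply: measurable_maxr => //; exact: measurable_cst.
- by move=> x y _ _; apply: le_trans (ler_dist_max _ _ _ _) _; rewrite subrr normr0 ge_max lexx normr_ge0.
- move=> x _; rewrite /phi; case: (leP (psi x) 0%R) => // h; by rewrite normr0.
Qed.

Let supp_phi (t : R) : t != 0%R -> [set x | (t * phi x)%R != 0%R] = D.
Proof.
move=> t0; apply/seteqP; split => x /=.
  by rewrite mulf_eq0 (negbTE t0)/=; move=> /eqP; apply: contra_notP => /phi0.
by move=> Dx; rewrite mulf_neq0// gt_eqF// phi_gt0.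
Qed.

(** On [D], [t = 1] turns [H1] into [H2], [t = -1] turns [H2] into [H1], and [t = 1 / 2] turns [H1]
    into the mean; the set of integration is [D] in each case. *)
Let energy_le h H k g (t : R) kD : t != 0%R -> pharmonic mu p G h ->
  (forall x, G x -> h x = (H x)%:E) -> minimal_pwug G H g -> pwug G H k -> Lp G k ->
  pwug D (fun x => H x + t * phi x)%R kD -> Lp D kD ->
  \int[mu]_(x in D) g x `^ p <= \int[mu]_(x in D) kD x `^ p.
Proof.
move=> t0 [_ _ minh] hH mg pk Lk pkD LkD; rewrite -(supp_phi t0).
have Nt := newtonZ t measurableT Nphi; have [_ _ [gt pgt Lgt]] := Nt.
have pgtG := pwug_subset measurableT mG (@subsetT _ _) pgt.
have [bk k0 _] := pk; have [bgt gt0 _] := pgt.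
apply: (minimizer_le_local oG oD DG minh hH mg Nt _ (pwugD mG pk pgtG) _ pkD LkD).
- by move=> x /phi0 ->; rewrite mulr0.
- by apply: LpD => //; apply: Lp_subset Lgt.
Qed.

Variables (g1 g2 : X -> \bar R).
Hypotheses (mg1 : minimal_pwug G H1 g1) (mg2 : minimal_pwug G H2 g2).

Let pg1 : pwug G H1 g1. Proof. by case: mg1. Qed.
Let pg2 : pwug G H2 g2. Proof. by case: mg2. Qed.
Let bg1 : borel_fun g1. Proof. by case: pg1. Qed.
Let bg2 : borel_fun g2. Proof. by case: pg2. Qed.
Let g10 x : 0 <= g1 x. Proof. by case: pg1 => _ + _; exact. Qed.
Let g20 x : 0 <= g2 x. Proof. by case: pg2 => _ + _; exact. Qed.

Let LpGD g : borel_fun g -> Lp G g -> Lp D g.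
Proof. by move=> bg; exact: Lp_subset. Qed.

Let Lg1 : Lp D g1. Proof. by apply: LpGD => //; case: mg1. Qed.
Let Lg2 : Lp D g2. Proof. by apply: LpGD => //; case: mg2. Qed.
Let pg1D : pwug D H1 g1. Proof. exact: pwug_subset pg1. Qed.
Let pg2D : pwug D H2 g2. Proof. exact: pwug_subset pg2. Qed.

Let energy12 : \int[mu]_(x in D) g1 x `^ p <= \int[mu]_(x in D) g2 x `^ p.
Proof.
apply: (energy_le (t := 1) _ harm1 hH1 mg1 pk1 Lk1 _ Lg2) => //.
by apply: (pwug_eq pg2D) => x Dx; rewrite mul1r phiD// addrC subrK.
Qed.

Let energy21 : \int[mu]_(x in D) g2 x `^ p <= \int[mu]_(x in D) g1 x `^ p.
Proof.
apply: (energy_le (t := (-1)%R) _ harm2 hH2 mg2 pk2 Lk2 _ Lg1); first by rewrite oppr_eq0 oner_eq0.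
by apply: (pwug_eq pg1D) => x Dx; rewrite mulN1r phiD// opprB addrC subrK.
Qed.

(* Strict convexity: the mean of H1 and H2 is an admissible competitor for H1. *)
Let gradients_ae_eq : {ae mu, forall x, D x -> g1 x = g2 x}.
Proof.
have hn0 : (2^-1 != 0 :> R)%R by rewrite invr_eq0.
have h0 : (0 < 2^-1 :> R)%R by rewrite invr_gt0.
pose gm x := (2^-1)%:E * (g1 x + g2 x).
have pgm : pwug D (fun x => H1 x + 2^-1 * phi x)%R gm.
  have := pwugM 2^-1%R (pwugD mD pg1D pg2D); rewrite gtr0_norm// => H.
  by apply: (pwug_eq H) => x Dx /=; rewrite phiD//; lra.
have mgp1 := measurable_pow (borel_fun_measurable (D := D) bg1).
have mgp2 := measurable_pow (borel_fun_measurable (D := D) bg2).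
have I2 : \int[mu]_(x in D) ((2^-1)%:E * (g1 x `^ p + g2 x `^ p)) = \int[mu]_(x in D) g1 x `^ p.
  rewrite ge0_integralZl//; last 2 first.
  - exact: emeasurable_funD.
  - by move=> x _; rewrite adde_ge0// poweR_ge0.
  rewrite ge0_integralD//; last 2 first.
  - by move=> x _; exact: poweR_ge0.
  - by move=> x _; exact: poweR_ge0.
  have -> : \int[mu]_(x in D) g2 x `^ p = \int[mu]_(x in D) g1 x `^ p.
    by apply/eqP; rewrite eq_le energy12 energy21.
  have fin : \int[mu]_(x in D) g1 x `^ p \is a fin_num.
    by rewrite ge0_fin_numE// integral_pow_ge0.
  by rewrite -(fineK fin) -EFinD -EFinM; congr EFin; lra.
have gmle x : gm x `^ p <= (2^-1)%:E * (g1 x `^ p + g2 x `^ p) by exact: midpoint_poweR.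
have Lgm : Lp D gm.
  by apply: (@le_lt_trans _ _ (\int[mu]_(x in D) g1 x `^ p)) => //; rewrite -I2;
    apply: ge0_le_integral_nomeas => x _; rewrite ?poweR_ge0.
have le := energy_le hn0 harm1 hH1 mg1 pk1 Lk1 pgm Lgm.
have bgm : borel_fun gm by case: pgm.
have ae : {ae mu, forall x, D x -> gm x `^ p = (2^-1)%:E * (g1 x `^ p + g2 x `^ p)}.
  apply: ae_eq_le_integral => //.
  - exact/measurable_pow/borel_fun_measurable.
  - by apply: measurable_funeM; exact: emeasurable_funD.
  - by move=> x _; exact: poweR_ge0.
  - by rewrite I2.
  - by rewrite I2.
apply: filterS3 ae (Lp_ae_lty mD bg1 g10 Lg1) (Lp_ae_lty mD bg2 g20 Lg2) => x e f1 f2 Dx.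
by apply: midpoint_poweR_eq; rewrite ?g10 ?g20 ?f1 ?f2//; exact: e.
Qed.

(* H1 is compared with min(H2, c), which has no gradient where H2 >= c. *)
Let gradient_vanish_level (c : R) :
  {ae mu, forall x, D x -> (H1 x < c <= H2 x)%R -> g1 x = 0}.
Proof.
pose V := G `&` [set x | H1 x < c]%R; pose C := G `&` [set x | H2 x < c]%R.
have cc : {in G, continuous (cst c : X -> R)} by move=> x _; exact: cvg_cst.
have oV : open V by exact: open_ltr_in.
have oC : open C by exact: open_ltr_in.
have oDV : open (D `&` V) by exact: openI.
have mDV := open_measurable oDV.
pose w x : R := Num.max (Num.min (H2 x) c - H1 x)%R 0%R.
pose u x : R := if x \in G then w x else 0%R.
have uG x : G x -> u x = w x by move=> Gx; rewrite /u mem_set.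
have [mphi Iphi [gphi pgphi Lgphi]] := Nphi.
have mw : measurable_fun G w.
  apply: measurable_maxr; last exact: measurable_cst.
  apply: measurable_funB; last exact: measurable_continuous_in.
  by apply: measurable_minr; [exact: measurable_continuous_in|exact: measurable_cst].
have mu' : measurable_fun setT u.
  rewrite -(setUv G); apply/measurable_funU => //; first exact: measurableC.
  split.
    by apply: eq_measurable_fun mw => x xG; rewrite /u xG.
  apply: (eq_measurable_fun (cst 0%R : X -> R)); last exact: measurable_cst.
  by move=> x; rewrite inE /u => /= nG; rewrite memNset.
have u_le x : (0 <= u x <= phi x)%R.
  rewrite /u; case: ifPn => [|_].
    rewrite inE => Gx; rewrite le_max lexx orbT/= /phi psiG//.
    rewrite ge_max !le_max lexx orbT andbT lerB// ge_min lexx//.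
  by rewrite lexx le_max lexx orbT.
have phiNG x : ~ G x -> phi x = 0%R by move=> nG; apply: phi0 => /DG.
have pu : pwug G u (g2 \+ g1).
  have pd := pwugD mG pg2 (pwugN pg1).
  have pmin : pwug G (fun x => Num.min (H2 x) c) g2.
    apply: pwug_map pg2 _ => x y _ _.
    have := ler_dist_clamp (H2 x) (H2 y) (Num.min (Num.min (H2 x) (H2 y)) c) c.
    rewrite !(max_idPl _) ?ge_min ?lexx ?orbT//.
  have pd' := pwugD mG pmin (pwugN pg1).
  apply: pwug_map pd' _ => x y Gx Gy; rewrite /u !mem_set// /w.
  by apply: le_trans (ler_dist_max _ _ _ _) _; rewrite subrr normr0 ge_max lexx normr_ge0.
have puT : pwug setT u ((g2 \+ g1) \_ G) by exact: (pwug_zero_extension oG pgphi Lgphi pu u_le phiNG).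
have [L1 L2] : Lp G g1 /\ Lp G g2 by case: mg1; case: mg2.
have Nu : newton setT u.
  split; [exact: mu'| |by exists ((g2 \+ g1) \_ G); [exact: puT|apply/Lp_patch/LpD]].
  apply: le_lt_trans Iphi; apply: ge0_le_integral_nomeas => x _; first exact: poweR_ge0.
  have /andP[u0 ul] := u_le x.
  apply: le_poweR; [exact: ltW|by []|rewrite lee_fin !ger0_norm//].
  exact: le_trans ul.
have uDV x : ~ (D `&` V) x -> u x = 0%R.
  move=> nDV; rewrite /u; case: ifPn => //; rewrite inE => Gx; apply/max_idPr.
  rewrite subr_le0 ge_min; apply/orP.
  have [l1|l1] := leP (H2 x) (H1 x); first by left.
  by right; rewrite leNgt; apply/negP => l2; apply: nDV.
have uE : [set x | u x != 0%R] = D `&` V.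
  apply/seteqP; split => x /=; first by move=> /eqP; apply: contra_notP => /uDV.
  move=> [[Gx l1] [_ l2]]; rewrite /u mem_set// /w gt_eqF//.
  by rewrite lt_max subr_gt0 lt_min l1 l2.
have pD : pwug (D `&` V) (H1 \+ u)%R (g2 \_ C).
  have pDV : pwug (D `&` V) (fun x => - H2 x)%R g2.
    by apply: pwugN; apply: pwug_subset pg2D.
  have LDV : Lp (D `&` V) g2 by apply: Lp_subset Lg2.
  have HC x : (D `&` V) x -> (- c < - H2 x)%R -> C x.
    by move=> [[Gx _] _]; rewrite ltrN2.
  have := pwugN (pwug_truncate mDV pDV LDV (open_borel_set oC) HC).
  move=> /pwug_eq; apply => x [[Gx l1] [_ l2]].
  rewrite /= uG// /w.
  rewrite oppr_max !opprK; move: l1 l2 => /= l1 l2.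
  have : (0 <= Num.min (H2 x) c - H1 x)%R by rewrite subr_ge0 le_min !ltW.
  by move=> /max_idPl ->; rewrite addrC subrK.
have LD : Lp (D `&` V) (g2 \_ C).
  apply: (Lp_subset (A := D)) => //; first exact: borel_fun_patch (open_borel_set oC).
  apply: Lp_le Lg2 => //; first exact: borel_fun_patch (open_borel_set oC).
  - by move=> x; exact: erestrict_ge0.
  - by move=> x _; rewrite patchE; case: ifPn.
have [_ _ minh] := harm1; have [_ _ [gu pgu Lgu]] := Nu.
have puG := pwug_subset measurableT mG (@subsetT _ _) puT.
have b21 : borel_fun ((g2 \+ g1) \_ G) by case: puT.
have LuG : Lp G ((g2 \+ g1) \_ G).
  by apply: (Lp_subset (A := setT)) => //; apply/Lp_patch/LpD.
have ge21 x : 0 <= ((g2 \+ g1) \_ G) x by case: puT => _ + _; exact.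
have := minimizer_le_local oG oDV (fun x H => DG H.1) minh hH1 mg1 Nu uDV
  (pwugD mG pk1 puG) _ pD LD.
have [bk1 k10 _] := pk1.
rewrite uE => /(_ (LpD mG bk1 b21 k10 ge21 Lk1 LuG)) le.
have bC : borel_set C by exact: open_borel_set.
(* As [g1] and [g2] agree almost everywhere on [D], the energy of [g1] is at most that of its
   restriction to [C]. So [g1] vanishes almost everywhere off [C], that is, where [H2 >= c]. *)
have le' : \int[mu]_(x in D `&` V) g1 x `^ p <= \int[mu]_(x in D `&` V) (g1 \_ C) x `^ p.
  apply: (le_trans le); rewrite le_eqVlt; apply/orP; left; apply/eqP.
  apply: ge0_ae_eq_integral => //.
  - by apply/measurable_pow/borel_fun_measurable; exact: borel_fun_patch.
  - by apply/measurable_pow/borel_fun_measurable; exact: borel_fun_patch.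
  - by move=> x _; exact: poweR_ge0.
  - by move=> x _; exact: poweR_ge0.
  - by move: gradients_ae_eq; apply: filterS => x e [Dx _]; rewrite !patchE e.
have LDV1 : Lp (D `&` V) g1 by apply: Lp_subset Lg1.
have ae := ae_le_of_integral mDV (borel_fun_measurable bg1) (borel_fun_measurable (borel_fun_patch bg1 bC)) _ _ LDV1 le'.
have : {ae mu, forall x, (D `&` V) x -> g1 x = (g1 \_ C) x}.
  apply: ae.
  - by move=> x _; rewrite patchE; case: ifPn.
  - by move=> x _; rewrite patchE; case: ifPn.
apply: filterS => x e [Gx l1] /andP[l2 l3].
rewrite e; last by split; split.
by rewrite patchE memNset// => -[_ /=]; rewrite ltNge l3.
Qed.

(** A rational level lies between [H1 x] and [H2 x], and only countably many null sets are
    discarded. *)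
Let gradients_vanish : {ae mu, forall x, D x -> g1 x + g2 x = 0}.
Proof.
pose q n : R := if unpickle n is Some r then ratr r else 0%R.
have := ae_foralln (fun n => gradient_vanish_level (q n)).
move=> H; apply: filterS2 H gradients_ae_eq => x z e Dx; rewrite -e//.
have [_ lt] := Dx.
have [r] := rat_in_itvoo lt; rewrite in_itv/= => /andP[r1 r2].
have qr : q (pickle r) = ratr r by rewrite /q pickleK.
have := z (pickle r) Dx; rewrite qr r1 (ltW r2) => -> //.
by rewrite adde0.
Qed.

(** The positive part [phi] of the difference has gradient 0, so its truncation vanishes almost
    everywhere. But [D] is open, so if nonempty it would contain a ball of positive measure on which
    [phi] is positive. *)
Lemma dirichlet_comparison : mu G < +oo -> 0 < Cp mu p (~` G) -> forall x, G x -> (H2 x <= H1 x)%R.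
Proof.
move=> Gfin CpG; have [mphi Iphi [gphi pgphi Lgphi]] := Nphi.
have [bgphi gphi0 _] := pgphi.
have pD : pwug D phi (g2 \+ g1).
  by apply: (pwug_eq (pwugD mD pg2D (pwugN pg1D))) => x Dx; rewrite phiD.
pose K x := if x \in D then mine (gphi x) ((g2 \+ g1) x) else gphi x.
have pK : pwug setT phi K.
  by apply: pwug_merge => //; [exact: openT|exact: LpD].
have [bK K0 _] := pK.
have LK : Lp setT K.
  apply: Lp_le Lgphi => // x _; rewrite /K; case: ifPn => // _; by rewrite ge_min lexx.
(* The Poincare inequality is for integrable functions; truncating at 1 provides one, as [G] has
   finite measure. *)
pose f x := Num.min (phi x) 1%R.
have phi_ge0 x : (0 <= phi x)%R by rewrite le_max lexx orbT.
have pf : pwug setT f (K \_ D).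
  have HD x : setT x -> (0 < phi x)%R -> D x.
    by move=> _; apply: contraPP => /phi0 ->; rewrite ltxx.
  have := pwug_truncate measurableT pK LK (open_borel_set oD) HD.
  move=> /pwug_map; apply => x y _ _; rewrite /f.
  rewrite !(max_idPl (phi_ge0 _)).
  have := ler_dist_clamp (phi x) (phi y) 0 1.
  by rewrite !(max_idPl (phi_ge0 _)).
have mf : measurable_fun setT f by apply: measurable_minr => //; exact: measurable_cst.
have f0 x : ~ G x -> f x = 0%R.
  by move=> nG; rewrite /f phi0; [apply/min_idPl|move=> /DG].
have If : mu.-integrable setT (EFin \o f).
  apply/integrableP; split; first exact/measurable_EFinP.
  apply: le_lt_trans Gfin; rewrite -[mu G]mul1e -integral_cst// [leRHS]integral_mkcond.
  apply: ge0_le_integral_nomeas => x _; first exact: abse_ge0.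
  rewrite patchE; case: ifPn => [_|]; last by rewrite notin_setE => /f0 /= ->; rewrite normr0.
  by rewrite lee_fin ger0_norm ?le_min ?ler01 ?phi_ge0// /f ge_min lexx orbT.
have I0 : \int[mu]_x (K \_ D) x `^ p = 0.
  have [bKD KD0 _] := pf.
  rewrite (ge0_ae_eq_integral (g := cst 0))//.
  - by rewrite integral0.
  - exact/measurable_pow/borel_fun_measurable.
  - by move=> x _; exact: poweR_ge0.
  move: gradients_vanish; apply: filterS => x z _ /=; rewrite patchE; case: ifPn => [|_]; last first.
    by rewrite poweR0r.
  rewrite inE => Dx; rewrite /K mem_set//= addeC z// (_ : mine _ _ = 0) ?poweR0r//.
  by apply/min_idPr.
have f_ae := zero_gradient_vanish mf If pf I0 f0 CpG.
move=> x Gx; rewrite leNgt; apply/negP => lt.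
have Dx : D x by [].
have /nbhs_ballP[r r0 BD] : nbhs x D by exact: open_nbhs_nbhs.
have /andP[B0 _] := mu_balls x r0.
have [y By fy] := ae_point (measurable_ball x r) B0 f_ae.
have := phi_gt0 (BD _ By) => /= phiy.
have : (0 < f y)%R by rewrite /f lt_min phiy ltr01.
by rewrite fy ltxx.
Qed.

End dirichlet_comparison.

Lemma compact_subset_ball (x0 : X) (A : set X) : compact A -> exists r : R, (0 < r)%R /\ A `<=` ball x0 r.
Proof.
rewrite compact_cover => /(_ nat setT (fun n => ball x0 n.+1%:R)).
case.
- by move=> n _; exact: ball_open_metric.
- move=> x Ax; exists (Num.truncn (mdist x0 x)) => //.
  by rewrite ballEmdist /= truncnS_gt.
move=> D _ AD; exists (\max_(n <- finmap.enum_fset D) n).+1%:R; split=> //.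
move=> x /AD[n /= nD]; apply: ball_subset_ball.
by rewrite mdistxx add0r ler_nat ltnS; exact: leq_bigmax_seq.
Qed.

Lemma Lp_cst A (c : R) : measurable A -> mu A < +oo -> (0 <= c)%R -> Lp A (cst c%:E).
Proof.
move=> mA Afin c0; rewrite /Lp (eq_integral (cst (c `^ p)%:E))// integral_cst//.
by apply: lte_mul_pinfty => //; rewrite lee_fin powR_ge0.
Qed.

(** Both solutions differ from [w] by Newtonian functions that vanish off [G], so their difference
    extends by 0. The Lipschitz constant of [w], in L^p on a set of finite measure, supplies the
    gradients of the solutions themselves. *)
Lemma dirichlet_le G (w : X -> R) (h1 h2 : X -> \bar R) : open G -> compact (closure G) ->
  0 < Cp mu p (~` G) -> lipschitz_in (closure G) w ->
  pharmonic mu p G h1 -> N1p0 mu p G (zero_ext G (h1 \- (EFin \o w))) ->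
  pharmonic mu p G h2 -> N1p0 mu p G (zero_ext G (h2 \- (EFin \o w))) ->
  forall x, G x -> h2 x <= h1 x.
Proof.
move=> oG cG CpG [L Lw] harm1 [N1 _] harm2 [N2 _].
have mG := open_measurable oG.
have [x0 _] := two_points.
have [r [r0 Gr]] := compact_subset_ball x0 cG.
have Gfin : mu G < +oo.
  have /andP[_] := mu_balls x0 r0; apply: le_lt_trans; apply: le_measure; rewrite ?inE//.
    exact: measurable_ball.
  by move=> x Gx; apply: Gr; exact: subset_closure.
have fin1 x : G x -> h1 x = (fine (h1 x))%:E by move=> Gx; rewrite fineK//; case: harm1 => + _ _; exact.
have fin2 x : G x -> h2 x = (fine (h2 x))%:E by move=> Gx; rewrite fineK//; case: harm2 => + _ _; exact.
pose ps (h : X -> \bar R) x : R := if x \in G then (fine (h x) - w x)%R else 0%R.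
have psE (h : X -> \bar R) : (forall x, G x -> h x = (fine (h x))%:E) ->
    zero_ext G (h \- (EFin \o w)) = EFin \o ps h.
  move=> hf; apply/funext => x; rewrite /zero_ext /ps /=.
  by case: ifPn => // /[1!inE] Gx; rewrite hf.
have Nps (h : X -> \bar R) : (forall x, G x -> h x = (fine (h x))%:E) ->
    N1p mu p setT (zero_ext G (h \- (EFin \o w))) -> newton setT (ps h).
  move=> hf; rewrite psE// => Nh; apply: (N1p_newton openT Nh) => //.
  by have [/measurable_EFinP] := Nh.
have L0 : (0 <= Num.max L 0)%R by rewrite le_max lexx orbT.
have pw : pwug G w (cst (Num.max L 0)%:E).
  apply: pwug_lipschitz => // x y Gx Gy.
  apply: (le_trans (Lw _ _ (subset_closure Gx) (subset_closure Gy))).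
  by rewrite ler_wpM2r ?mdist_ge0// le_max lexx.
have ug (h : X -> \bar R) : newton setT (ps h) -> exists2 k, pwug G (fine \o h) k & Lp G k.
  move=> [_ _ [k pk Lk]]; have [bk k0 _] := pk.
  exists (k \+ cst (Num.max L 0)%:E); last first.
    apply: LpD => //; [exact: measurable_cst| |exact: Lp_cst].
    exact: Lp_subset Lk.
  have pkG := pwug_subset measurableT mG (@subsetT _ _) pk.
  by apply: (pwug_eq (pwugD mG pkG pw)) => x Gx; rewrite /= /ps mem_set// subrK.
have N1' := Nps _ fin1 N1; have N2' := Nps _ fin2 N2.
have [k1 pk1 Lk1] := ug _ N1'; have [k2 pk2 Lk2] := ug _ N2'.
have [g1 mg1] := exists_minimal_pwug oG pk1 Lk1.
have [g2 mg2] := exists_minimal_pwug oG pk2 Lk2.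
have Npsi := newtonD measurableT N2' (newtonZ (-1) measurableT N1').
move=> x Gx; rewrite fin1// fin2// lee_fin.
apply: (dirichlet_comparison oG harm1 harm2 fin1 fin2 pk1 Lk1 pk2 Lk2 _ _ Npsi mg1 mg2 Gfin CpG Gx).
- by move=> y Gy; rewrite /ps /= mem_set//; lra.
- by move=> y nGy; rewrite /ps /= memNset// mulr0 addr0.
Qed.

(* Hext selects an arbitrary solution, so uniqueness is what makes it homogeneous. *)
Lemma HextZ G (w : X -> R) (c : R) : open G -> compact (closure G) ->
  0 < Cp mu p (~` G) -> lipschitz_in (closure G) w -> (0 < c)%R ->
  forall x, G x -> Hext mu p G (EFin \o w) x = c%:E * Hext mu p G (EFin \o (fun x => c^-1 * w x)%R) x.
Proof.
move=> oG cG CpG Lw c0.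
pose S (f : X -> R) h := pharmonic mu p G h /\ N1p0 mu p G (zero_ext G (h \- (EFin \o f))).
have SZ f h (k : R) : (0 < k)%R -> S f h -> S (fun x => k * f x)%R (fun x => k%:E * h x).
  move=> k0 [harm N0]; split; first exact: pharmonicZ.
  have := N1p0Z k0 N0; congr N1p0; apply/funext => x; rewrite /zero_ext.
  case: ifPn => [_|]; last by rewrite mule0.
  by rewrite muleBr// fin_num_adde_defl.
have c'0 : (0 < c^-1)%R by rewrite invr_gt0.
have wE : (fun x => c * (c^-1 * w x))%R = w.
  by apply/funext => x; rewrite mulrA mulfV ?gt_eqF// mul1r.
(* If the problem for [w] has no solution, neither has the scaled one, and both sides are the
   default 0. *)
have [[h Sh]|nS] := pselect (exists h, S w h); last first.
  move=> x Gx; rewrite /Hext xgetPN; last by move=> h Sh; apply: nS; exists h.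
  rewrite xgetPN ?mule0// => h Sh; apply: nS; exists (fun x => c%:E * h x).
  by have := SZ _ _ _ c0 Sh; rewrite wE.
have S1 : S w (Hext mu p G (EFin \o w)) by apply: (xgetPex (cst 0)); exists h.
have S2 : S (fun x => c^-1 * w x)%R (Hext mu p G (EFin \o (fun x => c^-1 * w x)%R)).
  by apply: (xgetPex (cst 0)); exists (fun x => (c^-1)%:E * h x); exact: SZ.
have S3 := SZ _ _ _ c0 S2; rewrite wE in S3.
move: S1 S3 => [h1 n1] [h3 n3] x Gx; apply/eqP; rewrite eq_le; apply/andP; split.
- exact: (dirichlet_le oG cG CpG Lw h3 n3 h1 n1 Gx).
- exact: (dirichlet_le oG cG CpG Lw h1 n1 h3 n3 Gx).
Qed.

Lemma superharmonicZ V (u : X -> \bar R) (c : R) : (0 < c)%R ->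
  superharmonic mu p V u -> superharmonic mu p V (fun x => c%:E * u x).
Proof.
move=> c0 [uNy lscu ufin ucomp]; split.
- move=> x Vx; have := uNy x Vx; case: (u x) => [r||]//; last by rewrite gt0_muley.
  by move=> _; rewrite -EFinM; exact: ltNyr.
- move=> x a; have c'0 : (0 < c^-1)%R by rewrite invr_gt0.
  rewrite muleC -lte_pdivrMr// muleC -EFinM => /lscu[W xW HW]; exists W => // y /HW.
  by rewrite EFinM muleC lte_pdivrMr// muleC.
- move=> x /ufin[y xy uy]; exists y => //; move: uy; case: (u y) => [r||]//=.
  by rewrite gt0_muleNy.
- move=> G w Gn0 oG cG GV CpG Lw wu x Gx; rewrite (HextZ oG cG CpG Lw c0 Gx).
  apply: lee_wpmul2l; first by rewrite lee_fin ltW.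
  apply: ucomp => //.
  + have [L HL] := Lw; exists (c^-1 * L)%R => y z Gy Gz.
    rewrite -mulrBr normrM gtr0_norm ?invr_gt0// -mulrA ler_pM2l ?invr_gt0//.
    exact: HL.
  + by move=> y /wu wy; rewrite EFinM muleC lee_pdivrMr// muleC.
Qed.

Lemma ereal_supZ (S : set X) (u : X -> \bar R) (c : R) : (0 < c)%R ->
  ereal_sup ((fun x => c%:E * u x) @` S) = c%:E * ereal_sup (u @` S).
Proof.
move=> c0; apply/eqP; rewrite eq_le; apply/andP; split.
  apply: ub_ereal_sup => _ [x Sx <-]; apply: lee_wpmul2l; first by rewrite lee_fin ltW.
  by apply: ereal_sup_ubound; exists x.
rewrite muleC -lee_pdivlMr//; apply: ub_ereal_sup => _ [x Sx <-].
by rewrite lee_pdivlMr// muleC; apply: ereal_sup_ubound; exists x.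
Qed.

Lemma ereal_infZ (S : set X) (u : X -> \bar R) (c : R) : (0 < c)%R ->
  ereal_inf ((fun x => c%:E * u x) @` S) = c%:E * ereal_inf (u @` S).
Proof.
move=> c0; apply/eqP; rewrite eq_le; apply/andP; split; last first.
  apply: le_ereal_inf_tmp => _ [x Sx <-]; apply: lee_wpmul2l; first by rewrite lee_fin ltW.
  by apply: ereal_inf_lbound; exists x.
rewrite muleC -lee_pdivrMr//; apply: le_ereal_inf_tmp => _ [x Sx <-].
by rewrite lee_pdivrMr// muleC; apply: ereal_inf_lbound; exists x.
Qed.

Lemma open_punctured (Om : set X) (x0 : X) : open Om -> open (Om `\ x0).
Proof.
move=> oO; rewrite setDE; apply: openI => //; apply: closed_openC.
by apply: accessible_closed_set1; apply: hausdorff_accessible; exact: metric_hausdorff.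
Qed.

Lemma singular_functionZ (Om : set X) (x0 : X) (v : X -> \bar R) (c : R) : open Om -> (0 < c)%R ->
  singular_function mu p Om x0 v -> singular_function mu p Om x0 (fun x => c%:E * v x).
Proof.
move=> oO c0 [v0 [sup harm S3 S4 S5]]; split.
  by move=> x /v0 vx; rewrite mule_gt0.
split.
- exact: superharmonicZ.
- by apply: pharmonicZ => //; exact: open_punctured.
- by rewrite S3 ereal_supZ.
- by rewrite ereal_infZ// S4 mule0.
- have := N1p_locZ c0 S5; congr N1p_loc; apply/funext => x; rewrite /zero_ext.
  by case: ifPn => // _; rewrite mule0.
Qed.

(** Near each parameter an arc runs in one of the two open sets, where one of the gradients applies,
    and the sum dominates both. *)
Lemma pwug_union U V f g g' : open U -> open V -> pwug U f g -> pwug V f g' ->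
  pwug (U `|` V) f ((g \_ U) \+ (g' \_ V)).
Proof.
move=> oU oV [bg g0 Hg] [bg' g'0 Hg'].
have bU := borel_fun_patch bg (open_borel_set oU).
have bV := borel_fun_patch bg' (open_borel_set oV).
have U0 x : 0 <= (g \_ U) x by exact: erestrict_ge0.
have V0 x : 0 <= (g' \_ V) x by exact: erestrict_ge0.
have bS : borel_fun ((g \_ U) \+ (g' \_ V)) by exact: emeasurable_funD.
have S0 x : 0 <= ((g \_ U) \+ (g' \_ V)) x by exact: adde_ge0.
have mUV : measurable (U `|` V) by apply: open_measurable; exact: openU.
split=> //.
apply: aearc_mono (aearcI mUV (aearc_subarc (aearc_open mUV oU Hg))
  (aearc_subarc (aearc_open mUV oV Hg'))) _ => c s t cc ac [DU DV].
have [st Ac _] := ac.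
apply: (local_to_global (F := f \o c) (ltW st) (borel_fun_comp cc bS) (fun r => S0 (c r))) => r hr.
have part W k : (forall x, W x -> k x <= ((g \_ U) \+ (g' \_ V)) x) -> (forall x, 0 <= k x) ->
    open W -> W (c r) ->
    (forall s' t', (s <= s')%R -> (s' < t')%R -> (t' <= t)%R ->
      (forall r, (s' <= r <= t')%R -> W (c r)) ->
      `|f (c s') - f (c t')|%:E <= \int[lam]_(r in `[s', t']) k (c r)) ->
    exists2 e : R, (0 < e)%R & forall r1 r2, (s <= r1)%R -> (r1 < r2)%R -> (r2 <= t)%R ->
      (`|r1 - r| < e)%R -> (`|r2 - r| < e)%R ->
      `|(f \o c) r1 - (f \o c) r2|%:E <= \int[lam]_(x in `[r1, r2]) ((g \_ U) \+ (g' \_ V)) (c x).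
  move=> kS k0 oW Wr D; apply: (arc_local ac hr oW Wr) => r1 r2 sr1 r12 r2t Wr'.
  apply: le_trans (D _ _ sr1 r12 r2t Wr') _; apply: ge0_le_integral_nomeas => r' //.
  by rewrite /= in_itv/= => /Wr' /kS.
case: (Ac r _) => [|Ur|Vr]; first by move: hr; rewrite ?in_itv.
- by apply: (part U g) => // x Ux; rewrite /= [(g \_ U) x]patchE mem_set// leeDl.
- by apply: (part V g') => // x Vx; rewrite /= [(g' \_ V) x]patchE mem_set// leeDr.
Qed.

Lemma exceptionalU A (Gam Gam' : set ((R -> X) * R)) : measurable A ->
  exceptional mu p A Gam -> exceptional mu p A Gam' -> exceptional mu p A (Gam `|` Gam').
Proof.
move=> mA [r1 [m1 r10 I1 H1]] [r2 [m2 r20 I2 H2]]; exists (r1 \+ r2); split.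
- exact: emeasurable_funD.
- by move=> x Ax; rewrite adde_ge0 ?r10 ?r20.
- apply: (integral_powD_lty mA m1 m2 r10 r20) => // x Ax.
  by rewrite lexx adde_ge0 ?r10 ?r20.
move=> gam l cg; have [_ gA _] := cg.
have inA t : `[0%R, l]%classic t -> A (gam t) by move=> tl; apply: gA; exists t.
have sub rho : (forall x, A x -> 0 <= rho x) -> (forall x, A x -> rho x <= r1 x + r2 x) ->
    curve_integral rho gam l = +oo -> curve_integral (r1 \+ r2) gam l = +oo.
  move=> rho0 le Ey; apply/eqP; rewrite -leye_eq -Ey; apply: ge0_le_integral_nomeas => t /inA At.
    exact: rho0.
  exact: le.
move=> [/(H1 _ _ cg)|/(H2 _ _ cg)]; apply: sub => // x Ax.
- by rewrite leeDl// r20.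
- by rewrite leeDr// r10.
Qed.

(* Almost every curve has finite endpoint values, so infinite values of u are
   invisible to weak upper gradients in L^p. *)
Lemma N1p_minimal A (u : X -> \bar R) : open A -> N1p mu p A u ->
  exists2 g, is_minimal_wug mu p A u g & Lp A g.
Proof.
move=> oA Nu; have mA := open_measurable oA.
have con x y : A x -> A y -> `|fine (u x) - fine (u y)|%:E <= `|u x - u y|.
  by move=> _ _; case: (u x) => [r||]; case: (u y) => [r'||] //=; exact: leey.
have [k pk Lk] := N1p_pwug oA Nu con.
have [g mg] := exists_minimal_pwug oA pk Lk.
have [pg Lg _] := mg; exists g => //.
have [wg Llg ming] := minimal_pwug_is_minimal_wug oA (fun _ _ => erefl) mg.
split => //; last first.
  move=> g' wg' Lg'; apply: ming => //; exact: wug_contraction wg' _.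
have [_ /N1p_normp_lt[g0 wg0 lt]] := Nu; have [mg0 g00 [Gam0 ex0 H0]] := wg0.
have [mgm gm0 [Gam ex H]] := wg; split => //.
exists ((Gam `|` Gam0) `|` [set c | curve_integral g0 c.1 c.2 = +oo]).
  apply: exceptionalU => //; first exact: exceptionalU.
  exists g0; split => //.
  by apply: le_lt_trans lt; rewrite leeDr// integral_pow_ge0.
move=> gam l cg nG; have nGam : ~ Gam (gam, l) by move=> h; apply: nG; left; left.
have nGam0 : ~ Gam0 (gam, l) by move=> h; apply: nG; left; right.
apply: le_trans (H _ _ cg nGam).
have : `|u (gam 0%R) - u (gam l)| < +oo.
  apply: le_lt_trans (H0 _ _ cg nGam0) _; rewrite ltey; apply/eqP => h; apply: nG; by right.
by case: (u _) (u _) => [r||] [r'||].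
Qed.

(** Locality of gradients: [f] is [f'] plus the positive part of [f - f'] minus that of [f' - f]. By
    truncation these parts have gradients carried by Borel covers of [{f > f'}] and [{f < f'}],
    which almost miss the set where the functions agree. *)
Lemma pwug_coincide A f f' g g' : open A -> measurable_fun A f -> measurable_fun A f' ->
  pwug A f g -> Lp A g -> pwug A f' g' -> Lp A g' ->
  exists k, [/\ pwug A f k, Lp A k & {ae mu, forall x, A x -> f x = f' x -> k x <= g' x}].
Proof.
move=> oA mf mf' pg Lg pg' Lg'; have mA := open_measurable oA.
have [bg g0 _] := pg; have [bg' g'0 _] := pg'.
have bgg : borel_fun (g \+ g') by exact: emeasurable_funD.
have gg0 x : 0 <= (g \+ g') x by exact: adde_ge0.
have LD : Lp A (g \+ g') by exact: LpD.
have pos (h h' : X -> R) : measurable_fun A h -> measurable_fun A h' -> pwug A (h \- h')%R (g \+ g') ->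
    exists2 S, borel_set S & pwug A (fun x => Num.max (h x - h' x) 0)%R ((g \+ g') \_ S) /\
      {ae mu, forall x, A x -> h x = h' x -> ~ S x}.
  move=> mh mh' ph.
  pose P := A `&` [set x | 0 < h x - h' x]%R.
  have mP : measurable P.
    have := measurable_funB mh mh' => /(_ mA `]0%R, +oo[%classic (measurable_itv _)).
    by rewrite /P; congr measurable; apply/seteqP; split => x [Ax hx]; split => //; move: hx; rewrite /= in_itv/= andbT.
  have [S [bS PS S0]] := borel_cover mP; exists S => //; split.
    by apply: (pwug_truncate mA ph LD bS) => x Ax hx; apply: PS.
  exists (S `\` P); split => //.
    by apply: measurableD => //; exact: borel_set_measurable.
  move=> x /= nx; apply: contrapT => nSP; apply: nx => Ax e Sx; apply: nSP; split => //.
  by move=> [_ /=]; rewrite e subrr ltxx.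
have pd : pwug A (f \- f')%R (g \+ g') by exact: pwugD mA pg (pwugN pg').
have pd' : pwug A (f' \- f)%R (g \+ g').
  by apply: (pwug_eq (pwugN pd)) => x _ /=; rewrite opprB.
have [S bS [pS aeS]] := pos _ _ mf mf' pd.
have [S' bS' [pS' aeS']] := pos _ _ mf' mf pd'.
exists ((g' \+ ((g \+ g') \_ S)) \+ ((g \+ g') \_ S')); split.
- have := pwugD mA (pwugD mA pg' pS) (pwugN pS'); move=> /pwug_eq; apply => x _ /=.
  have [l|l] := leP (f x) (f' x).
    by rewrite (max_idPr _) ?subr_le0// (max_idPl _) ?subr_ge0//; lra.
  by rewrite (max_idPl _) ?subr_ge0 ?(ltW l)// (max_idPr _) ?subr_le0 ?(ltW l)//; lra.
- have LS T : borel_set T -> Lp A ((g \+ g') \_ T).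
    move=> bT; apply: Lp_le LD => //; first exact: borel_fun_patch.
    + by move=> x; exact: erestrict_ge0.
    + by move=> x _; rewrite patchE; case: ifPn.
  have p0 T x : 0 <= ((g \+ g') \_ T) x by exact: erestrict_ge0.
  have pb T : borel_set T -> borel_fun ((g \+ g') \_ T) by exact: borel_fun_patch.
  apply: LpD => //; try exact: pb; try exact: LS.
  + by apply: emeasurable_funD => //; exact: pb.
  + by move=> x; rewrite /= adde_ge0.
  + by apply: LpD => //; [exact: pb|exact: LS].
- apply: filterS2 aeS aeS' => x h h' Ax e.
  rewrite /= !patchE !memNset ?adde0//; first exact: h'.
  exact: h.
Qed.

Lemma max_min_clamp (a b y : R) : (a <= b)%R ->
  Num.max (Num.min y b) a = Num.min (Num.max y a) b.
Proof.
move=> ab; have [yb|yb] := leP y b.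
  by have [ya|ya] := leP y a; [rewrite (min_idPl ab)|rewrite (min_idPl yb)].
rewrite (max_idPl ab) (max_idPl _) ?(min_idPr _)// ltW//.
exact: le_lt_trans yb.
Qed.

Lemma sub_clamp (a b z : R) : (a <= b)%R ->
  (z - Num.min (Num.max z a) b = Num.min z a + Num.max z b - (a + b))%R.
Proof.
move=> ab; have [za|za] := leP z a.
  by rewrite (min_idPl ab) (max_idPr (le_trans za ab)); lra.
by have [zb|zb] := leP z b; lra.
Qed.

(** The levels stay strictly below [M]: for [b < v x0] lower semicontinuity makes [{v > b}] a
    neighbourhood of the pole, whereas for [b = v x0] this set is empty. *)
Lemma exhausting_levels (M : \bar R) : 0 < M -> exists b : nat -> R, [/\ forall n, (0 < b n)%R,
  forall n, (b n)%:E < M, {homo b : m n / (m <= n)%N >-> (m <= n)%R} &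
  forall r : R, r%:E < M -> exists n, (r < b n)%R].
Proof.
case: M => [m||//]; last first.
  move=> _; exists (fun n => n.+1%:R); split => //.
  - by move=> n; exact: ltry.
  - by move=> i j ij; rewrite ler_nat ltnS.
  - by move=> r _; exists (Num.truncn r); exact: truncnS_gt.
rewrite lte_fin => m0; exists (fun n => m - m / n.+2%:R)%R.
have mn n : (0 < m / n.+2%:R)%R by rewrite divr_gt0.
split.
- by move=> n; rewrite subr_gt0 ltr_pdivrMr// ltr_pMr// ltr1n.
- by move=> n; rewrite lte_fin ltrBlDr ltrDl.
- by move=> i j ij; rewrite lerB// ler_pM2l// lef_pV2 ?posrE// ler_nat ltnS.
move=> r; rewrite lte_fin => rm; exists (Num.truncn (m / (m - r))).
rewrite ltrBrDr -ltrBrDl ltr_pdivrMr// mulrC -ltr_pdivrMr ?subr_gt0//.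
by apply: lt_trans (truncnS_gt _) _; rewrite ltr_nat.
Qed.

Lemma powRV (x q : R) : (0 < x)%R -> (x^-1 `^ q = (x `^ q)^-1)%R.
Proof.
move=> x0; have xq : (x `^ q != 0)%R by rewrite gt_eqF// powR_gt0.
apply: (mulIf xq); rewrite -powRM ?invr_ge0 ?ltW// mulVf ?gt_eqF// powR1.
by rewrite mulVf.
Qed.

(** * Singular functions *)

Section singular_potential.
Variables (Om : set X) (x0 : X) (v : X -> \bar R).
Hypotheses (oO : open Om) (bO : metric_bounded Om) (CpO : 0 < Cp mu p (~` Om)).
Hypotheses (Ox0 : Om x0) (v_sing : singular_function mu p Om x0 v).

Local Notation V := (Om `\ x0).
Local Notation vh := (zero_ext Om v).

Let oV : open V. Proof. exact: open_punctured. Qed.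
Let mO : measurable Om := open_measurable oO.
Let mV : measurable V := open_measurable oV.
Let VO : V `<=` Om. Proof. by move=> x []. Qed.

Let v_gt0 x : Om x -> 0 < v x. Proof. by case: v_sing => + _; exact. Qed.

Let v_le x : Om x -> v x <= v x0.
Proof. by case: v_sing => _ [_ _ -> _ _] Ox; apply: ereal_sup_ubound; exists x. Qed.

Let vV x : V x -> v x = (fine (v x))%:E.
Proof. by case: v_sing => _ [_ [+ _ _] _ _ _] => + Vx => /(_ x Vx) /fineK ->. Qed.

Let M_gt0 : 0 < v x0. Proof. exact: v_gt0. Qed.

Let vhE x : Om x -> vh x = v x. Proof. by move=> Ox; rewrite /zero_ext mem_set. Qed.
Let vh0 x : ~ Om x -> vh x = 0. Proof. by move=> nO; rewrite /zero_ext memNset. Qed.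
Let vh_ge0 x : 0 <= vh x.
Proof. by have [Ox|/vh0 ->] := pselect (Om x); rewrite ?vhE// ltW// v_gt0. Qed.

Let open_gt (a : R) : open (Om `&` [set x | a%:E < v x]).
Proof.
have [_ [[_ lsc _ _] _ _ _ _]] := v_sing.
rewrite openE => x [Ox ax]; have [W xW HW] := lsc x a ax.
have {}xW : within Om (nbhs x) W by rewrite nbhs_subspace_in.
rewrite /interior.
have nO : nbhs x Om by exact: open_nbhs_nbhs.
by apply: filterS2 nO xW => y Oy /(_ Oy) /HW.
Qed.

Let open_lt (b : R) : open (V `&` [set x | v x < b%:E]).
Proof.
have [_ [_ [_ cv _] _ _ _]] := v_sing.
have cc : {in V, continuous (cst b : X -> R)} by move=> x _; exact: cvg_cst.
have := open_ltr_in oV (fine_continuous_within oV cv vV) cc; congr open.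
by apply/seteqP; split => x [Vx hx]; split => //; move: hx; rewrite /= (vV Vx) lte_fin.
Qed.

Let measurable_vh : measurable_fun setT vh.
Proof.
rewrite -(setUv Om); apply/measurable_funU => //; first exact: measurableC.
split.
  have mv : measurable_fun Om v by apply: measurable_open_levels.
  by apply: eq_measurable_fun mv => x; rewrite inE => /vhE.
apply: (eq_measurable_fun (cst 0 : X -> \bar R)); last exact: measurable_cst.
by move=> x; rewrite inE => /vh0.
Qed.

Definition singular_layer (a b : R) := V `&` [set x | a%:E < v x < b%:E].
Local Notation layer := singular_layer.

Let layerE a b : layer a b = (Om `&` [set x | a%:E < v x]) `&` (V `&` [set x | v x < b%:E]).
Proof. by apply/seteqP; split => x; [move=> [[? ?] /andP[? ?]]|move=> [[? ?] [? ?]]; split => //; apply/andP]. Qed.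

Let open_layer a b : open (layer a b).
Proof. by rewrite layerE; exact: openI. Qed.

Let mu_Om : mu Om < +oo.
Proof.
have [y [r Or]] := bO.
have r0 : (0 < Num.max r 1)%R by rewrite lt_max ltr01 orbT.
have /andP[_] := mu_balls y r0; apply: le_lt_trans; apply: le_measure; rewrite ?inE//.
  exact: measurable_ball.
apply: subset_trans Or _; apply: ball_subset_ball.
by rewrite mdistxx add0r le_max lexx.
Qed.

Let compact_closure : compact (closure Om).
Proof.
have [y [r Or]] := bO.
by apply: (closed_bounded_compact (@closed_closure _ _)); exact: closure_subset_ball Or.
Qed.

Local Notation cut b := (fun x => clampe 0 b (vh x)).

(** Near the pole the truncation is constant by lower semicontinuity; near any other point, also on
    the boundary of [Om], (S5) gives a gradient. Finitely many such neighbourhoods cover the compact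
    closure of [Om], and outside it the truncation is 0. *)
Let cut_pwug (b : R) : (0 < b)%R -> b%:E < v x0 -> exists2 g, pwug setT (cut b) g & Lp setT g.
Proof.
move=> b0 bM.
have /choice[W HW] (x : X) : exists W : set X, [/\ open W, W x & exists2 g, pwug W (cut b) g & Lp W g].
  have [->|xx0] := eqVneq x x0.
    exists (Om `&` [set x | b%:E < v x]); split => //.
    exists (cst 0); last by rewrite /Lp integral0_eq// => y _; rewrite poweR0r.
    apply: (pwug_eq (pwug_cst _ b)) => y [Oy by_]; rewrite vhE//.
    move: by_ => /=; case: (v y) => [r||]//; rewrite ?clampey//.
    rewrite lte_fin clampe_fin => br; have r0 : (0 <= r)%R by rewrite ltW// (lt_trans b0).
    by rewrite (max_idPl r0) (min_idPr _)// ltW.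
  have [_ [_ _ _ _ N]] := v_sing.
  have [r [r0 Br NB]] := N x (fun e => negP xx0 (introT eqP e)).
  exists (ball x r); split; [exact: ball_open_metric|exact: ballxx|].
  apply: (N1p_pwug (ball_open_metric x r) NB) => y z _ _; exact: clampe_contraction.
have cov : closure Om `<=` \bigcup_(x in [set: X]) W x.
  by move=> x _; exists x => //; case: (HW x).
have := compact_closure; rewrite compact_cover => /(_ X setT W).
case; [by move=> x _; case: (HW x)|exact: cov|move=> D _ OD].
pose U := foldr (fun x A => W x `|` A) set0.
have US x s : x \in s -> W x `<=` U s.
  elim: s => // y s IH; rewrite inE => /predU1P[->|/IH xs] z Wz; [by left|right; exact: xs].
have [oU [g pg Lg]] : open (U (finmap.enum_fset D)) /\
    exists2 g, pwug (U (finmap.enum_fset D)) (cut b) g & Lp (U (finmap.enum_fset D)) g.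
  elim: (finmap.enum_fset D) => [|x s [oU [g pg Lg]]].
    split; first exact: open0.
    exists (cst 0); last by rewrite /Lp integral_set0.
    by apply: (pwug_eq (pwug_cst set0 0%R)).
  have [oW _ [gx pgx Lgx]] := HW x; split; first exact: openU.
  have [bg g0 _] := pg; have [bgx gx0 _] := pgx.
  exists ((gx \_ (W x)) \+ (g \_ (U s))); first exact: pwug_union.
  have mU : measurable (U (x :: s)) by apply: open_measurable; exact: openU.
  have sub B h : borel_fun h -> (forall x, 0 <= h x) -> open B -> Lp B h -> Lp (U (x :: s)) (h \_ B).
    move=> bh h0 oB LB; apply: Lp_subset (Lp_patch LB) => //.
    by apply: borel_fun_patch => //; exact: open_borel_set.
  apply: LpD => //; try exact: sub.
  - by apply: borel_fun_patch => //; exact: open_borel_set.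
  - by apply: borel_fun_patch => //; exact: open_borel_set.
  - by move=> y; exact: erestrict_ge0.
  - by move=> y; exact: erestrict_ge0.
set UD := U _ in oU pg Lg.
have oC : open (~` closure Om) by apply: closed_openC; exact: closed_closure.
have pC : pwug (~` closure Om) (cut b) (cst 0).
  apply: (pwug_eq (pwug_cst _ 0%R)) => x nO; rewrite vh0.
    by rewrite clampe_fin maxxx (min_idPl _)// ltW.
  by move=> /subset_closure.
have := pwug_union oU oC pg pC.
have -> : UD `|` ~` closure Om = setT.
  apply/seteqP; split => // x _; have [/OD[y /= yD Wy]|] := pselect (closure Om x); last by right.
  by left; exact: US yD _ Wy.
move=> H; exists ((g \_ UD) \+ (cst 0 \_ (~` closure Om))) => //.
apply: le_lt_trans (Lp_patch Lg); apply: ge0_le_integral_nomeas => x _; first exact: poweR_ge0.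
by rewrite /= [(cst 0 \_ _) x]patchE if_same adde0.
Qed.

Let layerP a b x : layer a b x -> [/\ Om x, vh x = (fine (v x))%:E, (a < fine (v x))%R & (fine (v x) < b)%R].
Proof.
move=> [Vx /=]; rewrite vhE; last by case: Vx.
by rewrite (vV Vx) !lte_fin /= => /andP[? ?]; split => //; case: Vx.
Qed.

Let not_layer0 (b : R) x : (0 < b)%R -> b%:E < v x0 -> Om x -> ~ layer 0 b x -> b%:E <= v x.
Proof.
move=> b0 bM Ox nl; rewrite leNgt; apply/negP => lt; apply: nl; split.
  by split => // e; move: lt; rewrite e ltNge (ltW bM).
by rewrite /= v_gt0.
Qed.

Let cut_layer b x : layer 0 b x -> cut b x = fine (v x).
Proof.
move=> /layerP[_ /= -> l1 l2]; rewrite clampe_fin (max_idPl _) ?(ltW l1)//.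
by apply/min_idPl; exact: ltW.
Qed.

Let cut_ge0 (b : R) x : (0 <= b)%R -> (0 <= cut b x <= b)%R.
Proof. by move=> b0; exact: clampe_bounds. Qed.

Let cut_notO (b : R) x : (0 <= b)%R -> ~ Om x -> cut b x = 0%R.
Proof. by move=> b0 nO; rewrite /= vh0// clampe_fin maxxx; apply/min_idPl. Qed.

Let cut_top (b : R) x : (0 <= b)%R -> Om x -> b%:E <= v x -> cut b x = b.
Proof.
move=> b0 Ox; rewrite /= vhE//; case: (v x) => [r||]//; rewrite ?clampey//.
rewrite lee_fin clampe_fin => br; rewrite (max_idPl _); last exact: le_trans br.
exact/min_idPr.
Qed.

(** Truncation at 0 removes the gradient off [Om], and truncation at [b] removes it where [v >= b].
    It then vanishes off the layer everywhere and not just almost everywhere, which later permits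
    cutting it off pointwise. *)
Let cut_minimal (b : R) : (0 < b)%R -> b%:E < v x0 -> exists g,
  minimal_pwug setT (cut b) g /\ forall x, ~ layer 0 b x -> g x = 0.
Proof.
move=> b0 bM; have [k pk Lk] := cut_pwug b0 bM.
have [g mg] := exists_minimal_pwug openT pk Lk; have [pg Lg ming] := mg.
have [bg g0 _] := pg.
have bL : borel_set (layer 0 b) by apply: open_borel_set; exact: open_layer.
have bO' : borel_set Om := open_borel_set oO.
pose C := ~` (Om `\` layer 0 b).
have bC : borel_set C.
  have -> : C = ~` Om `|` layer 0 b by rewrite /C setCD.
  apply: (@measurableU _ borelType); last exact: bL.
  by apply: (@measurableC _ borelType).
have H1 x : setT x -> (0 < cut b x)%R -> Om x.
  by move=> _; apply: contraPP => nO; rewrite (cut_notO (ltW b0) nO) ltxx.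
have p1 := pwug_truncate measurableT pg Lg bO' H1.
have p1' : pwug setT (cut b) (g \_ Om).
  by apply: (pwug_eq p1) => x _; apply/max_idPl; case/andP: (cut_ge0 x (ltW b0)).
have [bg1 g10 _] := p1'.
have L1 : Lp setT (g \_ Om).
  by apply: Lp_le Lg => // x _; rewrite patchE; case: ifPn.
have H2 x : setT x -> (- b < - cut b x)%R -> C x.
  move=> _; rewrite ltrN2 => lt [Ox nl]; move: lt.
  by rewrite cut_top ?ltxx ?(ltW b0)//; exact: not_layer0.
have p2 := pwug_truncate measurableT (pwugN p1') L1 bC H2.
have p2' : pwug setT (cut b) ((g \_ Om) \_ C).
  apply: (pwug_eq (pwugN p2)) => x _; rewrite (max_idPl _) ?opprK// lerN2.
  by case/andP: (cut_ge0 x (ltW b0)).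
have [bg2 g20 _] := p2'.
have le2 x : ((g \_ Om) \_ C) x <= g x.
  by rewrite !patchE; case: ifPn => // _; case: ifPn.
exists ((g \_ Om) \_ C); split.
  split => //; first exact: Lp_le Lg.
  move=> g' pg' Lg'; move: (ming _ pg' Lg'); apply: filterS => x h Ax.
  by apply: le_trans (le2 x) _; exact: h.
move=> x nl; rewrite patchE; case: ifPn => // /[1!inE] Cx.
rewrite patchE; case: ifPn => // /[1!inE] Ox; exfalso; exact: Cx.
Qed.

(* G is the supremum of minimal gradients of the truncations of v at levels
   increasing to v x0, which agree almost everywhere on the layers. *)
Lemma exists_singular_gradient : exists G : X -> \bar R,
  [/\ borel_fun G, forall x, 0 <= G x, is_minimal_wug mu p V v G,
    forall B g', open B -> B `<=` V -> pwug B (fine \o v) g' -> Lp B g' ->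
      {ae mu, forall x, B x -> G x <= g' x} &
    [/\ forall a b : R, (0 <= a < b)%R -> b%:E <= v x0 ->
          pwug setT (fun x => clampe a b (vh x)) (G \_ (layer a b)),
        forall a b : R, (0 <= a < b)%R -> b%:E <= v x0 ->
          pwug V (fun x => fine (v x) - clampe a b (v x))%R
            ((G \_ (V `&` [set x | v x < a%:E])) \+ (G \_ (V `&` [set x | b%:E < v x]))) &
        forall b : R, (0 < b)%R -> b%:E < v x0 -> Lp (layer 0 b) G]].
Proof.
have [b_ [b0 bM bmono bex]] := exhausting_levels M_gt0.
have /choice[g_ Hg] n := cut_minimal (b0 n) (bM n).
pose O_ n := layer 0 (b_ n).
have pg n : pwug setT (cut (b_ n)) (g_ n) by case: (Hg n) => -[].
have Lg n : Lp setT (g_ n) by case: (Hg n) => -[].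
have bg n : borel_fun (g_ n) by case: (pg n).
have g0 n x : 0 <= g_ n x by case: (pg n) => _ + _; exact.
have gO n x : ~ O_ n x -> g_ n x = 0 by case: (Hg n) => _; exact.
pose G x := esups (g_ ^~ x) 0%N.
have gG n x : g_ n x <= G x by apply: ereal_sup_ubound; exists n.
have bG : borel_fun G by exact: (@measurable_fun_esups _ borelType).
have G0 x : 0 <= G x by apply: le_trans (gG 0%N x).
have GO x : ~ V x -> G x = 0.
  move=> nV; apply/eqP; rewrite eq_le G0 andbT; apply: ub_ereal_sup => _ [n _ <-].
  by rewrite gO// => -[].
have GP x y : (forall n, g_ n x <= y) -> G x <= y.
  by move=> H; apply: ub_ereal_sup => _ [n _ <-].
(* If [b_ m <= b_ n], the truncation at [b_ m] is a contraction of the one at [b_ n]; otherwise both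
   equal [v] on the layer [O_ n], and minimality is local. *)
have gg m n : {ae mu, forall x, O_ n x -> g_ m x <= g_ n x}.
  have [mn|nm] := leP (b_ m) (b_ n).
    have [[_ _ minm] _] := Hg m.
    have pm : pwug setT (cut (b_ m)) (g_ n).
      apply: pwug_map (pg n) _ => x y _ _.
      have E z : cut (b_ m) z = clampe 0 (b_ m) (cut (b_ n) z)%:E.
        rewrite clampe_fin; have [h1 h2] := andP (cut_ge0 z (ltW (b0 n))).
        rewrite (max_idPl h1); case: (vh z) (vh_ge0 z) => [r r0||//].
          by rewrite !clampe_fin (max_idPl _)// -minA (min_idPr mn).
        by rewrite !clampey (min_idPr mn).
      rewrite [X in (`|X - _|)%R]E [X in (`|_ - X|)%R]E -lee_fin.
      by apply: le_trans (clampe_contraction _ _ _ _) _.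
    by move: (minm _ pm (Lg n)); apply: filterS => x h _; exact: h.
  have [mgm _] := Hg m.
  apply: (minimal_pwug_local openT (open_layer 0 (b_ n)) (@subsetT _ _) mgm).
    apply: (pwug_eq (pwug_subset measurableT _ (@subsetT _ _) (pg n))).
      by apply: open_measurable; exact: open_layer.
    move=> x lx; rewrite !cut_layer//; move: lx => [Vx /andP[l1 l2]]; split => //=.
    by rewrite l1 (lt_trans l2)// lte_fin.
  apply: Lp_subset (Lg n) => //.
  by apply: open_measurable; exact: open_layer.
have Gn n : {ae mu, forall x, O_ n x -> G x = g_ n x}.
  have := ae_foralln (fun m => gg m n); apply: filterS => x h Ox.
  by apply/eqP; rewrite eq_le gG andbT; apply: GP => m; exact: h.
have cutl n x : O_ n x -> cut (b_ n) x = fine (v x) by exact: cut_layer.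
have cvg_cut x (r : R) : vh x = r%:E -> (r%:E <= v x0) -> (cut (b_ n) x) @[n --> \oo] --> r.
  move=> E rM; have r0 : (0 <= r)%R by rewrite -lee_fin -E.
  apply/cvgrPdist_le => e e0; have [N HN] : exists n, (r - e < b_ n)%R.
    by apply: bex; apply: lt_le_trans rM; rewrite lte_fin ltrBlDr ltrDl.
  near=> n; have Nn : (N <= n)%N by near: n; exact: nbhs_infty_ge.
  have := lt_le_trans HN (bmono _ _ Nn).
  rewrite E clampe_fin (max_idPl r0) => h.
  have [l|l] := leP r (b_ n); first by rewrite subrr normr0 ltW.
  by rewrite ger0_norm ?subr_ge0 ?(ltW l)// lerBlDr; move: h; rewrite ltrBlDr addrC => /ltW.
have cvg_clamp a b x : (b%:E <= v x0) ->
    clampe a b (cut (b_ n) x)%:E @[n --> \oo] --> clampe a b (vh x).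
  move=> bM'; have [yes|no] := eqVneq (vh x) +oo.
    have vy : v x0 = +oo.
      have [Ox|/vh0 E] := pselect (Om x); last by rewrite E in yes.
      by apply/eqP; rewrite -leye_eq -yes vhE// v_le.
    have [N HN] : exists n, (b < b_ n)%R by apply: bex; rewrite vy ltry.
    apply: cvg_near_cst; near=> n; have Nn : (N <= n)%N by near: n; exact: nbhs_infty_ge.
    rewrite yes clampey clampey clampe_fin; apply/min_idPr.
    by rewrite le_max ltW//; exact: lt_le_trans (bmono _ _ Nn).
  have [r E] : exists r, vh x = r%:E.
    by move: no (vh_ge0 x); case: (vh x) => [r||]// _ _; exists r.
  have rM : r%:E <= v x0.
    have [Ox|/vh0 E'] := pselect (Om x); first by rewrite -E vhE// v_le.
    by rewrite -E E' ltW.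
  have := cvg_cut x r E rM => /cvgrPdist_le H; apply/cvgrPdist_le => e e0.
  move: (H e e0); apply: filterS => n; apply: le_trans.
  rewrite E -lee_fin; exact: (clampe_contraction a b r%:E).
(* Truncation asks for a set containing all points beyond the level, also those off the layer [O_ n]
   such as the pole. Enlarging [S] by the complement of [O_ n] costs nothing, since [g_ n] vanishes
   there. *)
have sel n S x : (g_ n \_ (~` O_ n `|` S)) x <= (G \_ S) x.
  have GS : 0 <= (G \_ S) x by exact: erestrict_ge0.
  have [Ox|nO] := pselect (O_ n x); last by rewrite patchE gO// if_same.
  rewrite patchE; case: ifPn => [|_//]; rewrite inE => -[//|Sx].
  by rewrite patchE mem_set.
have bsel n S : borel_set S -> borel_set (~` O_ n `|` S).
  move=> bS; apply: (@measurableU _ borelType); last exact: bS.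
  by apply: (@measurableC _ borelType); apply: open_borel_set; exact: open_layer.
have selgt n (a : R) S : borel_set S -> (forall x, O_ n x -> a%:E < v x -> S x) ->
    pwug setT (fun x => Num.max (cut (b_ n) x) a) (g_ n \_ (~` O_ n `|` S)).
  move=> bS HS; apply: (pwug_truncate measurableT (pg n) (Lg n) (bsel n S bS)) => x _.
  have [Ox|nO _] := pselect (O_ n x); last by left.
  rewrite cutl// => lt; right; apply: HS => //.
  by have [Vx _] := Ox; rewrite (vV Vx) lte_fin.
have sellt n (a : R) S : borel_set S -> (forall x, O_ n x -> v x < a%:E -> S x) ->
    pwug setT (fun x => Num.min (cut (b_ n) x) a) (g_ n \_ (~` O_ n `|` S)).
  move=> bS HS.
  have h x : setT x -> (- a < - cut (b_ n) x)%R -> (~` O_ n `|` S) x.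
    move=> _; rewrite ltrN2; have [Ox|nO _] := pselect (O_ n x); last by left.
    rewrite cutl// => lt; right; apply: HS => //.
    by have [Vx _] := Ox; rewrite (vV Vx) lte_fin.
  have := pwugN (pwug_truncate measurableT (pwugN (pg n)) (Lg n) (bsel n S bS) h).
  by move=> /pwug_eq; apply => x _; rewrite oppr_max !opprK.
have pV : pwug V (fine \o v) G.
  apply: (pwug_limit (f_ := fun n => cut (b_ n)) (g_ := g_) mV) => // [n|x Vx].
    exact: pwug_subset (pg n).
  have Ox := VO Vx; apply: cvg_cut; first by rewrite vhE// vV.
  by rewrite -vV// v_le.
(* Each truncation is a contraction of [v], so its minimal gradient is almost everywhere below any
   local gradient of [v], and so is the supremum. *)
have locmin B g' : open B -> B `<=` V -> pwug B (fine \o v) g' -> Lp B g' ->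
    {ae mu, forall x, B x -> G x <= g' x}.
  move=> oB BV pB LB.
  have : {ae mu, forall x, forall n, B x -> g_ n x <= g' x}.
    apply/ae_foralln => n; have [mgn _] := Hg n.
    apply: (minimal_pwug_local openT oB (@subsetT _ _) mgn _ LB).
    apply: pwug_map pB _ => x y Bx By; rewrite -lee_fin.
    have h z : B z -> vh z = (fine (v z))%:E by move=> /BV Vz; rewrite -vV//; apply: vhE; exact: VO.
    rewrite h// h//; exact: clampe_contraction.
  by apply: filterS => x h Bx; apply: GP => n; exact: h.
have LlocG : Lp_loc mu p V G.
  move=> x Vx; have [_ [_ [_ _ [Nv _]] _ _ _]] := v_sing.
  have [r [r0 BV NB]] := Nv x Vx; exists r => //.
  have oB := ball_open_metric x r; have mB := open_measurable oB.
  have [k pk Lk] : exists2 k, pwug (ball x r) (fine \o v) k & Lp (ball x r) k.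
    apply: (N1p_pwug oB NB) => y z By Bz; rewrite [in leRHS](vV (BV _ By)) [in leRHS](vV (BV _ Bz)).
    by rewrite -EFinB abse_EFin.
  have [bk k0 _] := pk.
  have -> : V `&` ball x r = ball x r by apply/setIidr.
  apply: (le_lt_trans _ Lk); apply: ae_ge0_le_integral => //.
  - by move=> y _; exact: poweR_ge0.
  - exact/measurable_pow/borel_fun_measurable.
  - by move=> y _; exact: poweR_ge0.
  - exact/measurable_pow/borel_fun_measurable.
  - move: (locmin _ _ oB BV pk Lk); apply: filterS => y h By.
    by apply: le_poweR; [exact: ltW|by []|exact: h].
exists G; split => //.
  exact: (is_minimal_wug_of_local oV vV pV LlocG locmin).
split.
- move=> a b /andP[a0 ab] bM'.
  have bL : borel_set (layer a b) by apply: open_borel_set; exact: open_layer.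
  apply: (pwug_limit (f_ := fun n x => clampe a b (cut (b_ n) x)%:E)
    (g_ := fun n => g_ n \_ (~` O_ n `|` layer a b)) measurableT).
  + move=> n.
    have b1 : borel_set (V `&` [set x | v x < b%:E]) by exact: open_borel_set.
    have p1 := sellt n b _ b1 (fun x Ox lt => conj Ox.1 lt).
    have Lc S : borel_set S -> Lp setT (g_ n \_ (~` O_ n `|` S)).
      move=> bS; apply: Lp_le (Lg n) => //.
      * by apply: borel_fun_patch => //; exact: bsel.
      * by move=> x; exact: erestrict_ge0.
      * by move=> x _; rewrite patchE; case: ifPn.
    have h x : setT x -> (a < Num.min (cut (b_ n) x) b)%R -> (~` O_ n `|` (Om `&` [set x | a%:E < v x])) x.
      move=> _; rewrite lt_min => /andP[lt _]; have [Ox|nO] := pselect (O_ n x); last by left.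
      right; move: lt; rewrite cutl//; have [Vx _] := Ox => lt; split; first exact: VO.
      by rewrite /= (vV Vx) lte_fin.
    have p2 := pwug_truncate measurableT p1 (Lc _ b1) (bsel n _ (open_borel_set (open_gt a))) h.
    have E : ((g_ n \_ (~` O_ n `|` V `&` [set x | v x < b%:E])) \_ (~` O_ n `|` (Om `&` [set x | a%:E < v x]))) =
        g_ n \_ (~` O_ n `|` layer a b).
      apply/funext => x; have [Ox|nO] := pselect (O_ n x); last first.
        by rewrite !patchE gO// !if_same.
      have E1 S : (x \in ~` O_ n `|` S) = (x \in S).
        by apply/idP/idP; rewrite !inE; [case|right].
      rewrite !patchE !E1 layerE; move: (Om `&` _) (V `&` _) => S1 S2.
      by rewrite in_setI; case: (x \in S1); case: (x \in S2).
    rewrite -E; apply: (pwug_eq p2) => x _; rewrite clampe_fin.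
    exact: max_min_clamp (ltW ab).
  + by apply: borel_fun_patch.
  + by move=> n x; exact: sel.
  + by move=> x _; exact: cvg_clamp.
- move=> a b /andP[a0 ab] bM'.
  have b1 : borel_set (V `&` [set x | v x < a%:E]) by exact: open_borel_set.
  have b2 : borel_set (V `&` [set x | b%:E < v x]).
    have -> : V `&` [set x | b%:E < v x] = V `&` (Om `&` [set x | b%:E < v x]).
      by apply/seteqP; split => x [Vx]; [move=> ?; split => //; split => //; exact: VO|move=> []].
    by apply: open_borel_set; exact: openI.
  apply: (pwug_limit (f_ := fun n x => (cut (b_ n) x - clampe a b (cut (b_ n) x)%:E)%R)
    (g_ := fun n => (g_ n \_ (~` O_ n `|` (V `&` [set x | v x < a%:E]))) \+
        (g_ n \_ (~` O_ n `|` (V `&` [set x | b%:E < v x])))) mV).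
  (* By [sub_clamp] the remainder of the truncation is, up to a constant, a minimum with [a] plus a
     maximum with [b], and the gradient of each is needed on one side of its level only. *)
  + move=> n; have p1 := sellt n a _ b1 (fun x Ox lt => conj Ox.1 lt).
    have p2 := selgt n b _ b2 (fun x Ox lt => conj Ox.1 lt).
    have := pwug_subset measurableT mV (@subsetT _ _) (pwugD measurableT p1 p2).
    move=> /pwug_map; apply => x y _ _ /=; rewrite !clampe_fin le_eqVlt; apply/orP; left; apply/eqP; congr (`|_|)%R.
    by rewrite !(sub_clamp _ (ltW ab)); lra.
  + by apply: emeasurable_funD; exact: borel_fun_patch.
  + by move=> n x; apply: leeD; exact: sel.
  + move=> x Vx; apply: cvgB; first apply: cvg_cut.
    * by rewrite -vV//; apply: vhE; exact: VO.
    * by rewrite -vV// v_le//; exact: VO.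
    by rewrite -[v x]vhE; [exact: cvg_clamp|exact: VO].
- move=> b b_gt0 bM'; have [c] : exists c : R, (b < c)%R /\ c%:E <= v x0.
    move: bM'; case: (v x0) => [m||]// h; first by exists m; rewrite lexx.
    by exists (b + 1)%R; rewrite ltrDl ltr01 leey.
  move=> [bc cM].
  have [n bn] := bex b bM'.
  have sub : layer 0 b `<=` O_ n.
    by move=> x [Vx /andP[l1 l2]]; split => //=; rewrite l1 (lt_trans l2)// lte_fin.
  have mL : measurable (layer 0 b) by apply: open_measurable; exact: open_layer.
  apply: (le_lt_trans _ (Lp_subset measurableT mL (@subsetT _ _) (bg n) (Lg n))).
  apply: ae_ge0_le_integral => //.
  - by move=> y _; exact: poweR_ge0.
  - exact/measurable_pow/borel_fun_measurable.
  - by move=> y _; exact: poweR_ge0.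
  - exact/measurable_pow/borel_fun_measurable.
  - by move: (Gn n); apply: filterS => y h /sub ly; rewrite h.
Unshelve. all: by end_near. Qed.

(** * Energy of the layers and capacity of condensers *)

Variable G : X -> \bar R.
Hypotheses (bG : borel_fun G) (G0 : forall x, 0 <= G x) (minG : is_minimal_wug mu p V v G).
Hypothesis locG : forall B g', open B -> B `<=` V -> pwug B (fine \o v) g' -> Lp B g' ->
  {ae mu, forall x, B x -> G x <= g' x}.
Hypothesis layG : forall a b : R, (0 <= a < b)%R -> b%:E <= v x0 ->
  pwug setT (fun x => clampe a b (vh x)) (G \_ (layer a b)).
Hypothesis resG : forall a b : R, (0 <= a < b)%R -> b%:E <= v x0 ->
  pwug V (fun x => fine (v x) - clampe a b (v x))%R
    ((G \_ (V `&` [set x | v x < a%:E])) \+ (G \_ (V `&` [set x | b%:E < v x]))).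
Hypothesis LG : forall b : R, (0 < b)%R -> b%:E < v x0 -> Lp (layer 0 b) G.

Local Notation energy a b := (\int[mu]_(x in layer a b) G x `^ p).
Local Notation upper a := (Om `&` [set x | a%:E < v x]).

Let mL a b : measurable (layer a b) := open_measurable (open_layer a b).

Let clampe_top a b x : (a <= b)%R -> Om x -> b%:E <= v x -> clampe a b (vh x) = b.
Proof.
move=> ab Ox; rewrite vhE//; case: (v x) => [r||]//; rewrite ?clampey//.
rewrite lee_fin clampe_fin => br; rewrite (max_idPl _); last exact: le_trans br.
exact/min_idPr.
Qed.

Let clampe_bot a b x : (0 <= a <= b)%R -> ~ upper a x -> clampe a b (vh x) = a.
Proof.
move=> /andP[a0 ab] nu; have va : vh x <= a%:E.
  have [Ox|/vh0 ->] := pselect (Om x); last by rewrite lee_fin.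
  by rewrite vhE// leNgt; apply/negP => lt; exact: nu.
move: va (vh_ge0 x); case: (vh x) => [r||]//; rewrite lee_fin => ra _.
by rewrite clampe_fin (max_idPr ra) (min_idPl ab).
Qed.

Lemma integral_pow_patch D (h : X -> \bar R) : \int[mu]_x (h \_ D) x `^ p = \int[mu]_(x in D) h x `^ p.
Proof.
rewrite [RHS]integral_mkcond; apply: eq_integral => x _.
by rewrite !patchE; case: ifPn => // _; rewrite poweR0r.
Qed.

Let ramp a b x : R := (clampe a b (vh x) - a)%R.

Let ramp_bounds a b x : (a <= b)%R -> (0 <= ramp a b x <= b - a)%R.
Proof. by move=> ab; have /andP[h1 h2] := clampe_bounds (vh x) ab; rewrite subr_ge0 h1 lerB. Qed.

Let pwug_ramp a b : (0 <= a < b)%R -> b%:E <= v x0 -> pwug setT (ramp a b) (G \_ (layer a b)).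
Proof.
by move=> ab bM; apply: (pwug_map (layG ab bM)) => x y _ _; rewrite /ramp opprB addrA subrK.
Qed.

Let newton_bounded (f : X -> R) (c : R) : measurable_fun setT f -> (0 <= c)%R ->
  (forall x, `|f x| <= c)%R -> (forall x, ~ Om x -> f x = 0%R) ->
  (exists2 g, pwug setT f g & Lp setT g) -> newton setT f.
Proof.
move=> mf c0 fc f0 pf; split; [exact: mf| |exact: pf].
apply: le_lt_trans (Lp_patch (Lp_cst mO mu_Om c0)); apply: ge0_le_integral_nomeas => x _.
  exact: poweR_ge0.
rewrite patchE; case: ifPn => [_|]; last by rewrite notin_setE => /f0 ->; rewrite abse0.
by apply: le_poweR; [exact: ltW|by []|rewrite lee_fin].
Qed.

Let newton_ramp a b : (0 <= a < b)%R -> b%:E <= v x0 -> energy a b < +oo -> newton setT (ramp a b).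
Proof.
move=> ab bM fin; have /andP[a0 alb] := ab.
apply: (newton_bounded (c := b - a)%R).
- apply: measurable_funB; last exact: measurable_cst.
  exact: measurable_clampe.
- by rewrite subr_ge0 ltW.
- by move=> x; have /andP[h1 h2] := ramp_bounds x (ltW alb); rewrite ger0_norm.
- move=> x nO; rewrite /ramp clampe_bot ?subrr//; last by move=> -[].
  by rewrite a0 ltW.
by exists (G \_ (layer a b)); [exact: pwug_ramp|rewrite /Lp integral_pow_patch].
Qed.

(* Where w differs from the rescaled truncation of v, the p-harmonicity of v is
   tested with their difference; where they agree, so do their gradients. *)
Lemma energy_lower a b (w : X -> R) gw : (0 <= a < b)%R -> b%:E <= v x0 -> energy a b < +oo ->
  measurable_fun setT w -> (forall x, 0 <= w x <= 1)%R -> w x0 = 1%R ->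
  (forall x, Om x -> b%:E < v x -> w x = 1%R) -> (forall x, ~ upper a x -> w x = 0%R) ->
  pwug setT w gw -> Lp setT gw ->
  energy a b <= ((b - a) `^ p)%:E * \int[mu]_x gw x `^ p.
Proof.
move=> ab bM fin mw w01 wx0 w1 w0 pw Lw; have /andP[a0 alb] := ab.
have ba0 : (0 < b - a)%R by rewrite subr_gt0.
have [bw gw0 _] := pw.
have Nw : newton setT w.
  apply: (newton_bounded (c := 1%R)) => //; last by exists gw.
  - by move=> x; have /andP[h1 h2] := w01 x; rewrite ger0_norm.
  - by move=> x nO; apply: w0 => -[].
have Nr := newton_ramp ab bM fin.
(* At the pole both terms equal [b - a], so [phi] is an admissible test function on the punctured
   domain. *)
pose phi x : R := ((b - a) * w x - ramp a b x)%R.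
have Nphi : newton setT phi.
  have := newtonD measurableT (newtonZ (b - a)%R measurableT Nw) (newtonZ (-1)%R measurableT Nr).
  by congr newton; apply/funext => x; rewrite /phi /= mulN1r.
have phi0 x : ~ V x -> phi x = 0%R.
  move=> nV; rewrite /phi /ramp; have [e|xx0] := eqVneq x x0.
    by rewrite e wx0 clampe_top// ?(ltW alb)//; lra.
  have nO : ~ Om x by move=> Ox; apply: nV; split => //; exact/eqP.
  rewrite w0 ?clampe_bot ?subrr ?mulr0 ?subr0// ?a0 ?(ltW alb)// => -[]//.
pose U := [set x | phi x != 0%R].
have UV : U `<=` V by move=> x /eqP; apply: contra_notP => /phi0.
have mphi : measurable_fun setT (EFin \o phi) by case: Nphi => /measurable_EFinP.
have UE : [set x | (EFin \o phi) x != 0] = U by apply/seteqP; split => x /=; rewrite eqe.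
have mU : measurable U by rewrite -UE; exact: measurable_neq0.
have ULab x : U x -> a%:E <= v x <= b%:E.
  move=> Ux; have [Ox _] := UV _ Ux; apply: contrapT => /negP nab; move: Ux => /=.
  move: nab; rewrite negb_and -!ltNge => /orP[va|vb]; apply/negP; rewrite negbK; apply/eqP.
    have nu : ~ upper a x by move=> [_ /=]; rewrite ltNge (ltW va).
    by rewrite /phi /ramp w0// clampe_bot ?subrr ?mulr0 ?subr0// a0 ltW.
  by rewrite /phi /ramp w1// clampe_top// ?(ltW alb) ?(ltW vb)//; lra.
pose k1 x := (b - a)%:E * gw x.
have bk1 : borel_fun k1 by exact: measurable_funeM.
have k10 x : 0 <= k1 x by rewrite mule_ge0// lee_fin ltW.
have pk1 : pwug setT (fun x => (b - a) * w x)%R k1.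
  by have := pwugM (b - a)%R pw; rewrite gtr0_norm.
have Ik1 D : measurable D -> \int[mu]_(x in D) k1 x `^ p = ((b - a) `^ p)%:E * \int[mu]_(x in D) gw x `^ p.
  by move=> mD; rewrite integral_powZ//; exact: borel_fun_measurable.
have Lk1 : Lp setT k1.
  by rewrite /Lp Ik1//; apply: lte_mul_pinfty => //; rewrite lee_fin powR_ge0.
(* On [V], the function [v + phi] is [(b - a) * w] plus [a] plus the remainder of [v] beyond the two
   levels. The remainder has gradient 0 where [a <= v <= b], and [U] lies there. *)
have onU : \int[mu]_(x in U) G x `^ p <= \int[mu]_(x in U) k1 x `^ p.
  have [_ [_ [_ _ [_ minv]] _ _ _]] := v_sing.
  have N0 : N1p0 mu p V (EFin \o phi).
    by split; [exact: newton_N1p openT Nphi|move=> x nV; rewrite /= phi0].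
  have := minv _ N0; rewrite UE (integral_minimal_wug mV mU UV minG) => /le_trans; apply.
  set r := (G \_ (V `&` [set x | v x < a%:E])) \+ (G \_ (V `&` [set x | b%:E < v x])).
  have pr := resG ab bM.
  have [br r0 _] := pr.
  have pk := pwugD mV (pwug_subset measurableT mV (@subsetT _ _) pk1) pr.
  have Gr x : r x <= 2%:E * G x.
    have le S : (G \_ S) x <= G x by rewrite patchE; case: ifPn.
    apply: (le_trans (leeD (le _) (le _))).
    by rewrite -[2%R]/(1 + 1)%R EFinD ge0_muleDl ?lee_fin// mul1e.
  apply: (@le_trans _ _ (\int[mu]_(x in U) (k1 \+ r) x `^ p)); last first.
    apply: ge0_le_integral_nomeas => x Ux; first exact: poweR_ge0.
    have /andP[h1 h2] := ULab x Ux.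
    have rx : r x = 0.
      rewrite /r /= !patchE memNset; last by move=> [_ /=]; rewrite ltNge h1.
      by rewrite memNset ?adde0//; move=> [_ /=]; rewrite ltNge h2.
    by rewrite /= rx adde0.
  apply: (integral_minimal_wug_le mV mU UV).
    apply: wug_contraction (pwug_wug mV pk) _ => x y Vx Vy.
    have E z : V z -> (v \+ (EFin \o phi)) z =
        (((fun x => (b - a) * w x) \+ (fun x => fine (v x) - clampe a b (v x)))%R z + a)%:E.
      move=> Vz; rewrite [in LHS]/= (vV Vz) -EFinD; congr EFin; rewrite /phi /ramp vhE; last exact: VO.
      by rewrite /= (vV Vz); lra.
    have sh (c d' e : R) : (c + e - (d' + e) = c - d')%R by lra.
    by rewrite (E _ Vx) (E _ Vy) -EFinB abse_EFin sh.
  move=> x Vx; have [_ LlG _] := minG; have [s s0 fins] := LlG x Vx; exists s => //.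
  have mB : measurable (V `&` ball x s) by apply: measurableI => //; exact: measurable_ball.
  apply: LpD => //.
  - exact: Lp_subset Lk1.
  - apply: (Lp_le (g := fun x => 2%:E * G x)) => //; first exact: measurable_funeM.
    rewrite /Lp integral_powZ//; last exact: borel_fun_measurable.
    by apply: lte_mul_pinfty => //; rewrite lee_fin powR_ge0.
(* On the layer [ramp] is [v - a], and off [U] it agrees with [(b - a) * w]; locality then gives [v]
   a gradient that is almost everywhere at most [k1] where they agree. *)
have offU : \int[mu]_(x in layer a b `\` U) G x `^ p <= \int[mu]_(x in layer a b `\` U) k1 x `^ p.
  have oL := open_layer a b.
  have [mr _ _] := Nr.
  have mk : measurable_fun setT (fun x => (b - a) * w x)%R.
    by apply: measurable_funM => //; exact: measurable_cst.
  have pL : pwug (layer a b) (ramp a b) (G \_ (layer a b)).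
    exact: pwug_subset (pwug_ramp ab bM).
  have LL : Lp (layer a b) (G \_ (layer a b)).
    apply: le_lt_trans fin; apply: ge0_le_integral_nomeas => x Lx; first exact: poweR_ge0.
    by rewrite patchE mem_set.
  have pkL := pwug_subset measurableT (mL a b) (@subsetT _ _) pk1.
  have LkL : Lp (layer a b) k1 by apply: Lp_subset Lk1.
  have [k [pk Lk aek]] := pwug_coincide oL (measurable_funTS mr) (measurable_funTS mk) pL LL pkL LkL.
  have pv : pwug (layer a b) (fine \o v) k.
    apply: (pwug_map pk) => x y /layerP[_ vx l1 l2] /layerP[_ vy l3 l4].
    rewrite /ramp vx vy !clampe_fin /= !(max_idPl _) ?(ltW l1) ?(ltW l3)//.
    rewrite !(min_idPl _) ?(ltW l2) ?(ltW l4)//.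
    have sh (c d' e : R) : (c - e - (d' - e) = c - d')%R by lra.
    by rewrite sh.
  have aeG := locG oL (@subIsetl _ _ _) pv Lk.
  have mD : measurable (layer a b `\` U) by exact: measurableD.
  apply: ae_ge0_le_integral => //.
  - by move=> y _; exact: poweR_ge0.
  - exact/measurable_pow/borel_fun_measurable.
  - by move=> y _; exact: poweR_ge0.
  - exact/measurable_pow/borel_fun_measurable.
  - apply: filterS2 aek aeG => x h1 h2 [Lx nU].
    apply: le_poweR; [exact: ltW|by []|apply: le_trans (h2 Lx) _; apply: h1 => //].
    have : phi x = 0%R by apply/eqP; apply: contrapT => /negP.
    by rewrite /phi => /eqP; rewrite subr_eq0 => /eqP.
have mGp D : measurable_fun D (fun x => G x `^ p) by exact/measurable_pow/borel_fun_measurable.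
have mkp D : measurable_fun D (fun x => k1 x `^ p) by exact/measurable_pow/borel_fun_measurable.
have mLU : measurable (layer a b `\` U) by exact: measurableD.
have dis : [disjoint U & layer a b `\` U] by rewrite disj_set2E setIC setDKI.
rewrite -Ik1//.
apply: (@le_trans _ _ (\int[mu]_(x in U `|` (layer a b `\` U)) k1 x `^ p)); last first.
  by apply: ge0_subset_integral => //; [exact: measurableU|move=> x _; exact: poweR_ge0].
rewrite ge0_integral_setU//; last by move=> x _; exact: poweR_ge0.
apply: le_trans (leeD onU offU); rewrite -ge0_integral_setU//; last by move=> x _; exact: poweR_ge0.
apply: ge0_subset_integral => //; first exact: measurableU.
- by move=> x _; exact: poweR_ge0.
- by move=> x Lx; have [Ux|nU] := pselect (U x); [left|right].
Qed.

(** The rescaled truncation of [v] gives the upper bound, and [energy_lower] for competitors clamped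
    to [[0, 1]] the lower one. The set [E] is left free so that it can be a superlevel set, or the
    pole alone when [b = v x0]. *)
Lemma capp_level a b (E : set X) : (0 <= a < b)%R -> b%:E <= v x0 -> energy a b < +oo ->
  E x0 -> upper b `<=` E -> (forall x, E x -> Om x /\ b%:E <= v x) ->
  capp mu p E (upper a) = ((b - a)^-1 `^ p)%:E * energy a b.
Proof.
move=> ab bM fin Ex0 bE Eb; have /andP[a0 alb] := ab.
have ba0 : (0 < b - a)%R by rewrite subr_gt0.
have ba0' : (0 < (b - a)^-1)%R by rewrite invr_gt0.
apply/eqP; rewrite eq_le; apply/andP; split.
  pose f x : R := ((b - a)^-1 * ramp a b x)%R.
  have Nf : newton setT f := newtonZ _ measurableT (newton_ramp ab bM fin).
  apply: (@le_trans _ _ (\int[mu]_x (minimal_wug mu p setT (EFin \o f) x `^ p))).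
    apply: ereal_inf_lbound; exists (EFin \o f) => //; split.
    - exact: newton_N1p openT Nf.
    - move=> x /Eb[Ox bx]; rewrite /= lee_fin /f /ramp clampe_top ?(ltW alb)//.
      by rewrite mulVf// gt_eqF.
    - move=> x nu; rewrite /= /f /ramp clampe_bot ?subrr ?mulr0//.
      by rewrite a0 ltW.
  have pf : pwug setT f (fun x => (b - a)^-1%:E * (G \_ (layer a b)) x).
    by have := pwugM (b - a)^-1%R (pwug_ramp ab bM); rewrite gtr0_norm.
  have [bf f0 _] := pf.
  have If : \int[mu]_x ((b - a)^-1%:E * (G \_ (layer a b)) x) `^ p = ((b - a)^-1 `^ p)%:E * energy a b.
    rewrite integral_powZ// ?integral_pow_patch//.
      by apply: borel_fun_measurable; apply: borel_fun_patch => //; apply: open_borel_set; exact: open_layer.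
    by move=> x _; exact: erestrict_ge0.
  rewrite -If; apply: integral_minimal_wug_le => //; first exact: pwug_wug.
  move=> x _; exists 1%R => //; apply: (@le_lt_trans _ _ (((b - a)^-1 `^ p)%:E * energy a b)).
    rewrite -If; apply: ge0_subset_integral => //.
    - by rewrite setTI; exact: measurable_ball.
    - exact/measurable_pow/borel_fun_measurable.
    - by move=> y _; exact: poweR_ge0.
  by apply: lte_mul_pinfty => //; rewrite lee_fin powR_ge0.
apply: le_ereal_inf_tmp => _ [u [Nu u1 u0] <-].
have [g mg Lg] := N1p_minimal openT Nu.
rewrite (integral_minimal_wug _ _ _ mg)//.
have [wg _ _] := mg.
pose w x : R := clampe 0 1 (u x).
have ww : weak_upper_gradient mu p setT (EFin \o w) g.
  by apply: wug_contraction wg _ => x y _ _; exact: clampe_contraction.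
have [g' [pg' _ g'g]] := wug_pwug openT ww (fun _ _ => erefl).
have [mg' _ _] := wg; have [bg' g'0 _] := pg'.
have Ig' : \int[mu]_x g' x `^ p = \int[mu]_x g x `^ p.
  apply: ge0_ae_eq_integral => //.
  - exact/measurable_pow/borel_fun_measurable.
  - exact: measurable_pow.
  - by move=> x _; exact: poweR_ge0.
  - by move=> x _; exact: poweR_ge0.
  - by move: g'g; apply: filterS => x h _; rewrite h.
have w1 x : E x -> w x = 1%R.
  move=> /u1; rewrite /w; case: (u x) => [r||]//; rewrite ?clampey//.
  rewrite lee_fin clampe_fin => r1; rewrite (max_idPl _); last exact: le_trans r1.
  exact/min_idPr.
have := @energy_lower a b w g' ab bM fin _ _ _ _ _ pg' _; rewrite -Ig'.
rewrite (powRV _ ba0).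
rewrite lee_pdivrMl ?powR_gt0//; apply.
- by apply: measurable_clampe; case: Nu.
- by move=> x; exact: clampe_bounds.
- exact: w1.
- by move=> x Ox bx; apply: w1; apply: bE.
- by move=> x /u0 ux; rewrite /w ux clampe_fin maxxx; apply/min_idPl.
- by rewrite /Lp Ig'.
Qed.

Lemma integral_pow_disjoint L1 L2 (h1 h2 : X -> \bar R) : measurable L1 -> measurable L2 ->
  [disjoint L1 & L2] -> borel_fun h1 -> borel_fun h2 ->
  (forall x, 0 <= h1 x) -> (forall x, 0 <= h2 x) ->
  \int[mu]_x ((h1 \_ L1) x + (h2 \_ L2) x) `^ p =
  \int[mu]_(x in L1) h1 x `^ p + \int[mu]_(x in L2) h2 x `^ p.
Proof.
move=> m1 m2 dis b1 b2 h10 h20.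
rewrite -[X in _ = X + _]integral_pow_patch -[X in _ = _ + X]integral_pow_patch.
have mp L h : measurable L -> borel_fun h -> measurable_fun setT (fun x => (h \_ L) x `^ p).
  move=> mL' bh; apply/measurable_pow/(measurable_restrictT _ mL').1; exact: borel_fun_measurable.
rewrite -(ge0_integralD mu measurableT (fun x _ => poweR_ge0 _ _) (mp _ _ m1 b1)
  (fun x _ => poweR_ge0 _ _) (mp _ _ m2 b2)).
apply: eq_integral => x _; rewrite !patchE.
case: ifPn => [/[1!inE] l1|_]; case: ifPn => [/[1!inE] l2|_].
- have : (L1 `&` L2) x by [].
  by move: dis; rewrite disj_set2E => /eqP ->.
- by rewrite adde0 poweR0r// adde0.
- by rewrite add0e poweR0r// add0e.
- by rewrite adde0 poweR0r// adde0.
Qed.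

(** At an interior minimum the derivative of A t^p + B (1 - t)^p vanishes. *)
Lemma powR_balance (A B t0 : R) : (0 < t0 < 1)%R ->
  (forall t, (0 < t < 1)%R ->
    (A * t0 `^ p + B * (1 - t0) `^ p <= A * t `^ p + B * (1 - t) `^ p)%R) ->
  (A * t0 `^ (p - 1) = B * (1 - t0) `^ (p - 1))%R.
Proof.
move=> t01 H.
pose f := (A \*: (fun t : R => t `^ p) + B \*: ((fun t : R => t `^ p) \o (fun t : R => 1 - t)))%R.
have df (t : R) : (0 < t < 1)%R -> is_derive t 1%R f
    (A *: (p * t `^ (p - 1)) + B *: (p * (1 - t) `^ (p - 1) * (0 - 1)))%R.
  move=> /andP[h1 h2]; apply: is_deriveD.
    by apply: is_deriveZ; exact: is_derive1_powR.
  apply: is_deriveZ; apply: is_derive1_comp.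
    by apply: is_derive1_powR; rewrite subr_gt0.
have in01 (t : R) : t \in `]0%R, 1%R[ = (0 < t < 1)%R by rewrite in_itv.
have m : is_derive t0 1%R f 0%R.
  apply: (derive1_at_min ler01).
  - by move=> t; rewrite in01 => t_in; have [] := df t t_in.
  - by rewrite in01.
  - by move=> t; rewrite in01; exact: H.
have := @derive_val _ _ _ _ _ _ _ (df t0 t01); rewrite (@derive_val _ _ _ _ _ _ _ m) sub0r.
rewrite /GRing.scale /= => E.
have : (p * (A * t0 `^ (p - 1) - B * (1 - t0) `^ (p - 1)) = 0)%R.
  by rewrite [RHS]E; ring.
by move=> /eqP; rewrite mulf_eq0 (negbTE p_neq0)/= subr_eq0 => /eqP.
Qed.

Let energy_fin a b : (0 <= a < b)%R -> b%:E < v x0 -> energy a b < +oo.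
Proof.
move=> /andP[a0 ab] bM; have b0 : (0 < b)%R by exact: le_lt_trans ab.
apply: (Lp_subset _ _ _ bG (LG b0 bM)) => //.
by move=> x [Vx /andP[l1 l2]]; split => //=; rewrite l2 v_gt0//; case: Vx.
Qed.

Let energyE a b : (0 <= a < b)%R -> b%:E < v x0 -> energy a b = (fine (energy a b))%:E.
Proof.
by move=> ab bM; rewrite fineK// ge0_fin_numE ?integral_pow_ge0//; exact: energy_fin.
Qed.

(* The competitors with slope t / (c - a) below the level c and
   (1 - t) / (b - c) above it have minimal energy for the affine one. *)
Lemma energy_split a c b : (0 <= a < c)%R -> (c < b)%R -> b%:E < v x0 ->
  exists k : R, [/\ energy a c = (k * (c - a))%:E, energy c b = (k * (b - c))%:E &
    energy a b = (k * (b - a))%:E].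
Proof.
move=> ac cb bM; have /andP[a0 alc] := ac.
have c0 : (0 <= c)%R by rewrite (le_trans a0)// ltW.
have cb' : (0 <= c < b)%R by rewrite c0.
have ab : (0 <= a < b)%R by rewrite a0 (lt_trans alc).
have cM : c%:E < v x0 by apply: lt_trans bM; rewrite lte_fin.
have ca0 : (0 < c - a)%R by rewrite subr_gt0.
have bc0 : (0 < b - c)%R by rewrite subr_gt0.
have ba0 : (0 < b - a)%R by rewrite subr_gt0; case/andP: ab.
pose J1 := fine (energy a c); pose J2 := fine (energy c b); pose J := fine (energy a b).
have E1 : energy a c = J1%:E by exact: energyE.
have E2 : energy c b = J2%:E by exact: energyE.
have E : energy a b = J%:E by exact: energyE.
have mGp D : measurable_fun D (fun x => G x `^ p) by exact/measurable_pow/borel_fun_measurable.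
have dis : [disjoint layer a c & layer c b].
  rewrite disj_set2E; apply/eqP/seteqP; split => x // -[[_ /andP[_ l2]] [_ /andP[l3 _]]].
  by move: (lt_trans l2 l3); rewrite ltxx.
(* Only an inequality at this stage, as the level set [{v = c}] might carry energy. *)
have sub : (J1 + J2 <= J)%R.
  rewrite -lee_fin EFinD -E -E1 -E2 -ge0_integral_setU//; last by move=> x _; exact: poweR_ge0.
  apply: ge0_subset_integral => //; first exact: measurableU.
  - by move=> x _; exact: poweR_ge0.
  - move=> x [[Vx /andP[l1 l2]]|[Vx /andP[l1 l2]]]; split => //=; rewrite ?l1 ?l2 ?andbT.
      by rewrite (lt_trans l2)// lte_fin.
    by rewrite (lt_trans _ l1)// lte_fin.
have comp (t : R) : (0 < t < 1)%R ->
    (J <= (b - a) `^ p * ((t / (c - a)) `^ p * J1 + ((1 - t) / (b - c)) `^ p * J2))%R.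
  move=> /andP[t0 t1]; have t1' : (0 < 1 - t)%R by rewrite subr_gt0.
  pose al := (t / (c - a))%R; pose be := ((1 - t) / (b - c))%R.
  have al0 : (0 < al)%R by rewrite divr_gt0.
  have be0 : (0 < be)%R by rewrite divr_gt0.
  pose w x : R := (al * ramp a c x + be * ramp c b x)%R.
  pose gw x := al%:E * (G \_ (layer a c)) x + be%:E * (G \_ (layer c b)) x.
  have pw : pwug setT w gw.
    have := pwugD measurableT (pwugM al (pwug_ramp ac (ltW cM))) (pwugM be (pwug_ramp cb' (ltW bM))).
    by rewrite !gtr0_norm.
  have Igw : \int[mu]_x gw x `^ p = (al `^ p * J1 + be `^ p * J2)%:E.
    rewrite EFinD !EFinM -E1 -E2 -!integral_powZ//; try exact: borel_fun_measurable.
    rewrite -integral_pow_disjoint//; try exact: measurable_funeM.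
    - apply: eq_integral => x _; rewrite /gw !patchE.
      by case: ifPn; case: ifPn; rewrite ?mule0.
    - by move=> x; rewrite mule_ge0// lee_fin ltW.
    - by move=> x; rewrite mule_ge0// lee_fin ltW.
  have [Nac _ _] := newton_ramp ac (ltW cM) (energy_fin ac cM).
  have [Ncb _ _] := newton_ramp cb' (ltW bM) (energy_fin cb' bM).
  have top x : Om x -> b%:E <= v x -> w x = 1%R.
    move=> Ox bx; have cx : c%:E <= v x by apply: le_trans bx; rewrite lee_fin ltW.
    rewrite /w /ramp !clampe_top ?(ltW cb) ?(ltW alc)// /al /be !divfK ?gt_eqF//.
    by lra.
  rewrite -lee_fin -E EFinM -Igw; apply: (energy_lower ab (ltW bM) (energy_fin ab bM) _ _ _ _ _ pw).
  - by apply: measurable_funD; apply: measurable_funM => //; exact: measurable_cst.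
  - move=> x; have /andP[h1 h2] := ramp_bounds x (ltW alc); have /andP[h3 h4] := ramp_bounds x (ltW cb).
    apply/andP; split.
      by apply: addr_ge0; apply: mulr_ge0 => //; exact: ltW.
    have k1 : (al * ramp a c x <= t)%R.
      by apply: (@le_trans _ _ (al * (c - a))%R); [rewrite ler_pM2l|rewrite /al divfK ?gt_eqF].
    have k2 : (be * ramp c b x <= 1 - t)%R.
      by apply: (@le_trans _ _ (be * (b - c))%R); [rewrite ler_pM2l|rewrite /be divfK ?gt_eqF].
    by apply: le_trans (lerD k1 k2) _; rewrite addrC subrK.
  - exact: (top x0 Ox0 (ltW bM)).
  - by move=> x Ox bx; exact: (top x Ox (ltW bx)).
  - move=> x nu; rewrite /w /ramp !clampe_bot ?subrr ?mulr0 ?addr0//.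
    + by rewrite c0 ltW.
    + by move=> [Ox /= cx]; apply: nu; split => //=; rewrite (lt_trans _ cx)// lte_fin.
    + by rewrite a0 ltW.
  - by rewrite /Lp Igw ltry.
pose A := ((c - a)^-1 `^ p * J1)%R; pose B := ((b - c)^-1 `^ p * J2)%R.
have compE (t : R) : (0 < t < 1)%R ->
    ((t / (c - a)) `^ p * J1 + ((1 - t) / (b - c)) `^ p * J2 = A * t `^ p + B * (1 - t) `^ p)%R.
  move=> /andP[t0 t1]; rewrite !powRM ?invr_ge0 ?subr_ge0 ?(ltW t0) ?(ltW t1) ?(ltW alc) ?(ltW cb)//.
  by rewrite /A /B; ring.
pose t0 := ((c - a) / (b - a))%R.
have t0E : (1 - t0 = (b - c) / (b - a))%R by rewrite /t0; field; rewrite gt_eqF.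
have t01 : (0 < t0 < 1)%R by rewrite divr_gt0//= -subr_gt0 t0E divr_gt0.
(* At [t0] the two slopes agree and the rescaled energy of the competitor is [J1 + J2]. This is at
   most [J], which [comp] bounds by the value at any [t], so [t0] is a minimum. *)
have at0 : ((b - a) `^ p * (A * t0 `^ p + B * (1 - t0) `^ p) = J1 + J2)%R.
  rewrite -compE// t0E /t0.
  have e1 : ((c - a) / (b - a) / (c - a) = (b - a)^-1)%R by field; rewrite !gt_eqF.
  have e2 : ((b - c) / (b - a) / (b - c) = (b - a)^-1)%R by field; rewrite !gt_eqF.
  by rewrite e1 e2 -mulrDr mulrA -powRM ?invr_ge0 ?(ltW ba0)// mulfV ?gt_eqF// powR1 mul1r.
have bap : (0 < (b - a) `^ p)%R by rewrite powR_gt0.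
have bal : (A * t0 `^ (p - 1) = B * (1 - t0) `^ (p - 1))%R.
  apply: powR_balance => // t t01'.
  rewrite -(ler_pM2l bap) at0; apply: le_trans sub _; rewrite -compE//; exact: comp.
have pw1 (x : R) : (0 < x)%R -> (x `^ p = x `^ (p - 1) * x)%R.
  by move=> x_gt0; rewrite -[X in (_ * X)%R](powRr1 (ltW x_gt0)) -powRD ?subrK// gt_eqF ?implybT.
have bm0 : (0 < (b - a) `^ (p - 1))%R by rewrite powR_gt0.
have key (x J' : R) : (0 < x)%R -> (x^-1 `^ p * J' * (x / (b - a)) `^ (p - 1) = J' / x / (b - a) `^ (p - 1))%R.
  move=> x_gt0; rewrite powRM ?invr_ge0 ?(ltW x_gt0) ?(ltW ba0)// !powRV// pw1//.
  by field; rewrite !gt_eqF// powR_gt0.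
move: bal; rewrite t0E /A /B /t0 !key// => /(mulIf (invr_neq0 (lt0r_neq0 bm0))) bal.
(* The affine competitor also bounds [J] from above, so the level set carries no energy. *)
have J_eq : (J = J1 + J2)%R.
  by apply/eqP; rewrite eq_le sub andbT -at0 -compE//; exact: comp.
exists (J1 / (c - a))%R; rewrite E1 E2 E J_eq.
have J2E : (J2 = J1 / (c - a) * (b - c))%R by rewrite bal divfK ?gt_eqF.
by rewrite J2E; split; congr EFin; field; rewrite gt_eqF.
Qed.

Let integrable_bounded (f : X -> R) (c : R) : measurable_fun setT f -> (0 <= c)%R ->
  (forall x, `|f x| <= c)%R -> (forall x, ~ Om x -> f x = 0%R) -> mu.-integrable setT (EFin \o f).
Proof.
move=> mf c0 fc f0; apply/integrableP; split; first exact/measurable_EFinP.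
have cO : c%:E * mu Om < +oo by apply: lte_mul_pinfty.
apply: le_lt_trans cO; rewrite -integral_cst// [leRHS]integral_mkcond.
apply: ge0_le_integral_nomeas => x _; first exact: abse_ge0.
rewrite patchE; case: ifPn => [_|]; first by rewrite lee_fin.
by rewrite notin_setE => /f0 /= ->; rewrite normr0.
Qed.

(** With zero energy the truncation of [v] would vanish almost everywhere, because the complement of
    [Om] has positive capacity; but it is positive on a ball around the pole. *)
Let energy_gt0 (b : R) : (0 < b)%R -> b%:E < v x0 -> 0 < energy 0 b.
Proof.
move=> b0 bM; have b00 : (0 <= (0 : R) < b)%R by apply/andP; split.
have := integral_pow_ge0 (layer 0 b) G; rewrite le_eqVlt => /predU1P[/esym E|//].
have [mr _ _] := newton_ramp b00 (ltW bM) (energy_fin b00 bM).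
have rE x : ramp 0 b x = clampe 0 b (vh x) by rewrite /ramp subr0.
have ir : mu.-integrable setT (EFin \o ramp 0 b).
  apply: (@integrable_bounded _ b mr (ltW b0)) => x.
    by have /andP[h1 h2] := ramp_bounds x (ltW b0); rewrite ger0_norm// -[leRHS]subr0.
  by move=> nO; rewrite rE cut_notO// ltW.
have pr := pwug_ramp b00 (ltW bM).
have r_ae : {ae mu, forall x, ramp 0 b x = 0%R}.
  apply: (zero_gradient_vanish mr ir pr _ _ CpO); first by rewrite integral_pow_patch.
  by move=> x nO; rewrite rE cut_notO// ltW.
have /nbhs_ballP[r r0 BO] : nbhs x0 Om by exact: open_nbhs_nbhs.
have /andP[B0 _] := mu_balls x0 r0.
have [y By] := ae_point (measurable_ball x0 r) B0 r_ae.
rewrite rE; have := v_gt0 (BO _ By); rewrite vhE; last exact: BO.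
case: (v y) => [s||]//; rewrite ?clampey//; last by move=> _ e; move: b0; rewrite e ltxx.
rewrite lte_fin clampe_fin => s0; rewrite (max_idPl (ltW s0)) => /eqP.
by rewrite gt_eqF// lt_min s0.
Qed.

(** Splitting the layers from 0 carries the constant from the fixed level [b1] to every [b < v x0],
    and splitting at [a] handles the layer from [a] to [b]. For [b = v x0], where finiteness of the
    energy is not known beforehand, monotone convergence over levels below [b] is used. *)
Lemma energy_linear : exists2 Lam : R, (0 < Lam)%R &
  forall a b : R, (0 <= a < b)%R -> b%:E <= v x0 -> energy a b = (Lam * (b - a))%:E.
Proof.
have [s [s0 sM smono sex]] := exhausting_levels M_gt0.
have b0 := s0 0%N; have bM := sM 0%N; set b1 := s 0%N in b0 bM.
have lt0 (b : R) : (0 < b)%R -> (0 <= (0 : R) < b)%R by move=> ->; rewrite lexx.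
pose Lam := (fine (energy 0 b1) / b1)%R.
have E1 : energy 0 b1 = (Lam * b1)%:E.
  by rewrite /Lam divfK ?gt_eqF//; apply: energyE => //; exact: lt0.
have Lam0 : (0 < Lam)%R.
  by have := energy_gt0 b0 bM; rewrite E1 lte_fin pmulr_lgt0.
have lin0 (b : R) : (0 < b)%R -> b%:E < v x0 -> energy 0 b = (Lam * b)%:E.
  move=> b_gt0 bM'; have [lt|lt|->] := ltgtP b b1; last exact: E1.
  - have [k [h1 _ h3]] := energy_split (lt0 _ b_gt0) lt bM.
    move: h1 h3; rewrite E1 !subr0 => -> -[/(mulIf (lt0r_neq0 b0)) ->]//.
  - have [k [h1 _ h3]] := energy_split (lt0 _ b0) lt bM'.
    by move: h1 h3; rewrite E1 !subr0 => -[/(mulIf (lt0r_neq0 b0)) ->].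
have lin (a b : R) : (0 <= a < b)%R -> b%:E < v x0 -> energy a b = (Lam * (b - a))%:E.
  move=> /andP[]; rewrite le_eqVlt => /predU1P[<- b_gt0 bM'|a_gt0 ab bM'].
    by rewrite subr0; exact: lin0.
  have b_gt0 : (0 < b)%R by exact: lt_trans ab.
  have [k [_ h2 h3]] := energy_split (lt0 _ a_gt0) ab bM'.
  by move: h2 h3; rewrite lin0// subr0 => -> -[/(mulIf (lt0r_neq0 b_gt0)) ->].
exists Lam => // a b ab; rewrite le_eqVlt => /predU1P[bE|]; last exact: lin.
have /andP[a0 alb] := ab.
have sb n : (s n < b)%R by rewrite -lte_fin bE.
have lE : layer a b = \bigcup_n layer a (s n).
  apply/seteqP; split => [x [Vx /andP[l1 l2]]|x [n _ [Vx /andP[l1 l2]]]].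
    have [n ln] : exists n, (fine (v x) < s n)%R by apply: sex; rewrite -(vV Vx) -bE.
    by exists n => //; split => //=; rewrite l1 (vV Vx) lte_fin.
  by split => //=; rewrite l1 (lt_trans l2)// lte_fin.
have cv : energy a (s n) @[n --> \oo] --> energy a b.
  rewrite lE; apply: ge0_nondecreasing_set_cvg_integral.
  - move=> i j ij; apply/subsetPset => x [Vx /andP[l1 l2]]; split => //=.
    by rewrite l1 (lt_le_trans l2)// lee_fin smono.
  - by move=> n; exact: mL.
  - by move=> n; exact/measurable_pow/borel_fun_measurable.
  - by move=> n x _; exact: poweR_ge0.
have cv' : energy a (s n) @[n --> \oo] --> (Lam * (b - a))%:E.
  have [N HN] : exists n, (a < s n)%R by apply: sex; rewrite -bE lte_fin.
  have : (Lam * (s n - a))%:E @[n --> \oo] --> (Lam * (b - a))%:E.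
    apply: cvg_EFin; first exact: nearW.
    apply: cvgMr; apply: cvgB; last exact: cvg_cst.
    apply/cvgrPdist_le => e e0; have [k Hk] : exists n, (b - e < s n)%R.
      by apply: sex; rewrite -bE lte_fin ltrBlDr ltrDl.
    near=> n; have kn : (k <= n)%N by near: n; exact: nbhs_infty_ge.
    rewrite ger0_norm ?subr_ge0 ?ltW//.
    by rewrite ltrBlDr -ltrBlDl (lt_le_trans Hk)// smono.
  apply: cvg_trans; apply: near_eq_cvg; near=> n.
  have Nn : (N <= n)%N by near: n; exact: nbhs_infty_ge.
  by rewrite lin// a0 (lt_le_trans HN)// smono.
exact: (cvg_unique _ cv cv').
Unshelve. all: by end_near. Qed.

(** If [v x0] is infinite, the truncation at [n] divided by [n] is 1 at the pole, tends to 0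
    elsewhere and has energy Lam n^(1 - p), which tends to 0. If [v x0 = m] is finite, zero capacity
    would give competitors of arbitrarily small energy, against the bound Lam m^(1 - p) from
    [energy_lower]. *)
Lemma Cp_point_pole : (Cp mu p [set x0] == 0) = (v x0 == +oo).
Proof.
have [Lam Lam0 lin] := energy_linear.
apply/idP/idP => [/eqP Cp0|/eqP vy]; last first.
  apply/eqP; apply: Cp_point_eq0 => e e0.
  pose w (n : nat) x : R := (n.+1%:R^-1 * ramp 0 n.+1%:R x)%R.
  have n0 n : (0 < n.+1%:R :> R)%R by [].
  have n0' n : (0 <= (0 : R) < n.+1%:R)%R by rewrite lexx n0.
  have nM n : (n.+1%:R)%:E <= v x0 by rewrite vy leey.
  have fin n : energy 0 n.+1%:R < +oo by rewrite lin// ltry.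
  have Nr n := newton_ramp (n0' n) (nM n) (fin n).
  have mr n : measurable_fun setT (ramp 0 n.+1%:R) by case: (Nr n).
  have mw n : measurable_fun setT (w n).
    by apply: measurable_funM; [exact: measurable_cst|exact: mr].
  have w01 n x : (0 <= w n x <= 1)%R.
    have /andP[h1 h2] := ramp_bounds x (ltW (n0 n)).
    by rewrite /w mulr_ge0 //= mulrC ler_pdivrMr// mul1r -[leRHS]subr0.
  have wO n x : ~ Om x -> w n x = 0%R.
    by move=> nO; rewrite /w /ramp cut_notO// subrr mulr0.
  have iw n : mu.-integrable setT (EFin \o w n).
    apply: (@integrable_bounded _ 1%R (mw n) ler01) => x; last exact: wO.
    by have /andP[h1 h2] := w01 n x; rewrite ger0_norm.
  have pw n : pwug setT (w n) (fun x => (n.+1%:R^-1)%:E * (G \_ (layer 0 n.+1%:R)) x).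
    by have := pwugM (n.+1%:R^-1)%R (pwug_ramp (n0' n) (nM n)); rewrite gtr0_norm ?invr_gt0.
  have mC : measurable (~` [set x0]).
    by apply: measurableC; apply: borel_set_measurable; exact: borel_set_singleton.
  have Iw : \int[mu]_(x in ~` [set x0]) (w n x)%:E @[n --> \oo] --> 0.
    have i1 : mu.-integrable (~` [set x0]) (EFin \o (fun x => \1_Om x : R)).
      apply: (integrableS measurableT) => //.
      apply: (@integrable_bounded _ 1%R) => //.
      - exact: measurable_indic.
      - by move=> x; rewrite indicE; case: (x \in Om); rewrite ?normr1 ?normr0.
      - by move=> x nO; rewrite indicE memNset.
    have c1 : {ae mu, forall x, (~` [set x0]) x -> (w n x)%:E @[n --> \oo] --> (cst 0 : X -> \bar R) x}.
      apply/aeW => x xx0; apply: cvg_EFin; first exact: nearW.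
      have [r vr] : exists2 r : R, (0 <= r)%R & vh x = r%:E.
        have [Ox|/vh0 ->] := pselect (Om x); last by exists 0%R.
        exists (fine (v x)); last by rewrite vhE// vV.
        by rewrite fine_ge0// ltW// v_gt0.
      move=> vE; apply/cvgrPdist_le => k k0.
      near=> n; have nk : (Num.truncn (r / k) <= n)%N by near: n; exact: nbhs_infty_ge.
      rewrite sub0r normrN ger0_norm; last by case/andP: (w01 n x).
      rewrite /= /w /ramp vE clampe_fin (max_idPl vr) subr0 mulrC ler_pdivrMr//.
      rewrite ge_min; apply/orP; left; rewrite mulrC -ler_pdivrMr//.
      by apply: ltW; apply: lt_le_trans (truncnS_gt _) _; rewrite ler_nat ltnS.
    have c2 : {ae mu, forall x n, (~` [set x0]) x -> `|(w n x)%:E| <= (\1_Om x : R)%:E}.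
      apply/aeW => x n _; have /andP[h1 h2] := w01 n x; rewrite abse_EFin lee_fin ger0_norm//.
      by rewrite indicE; have [Ox|nO] := pselect (Om x); [rewrite mem_set|rewrite memNset// wO].
    have mwC n : measurable_fun (~` [set x0]) (fun x => (w n x)%:E).
      by apply/measurable_EFinP; exact: measurable_funTS.
    have [_ _] := dominated_convergence mC mwC (measurable_cst 0) c1 i1 c2.
    by rewrite integral_cst// mul0e.
  have [n [In en]] : exists n, \int[mu]_(x in ~` [set x0]) (w n x)%:E <= e%:E /\
      (n.+1%:R^-1 `^ p * (Lam * n.+1%:R) <= e)%R.
    have p1 : (0 < p - 1)%R by rewrite subr_gt0.
    have q0 : (0 < (p - 1)^-1)%R by rewrite invr_gt0.
    (* Once n + 1 >= [b], the energy Lam (n + 1)^(1 - p) is at most [e]. *)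
    pose b := ((Lam / e) `^ (p - 1)^-1)%R.
    have near1 : \forall n \near \oo, \int[mu]_(x in ~` [set x0]) (w n x)%:E < e%:E.
      apply: (Iw [set y | y < e%:E]); apply: open_nbhs_nbhs; split; last by rewrite /= lte_fin.
      exact: open_ereal_lt_ereal.
    near \oo => n; exists n; split; first by apply: ltW; near: n.
    have nb : (b <= n.+1%:R)%R.
      have nk : (Num.truncn b <= n)%N by near: n; exact: nbhs_infty_ge.
      by apply: ltW; apply: lt_le_trans (truncnS_gt _) _; rewrite ler_nat ltnS.
    have nb' : (Lam / e <= n.+1%:R `^ (p - 1))%R.
      have -> : (Lam / e = b `^ (p - 1))%R.
        by rewrite /b -powRrM mulVf ?gt_eqF// powRr1// divr_ge0// ltW.
      by apply: ge0_ler_powR => //; rewrite ?nnegrE ?powR_ge0// ltW.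
    have pE : (n.+1%:R `^ p = n.+1%:R `^ (p - 1) * n.+1%:R :> R)%R.
      by rewrite -[X in (_ * X)%R]powRr1// -powRD ?subrK// gt_eqF ?implybT.
    rewrite powRV// pE; have np : (0 < n.+1%:R `^ (p - 1) :> R)%R by rewrite powR_gt0.
    have -> : ((n.+1%:R `^ (p - 1) * n.+1%:R)^-1 * (Lam * n.+1%:R) = Lam / n.+1%:R `^ (p - 1))%R.
      by field; rewrite gt_eqF// addrC natr1 gt_eqF.
    by rewrite ler_pdivrMr// mulrC -ler_pdivrMr.
  exists (w n), (fun x => (n.+1%:R^-1)%:E * (G \_ (layer 0 n.+1%:R)) x); split => //.
    by rewrite /w /ramp clampe_top// subr0 mulVf.
  split => //; rewrite integral_powZ ?invr_gt0//.
  - by rewrite integral_pow_patch lin// subr0 -EFinM lee_fin.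
  - by apply: borel_fun_measurable; apply: borel_fun_patch => //; apply: open_borel_set; exact: open_layer.
  - by move=> x _; exact: erestrict_ge0.
have : v x0 != -oo by rewrite gt_eqF// (lt_trans _ M_gt0)// ltNyr.
case vE : (v x0) => [m||]// _; have m0 : (0 < m)%R by rewrite -lte_fin -vE.
have ab : (0 <= (0 : R) < m)%R by rewrite lexx.
have mM : m%:E <= v x0 by rewrite vE.
(* Half of the least energy that [energy_lower] allows for a competitor. *)
pose e := (Lam * m / m `^ p / 2)%R.
have mp0 : (0 < m `^ p)%R by rewrite powR_gt0.
have e0 : (0 < e)%R by rewrite !divr_gt0// mulr_gt0.
have [w [g [mw w01 w1 w0 [pg ge]]]] := Cp0_competitor oO Ox0 Cp0 e0.
have fin : energy 0 m < +oo by rewrite lin// ltry.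
have := @energy_lower 0%R m w g ab mM fin mw w01 w1 _ _ pg _; rewrite lin// subr0 => H.
have : (Lam * m)%:E <= (m `^ p)%:E * e%:E.
  apply: (le_trans (H _ _ _)).
  - by move=> x Ox; rewrite -vE ltNge v_le.
  - by move=> x nu; apply: w0 => Ox; apply: nu; split => //=; exact: v_gt0.
  - by apply: lt_trans ge _; exact: ltry.
  - by apply: lee_wpmul2l; [rewrite lee_fin ltW|exact: ltW].
rewrite -EFinM lee_fin /e.
have -> : (m `^ p * (Lam * m / m `^ p / 2) = Lam * m / 2)%R by field; rewrite gt_eqF.
rewrite leNgt ltr_pdivrMr// => /negP[].
by rewrite ltr_pMr ?mulr_gt0// ltr1n.
Unshelve. all: by end_near. Qed.

Lemma capp_affine : exists2 Lam : R, (0 < Lam)%R & forall (a b : R) (E : set X),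
  (0 <= a < b)%R -> b%:E <= v x0 -> E x0 -> upper b `<=` E ->
  (forall x, E x -> Om x /\ b%:E <= v x) ->
  capp mu p E (upper a) = (Lam * (b - a) `^ (1 - p))%:E.
Proof.
have [Lam Lam0 lin] := energy_linear; exists Lam => // a b E ab bM Ex0 bE Eb.
have ba0 : (0 < b - a)%R by rewrite subr_gt0; case/andP: ab.
rewrite (capp_level ab bM _ Ex0 bE Eb); last by rewrite lin// ltry.
rewrite lin// -EFinM; congr EFin; rewrite powRV// -powRN mulrCA; congr (_ * _)%R.
rewrite -[X in (_ * X)%R](powRr1 (ltW ba0)) -powRD; first by rewrite [(- p + 1)%R]addrC.
by rewrite (gt_eqF ba0) implybT.
Qed.

End singular_potential.

(** Discharges the auxiliary gradient; what remains is the behaviour at the pole and a single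
    constant. *)
Lemma singular_capacity (Om : set X) (x0 : X) (v : X -> \bar R) : open Om -> metric_bounded Om ->
  0 < Cp mu p (~` Om) -> Om x0 -> singular_function mu p Om x0 v ->
  (Cp mu p [set x0] == 0) = (v x0 == +oo) /\
  exists2 Lam : R, (0 < Lam)%R & forall (a b : R) (E : set X),
    (0 <= a < b)%R -> b%:E <= v x0 -> E x0 -> Om `&` [set x | b%:E < v x] `<=` E ->
    (forall x, E x -> Om x /\ b%:E <= v x) ->
    capp mu p E (Om `&` [set x | a%:E < v x]) = (Lam * (b - a) `^ (1 - p))%:E.
Proof.
move=> oO bO CpO Ox0 vs.
have [G [bG G0 minG locG [layG resG LG]]] := exists_singular_gradient oO bO Ox0 vs.
split.
- exact: (Cp_point_pole oO bO CpO Ox0 vs bG G0 minG locG layG resG LG).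
- exact: (capp_affine oO bO CpO Ox0 vs bG G0 minG locG layG resG LG).
Qed.

(** * Normalization of the Green function *)

Lemma epow_EFin (x s : R) : (0 < x)%R -> epow x%:E s = (x `^ s)%:E.
Proof.
move=> x0; rewrite /epow; case: ifPn => // _; rewrite poweR_EFin inver gt_eqF ?powR_gt0//.
by rewrite powRN invrK.
Qed.

Lemma capp_ge0 (E A : set X) : 0 <= capp mu p E A.
Proof. by apply: le_ereal_inf_tmp => _ [u _ <-]; exact: integral_pow_ge0. Qed.

Lemma capp_le (E E' A : set X) : E `<=` E' -> capp mu p E A <= capp mu p E' A.
Proof.
move=> EE'; apply: le_ereal_inf => _ [u [Nu u1 u0] <-]; exists u => //; split => //.
by move=> x /EE'; exact: u1.
Qed.

Section green_normalization.
Variables (Om : set X) (x0 : X) (v : X -> \bar R) (Lam : R).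
Hypotheses (oO : open Om) (Ox0 : Om x0) (vs : singular_function mu p Om x0 v).
Hypothesis pole : (Cp mu p [set x0] == 0) = (v x0 == +oo).
Hypothesis Lam0 : (0 < Lam)%R.
Hypothesis cappE : forall (a b : R) (E : set X),
  (0 <= a < b)%R -> b%:E <= v x0 -> E x0 -> Om `&` [set x | b%:E < v x] `<=` E ->
  (forall x, E x -> Om x /\ b%:E <= v x) ->
  capp mu p E (Om `&` [set x | a%:E < v x]) = (Lam * (b - a) `^ (1 - p))%:E.

Local Notation q := ((1 - p)^-1)%R.
Local Notation al := (Lam `^ q)%R.

Let np0 : (1 - p != 0)%R. Proof. by rewrite subr_eq0 lt_eqF. Qed.
Let al0 : (0 < al)%R. Proof. exact: powR_gt0. Qed.
Let al_pow : (al `^ (1 - p) = Lam)%R.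
Proof. by rewrite -powRrM mulVf// powRr1// ltW. Qed.

Let v_gt0 x : Om x -> 0 < v x. Proof. by case: vs => + _; exact. Qed.

Let capp_superlevel (a b c : R) : (0 < c)%R -> (0 <= a < b)%R -> b%:E <= c%:E * v x0 ->
  capp mu p [set x | Om x /\ b%:E <= c%:E * v x] [set x | Om x /\ a%:E < c%:E * v x] =
  (Lam * ((b - a) / c) `^ (1 - p))%:E.
Proof.
move=> c0 /andP[a0 ab] bM.
have le (r : R) x : (r%:E <= c%:E * v x) = ((r / c)%:E <= v x).
  by rewrite EFinM lee_pdivrMr// muleC.
have lt (r : R) x : (r%:E < c%:E * v x) = ((r / c)%:E < v x).
  by rewrite EFinM lte_pdivrMr// muleC.
have -> : [set x | Om x /\ a%:E < c%:E * v x] = Om `&` [set x | (a / c)%:E < v x].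
  by apply/seteqP; split => x [Ox] /=; rewrite lt.
rewrite (cappE (a := (a / c)%R) (b := (b / c)%R)).
- by rewrite mulrBl.
- by rewrite divr_ge0 ?ltr_pM2r ?invr_gt0// ltW.
- by rewrite -le.
- by split.
- by move=> x [Ox bx]; split => //; rewrite le; exact: ltW.
- by move=> x [Ox]; rewrite le.
Qed.

(** Since [v] is positive, [Om] is itself a strict superlevel set, at level 0, so capacities
    relative to [Om] are a case of [cappE]. *)
Let Om_pos (c : R) : (0 < c)%R -> Om = [set x | Om x /\ 0%:E < c%:E * v x].
Proof.
move=> c0; apply/seteqP; split => x; last by case.
by move=> Ox; split => //; rewrite mule_gt0 ?lte_fin// v_gt0.
Qed.

(** If [v x0] is infinite, the level 1 is available and its capacity is [Lam]. If [v x0 = m], the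
    pole has capacity Lam m^(1 - p); the exponent turns this into Lam^(1 / (1 - p)) m, and the
    division by [v x0] removes the factor [m]. *)
Lemma green_constantE : green_constant mu p Om x0 v = al%:E.
Proof.
have v1 x : 1 * v x = v x by rewrite mul1e.
rewrite /green_constant pole; case: ifPn => [/eqP vy|].
  have := @capp_superlevel 0%R 1%R 1%R ltr01 _ _; rewrite lexx ltr01 vy mul1e leey => /(_ isT isT).
  rewrite -(Om_pos ltr01) subr0 divr1 powR1 mulr1.
  have -> : [set x | Om x /\ 1%:E <= 1 * v x] = [set x | Om x /\ 1 <= v x].
    by apply/seteqP; split => x [Ox] /=; rewrite mul1e.
  by move=> ->; exact: epow_EFin.
have := v_gt0 Ox0; case vE : (v x0) => [m||]// + _; rewrite lte_fin => m0.
have -> : capp mu p [set x0] Om = (Lam * m `^ (1 - p))%:E.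
  rewrite {1}(Om_pos ltr01).
  have -> : [set x | Om x /\ 0%:E < 1 * v x] = Om `&` [set x | 0%:E < v x].
    by apply/seteqP; split => x [Ox] /=; rewrite mul1e.
  rewrite (cappE (a := 0%R) (b := m)) ?subr0 ?vE//.
  - by rewrite lexx m0.
  - move=> x [Ox /=]; rewrite -vE ltNge; case: vs => _ [_ _ -> _ _].
    by rewrite ereal_sup_ubound//; exists x.
  - by move=> _ ->; rewrite vE lexx.
rewrite epow_EFin ?mulr_gt0 ?powR_gt0// inver gt_eqF// -EFinM; congr EFin.
by rewrite powRM ?powR_ge0 ?(ltW Lam0)// -powRrM mulfV// powRr1 ?(ltW m0)// mulrCA mulVf ?mulr1// gt_eqF.
Qed.

Lemma capp_layer (a b : \bar R) : 0 <= a -> a < b -> b <= al%:E * v x0 ->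
  capp mu p [set x | Om x /\ b <= al%:E * v x] [set x | Om x /\ a < al%:E * v x] =
  epow (b - a) (1 - p)%R.
Proof.
case: a => [a||]//; rewrite ?lee_fin => a0; last by rewrite ltNge leey.
have finE (b' : R) : (a < b')%R -> b'%:E <= al%:E * v x0 ->
    capp mu p [set x | Om x /\ b'%:E <= al%:E * v x] [set x | Om x /\ a%:E < al%:E * v x] =
    ((b' - a) `^ (1 - p))%:E.
  move=> ab bM; rewrite capp_superlevel ?a0// powRM ?invr_ge0 ?subr_ge0 ?(ltW ab) ?(ltW al0)//.
  by rewrite powRV// al_pow mulrCA mulfV ?mulr1// gt_eqF.
case: b => [b||//].
  rewrite lte_fin => ab bM; rewrite finE// -EFinB epow_EFin// subr_gt0//.
move=> _; rewrite leye_eq => /eqP vy.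
have -> : epow (+oo - a%:E) (1 - p) = 0.
  by rewrite addye// /epow subr_lt0 p_gt1 poweRyr ?oppr_eq0// invey.
apply/eqP; rewrite eq_le capp_ge0 andbT; apply/lee_addgt0Pr => e e0; rewrite add0e.
(* The set where the function is infinite lies in every superlevel set, and the one at level a +
   e^q, with [q] the inverse of [1 - p], has capacity exactly [e]. *)
have eq0 : (0 < e `^ q)%R by rewrite powR_gt0.
have /finE : (a < a + e `^ q)%R by rewrite ltrDl.
rewrite vy leey => /(_ isT); rewrite addrAC subrr add0r -powRrM mulVf// powRr1 ?(ltW e0)// => <-.
by apply: capp_le => x [Ox ux]; split => //; apply: le_trans ux; exact: leey.
Qed.

Lemma green_normalization : green_function mu p Om x0 (fun x => al%:E * v x).
Proof.
split; first exact: singular_functionZ.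
move=> b b0 bM; rewrite [X in capp mu p _ X](Om_pos al0) capp_layer ?lte_fin ?(ltW bM)//.
by rewrite sube0.
Qed.

(** Positivity at the pole forces [beta > 0], and then one level suffices: for [0 < b < v x0] the
    superlevel set of [beta v] at level [beta * b] is that of [v] at [b], with capacity Lam b^(1 -
    p). Hence beta^(1 - p) is [Lam]. *)
Lemma green_constant_unique (beta : R) :
  green_function mu p Om x0 (fun x => beta%:E * v x) -> beta = al.
Proof.
move=> [[pos _] H].
have beta0 : (0 < beta)%R.
  have := pos x0 Ox0; rewrite ltNge => h; rewrite ltNge; apply: contra h => b0.
  by apply: mule_le0_ge0; [rewrite lee_fin|exact/ltW/v_gt0].
have [s [s0 sM _ _]] := exhausting_levels (v_gt0 Ox0).
have b0 := s0 0%N; have bM := sM 0%N; set b := s 0%N in b0 bM.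
have bM' : (beta * b)%:E < beta%:E * v x0 by rewrite EFinM lte_pmul2l// lte_fin.
have bb0 : (0 < beta * b)%R by exact: mulr_gt0.
have := H _ bb0 bM'; rewrite [X in capp mu p _ X](Om_pos beta0) capp_superlevel ?lexx ?bb0 ?(ltW bM')//.
rewrite epow_EFin// subr0 mulrAC mulfV ?gt_eqF// mul1r => -[].
rewrite powRM ?(ltW beta0) ?(ltW b0)// => /(mulIf (lt0r_neq0 (powR_gt0 _ b0))) ->.
by rewrite -powRrM mulfV// powRr1// ltW.
Qed.

End green_normalization.
End newtonian_calculus.

Theorem theorem9p3 (R : realType) (d : measure_display)
    (X : measMetricType d R) (mu : {measure set X -> \bar R}) (p : R)
    (Omega : set X) (x0 : X) (v : X -> \bar R)
    (p_gt1 : (1 < p)%R)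
    (two_points : exists x y : X, x <> y)
    (X_complete : @complete_space R X)
    (mu_borel : completed_borel mu)
    (mu_balls : balls_pos_finite mu)
    (mu_doubling : doubling mu)
    (X_poincare : poincare mu p)
    (Omega_domain : domain Omega)
    (Omega_bounded : metric_bounded Omega)
    (Omega_Cp : 0 < Cp mu p (~` Omega))
    (Omega_x0 : Omega x0)
    (v_singular : singular_function mu p Omega x0 v) :
  let alpha := green_constant mu p Omega x0 v in
  let u := fun x => alpha * v x in
  [/\ green_function mu p Omega x0 u,
      forall a b : \bar R, 0 <= a -> a < b -> b <= u x0 ->
        capp mu p [set x | Omega x /\ b <= u x] [set x | Omega x /\ a < u x]
          = epow (b - a) (1 - p)%R &
      forall beta : R,
        green_function mu p Omega x0 (fun x => beta%:E * v x) ->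
        beta%:E = alpha].
Proof.
have [_ oO _] := Omega_domain; move=> /=.
have [pole [Lam Lam0 cappE]] := singular_capacity p_gt1 mu_borel mu_balls mu_doubling X_complete
  X_poincare two_points oO Omega_bounded Omega_Cp Omega_x0 v_singular.
rewrite (green_constantE p_gt1 Omega_x0 v_singular pole Lam0 cappE); split.
- exact: green_normalization.
- exact: capp_layer.
- by move=> beta Gbeta; congr EFin; exact: green_constant_unique Gbeta.
Qed.
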